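(* In the setting described in the context (separable real Hilbert space $E$, generalized Mehler semigroup with characteristics $[b,Q,\nu]$ and $(S(t))_{t\ge0}$, invariant measure $\gamma*\pi$), assume that $q_0\in(0,\infty)$. Then, for every $r\in[2,\infty)$ and every $f\in\mathcal FC^2_A(E)$, $$\int_E\mathrm{Ent}_\gamma\big(|f(\cdot+y)|^r\big)\,d\pi(y)\le\frac{r^2}{2q_0}\int_E|f|^{r-2}\langle QDf,Df\rangle\,d(\gamma*\pi)+\frac{r}{(r-1)q_0}\int_E\int_E\mathrm D_{|\cdot|^r}\big(f(x+y),f(x)\big)\,d\nu(y)\,d(\gamma*\pi)(x).$$
   Context: $E$ is a separable real Hilbert space, identified with its dual; $B_1$ is the closed unit ball. Data: $b\in E$, $Q$ a nonnegative symmetric trace-class operator on $E$, $\nu$ a Lévy measure on $E$ ($\nu(\{0\})=0$, $\int_E\min\{1,\|x\|^2\}d\nu<\infty$), $\lambda(\xi)=-i\langle b,\xi\rangle+\frac12\langle Q\xi,\xi\rangle+\int_E(1-e^{i\langle\xi,y\rangle}+i\langle\xi,y\rangle\chi_{B_1}(y))d\nu(y)$, and $(S(t))_{t\ge0}$ a strongly continuous semigroup on $E$. Standing assumptions: (i) the generator $A:D(A)\subseteq E\to E$ of $(S(t))_{t\ge0}$ satisfies $\langle A\xi,\xi\rangle<0$ for all $\xi\in D(A)\setminus\{0\}$; (ii) there is an orthonormal basis $\{h_n\}_{n\in\mathbb N}$ of $E$ consisting of eigenvectors of $A^*$; (iii) $\int_{\{\|x\|\ge1\}}\|x\|\,d\nu(x)<\infty$.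 Generalized Mehler semigroup: $(P(t)f)(x)=\int_Ef(S(t)x+y)d\mu_t(y)$, where $\widehat\mu_t(\xi)=\exp(-\int_0^t\lambda(S(r)^*\xi)dr)$. Put $Q_\infty=\int_0^\infty S(r)QS(r)^*dr$; $\nu_\infty(\{0\})=0$, $\nu_\infty(B)=\int_0^\infty\nu(S(r)^{-1}(B))dr$ for Borel $B\not\ni0$; $b_\infty=\lim_{t\to\infty}\big[\int_0^tS(r)b\,dr+\int_0^t\int_ES(r)x(\chi_{B_1}(S(r)x)-\chi_{B_1}(x))d\nu(x)dr\big]$. Let $\gamma=\mathcal N(0,Q_\infty)$, let $H$ be its Cameron--Martin space, and let $\pi$ be the probability measure with characteristic function $\exp(i\langle b_\infty,\xi\rangle+\int_E(e^{i\langle\xi,y\rangle}-1-i\langle\xi,y\rangle\chi_{B_1}(y))d\nu_\infty(y))$. The source states, as a consequence of (i)--(iii) and not as an additional hypothesis, that these objects are well defined ($Q_\infty$ trace class, $\nu_\infty$ a Lévy measure, $b_\infty$ exists) and that $\gamma*\pi$ is the unique invariant measure of $(P(t))_{t\ge0}$. The operator $S(t)$ maps $H$ into $H$ contractively. $q_0:=\liminf_{h\to0^+}\frac1h\big(\|S(h)_{|_H}\|_{\mathcal L(H)}^{-2}-1\big)$. Function classes: $f\in C^2_A(E)$ if $f\in C_b(E)\cap C^2(E)$, its first and second order derivatives are uniformly bounded and uniformly continuous on bounded subsets of $E$, $Df(E)\subseteq D(A^* )$ and $x\mapsto\langle x,A^*Df(x)\rangle$ is in $C_b(E)$. $F\in\mathcal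 FC^2_A(E)$ if $F(x)=f(\langle x,h_1\rangle,\dots,\langle x,h_n\rangle)$ for some $n\in\mathbb N$ and $f\in C^2_A(\mathbb R^n)$, where on $\mathbb R^n$ the role of $A^*$ is played by the diagonal matrix of the eigenvalues of $A^*$ at $h_1,\dots,h_n$. $Df$ denotes the gradient of $f$ in $E$. Notation: $\mathrm{Ent}_\gamma(\psi)=\int_E\psi\ln\psi\,d\gamma-\big(\int_E\psi\,d\gamma\big)\ln\big(\int_E\psi\,d\gamma\big)$ for $\psi\ge0$ (with $0\ln0=0$). Bregman divergence: $\mathrm D_{|\cdot|^r}(x,y)=|x|^r-|y|^r-r|y|^{r-1}\operatorname{sgn}(y)(x-y)$ for $x,y\in\mathbb R$. *)

(* Defs.v *)
From HB Require Import structures.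
From mathcomp Require Import all_boot all_order all_algebra.
From mathcomp Require Import all_classical all_reals all_analysis.
From mathcomp Require Export complex.

Set Implicit Arguments.
Unset Strict Implicit.
Unset Printing Implicit Defensive.

Import Order.TTheory GRing.Theory Num.Theory.
Import numFieldNormedType.Exports.

Local Open Scope classical_set_scope.
Local Open Scope ring_scope.

HB.mixin Record CompleteNormedModule_isHilbert (R : realType) E
    of CompleteNormedModule R E := {
  inner : E -> E -> R ;
  innerC : forall x y, inner x y = inner y x ;
  innerDl : forall x y z, inner (x + y) z = inner x z + inner y z ;
  innerZl : forall (a : R) x y, inner (a *: x) y = a * inner x y ;
  inner_norm : forall x, inner x x = `|x| ^+ 2
}.

#[short(type="hilbertType")]
HB.structure Definition Hilbert (R : realType) :=
  {E of CompleteNormedModule R E & CompleteNormedModule_isHilbert R E}.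

(* A hilbertType equipped with its Borel sigma-algebra. *)
Notation borel E := (g_sigma_algebraType (@open E)).

Section Integrals.
Context {R : realType}.

Definition cexp (z : R[i]) : R[i] :=
  Complex (expR (complex.Re z) * cos (complex.Im z))
          (expR (complex.Re z) * sin (complex.Im z)).

Definition cintegral d (T : measurableType d)
    (mu : {measure set T -> \bar R}) (D : set T) (f : T -> R[i]) : R[i] :=
  Complex (\int[mu]_(x in D) complex.Re (f x))%R
          (\int[mu]_(x in D) complex.Im (f x))%R.

(* Weak (Pettis) integral of an E-valued function; it agrees with the Bochner
   integral whenever the latter exists. *)
Definition is_vintegral (E : hilbertType R) d (T : measurableType d)
    (mu : {measure set T -> \bar R}) (D : set T) (f : T -> E) (v : E) : Prop :=
  forall y : E, mu.-integrable D (EFin \o (fun t => inner (f t) y)) /\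
    inner v y = (\int[mu]_(t in D) inner (f t) y)%R.

Definition vintegral (E : hilbertType R) d (T : measurableType d)
    (mu : {measure set T -> \bar R}) (D : set T) (f : T -> E) : E :=
  xget 0 [set v | is_vintegral mu D f v].

End Integrals.

Section Operators.
Context {R : realType} {E : hilbertType R}.

Definition separable_space : Prop := exists2 A : set E, countable A & dense A.

Definition hilbert_basis (e : nat -> E) : Prop :=
  (forall i j, inner (e i) (e j) = (i == j)%:R) /\
  (forall x, series (fun n => inner x (e n) *: e n) @ \oo --> x).

(* For Q nonnegative and symmetric, |Q| = Q, so that Q is trace class iff the
   sum below is finite in one (equivalently, every) orthonormal basis. *)
Definition nonneg_sym_trace_class (Q : {linear E -> E}) : Prop :=
  [/\ continuous Q,
      (forall x y, inner (Q x) y = inner x (Q y)),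
      (forall x, 0 <= inner (Q x) x) &
      exists2 e, hilbert_basis e &
        (\sum_(0 <= k <oo) (inner (Q (e k)) (e k))%:E < +oo)%E].

(* Adjoint of an operator T with domain D, which is meant to be dense. *)
Definition adj_dom (D : set E) (T : E -> E) : set E :=
  [set y | exists z, forall x, D x -> inner (T x) y = inner x z].

Definition adj (D : set E) (T : E -> E) (y : E) : E :=
  xget 0 [set z | forall x, D x -> inner (T x) y = inner x z].

(* The values S t for t < 0 are irrelevant. *)
Record C0_semigroup (S : R -> {linear E -> E}) : Prop := {
  semigroup_continuous : forall t, 0 <= t -> continuous (S t) ;
  semigroup0 : forall x, S 0 x = x ;
  semigroupD : forall s t x, 0 <= s -> 0 <= t -> S (s + t) x = S s (S t x) ;
  semigroup_strong : forall x, S t x @[t --> 0^'+] --> x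
}.

Definition gen_dom (S : R -> {linear E -> E}) : set E :=
  [set x | cvg (t^-1 *: (S t x - x) @[t --> 0^'+])].

Definition gen (S : R -> {linear E -> E}) (x : E) : E :=
  lim (t^-1 *: (S t x - x) @[t --> 0^'+]).

Definition adjoint_eigenbasis (S : R -> {linear E -> E})
    (h : nat -> E) (alpha : nat -> R) : Prop :=
  hilbert_basis h /\
  forall n, adj_dom (gen_dom S) (gen S) (h n) /\
            adj (gen_dom S) (gen S) (h n) = alpha n *: h n.

End Operators.
Arguments separable_space {R} E.

Section Mehler.
Context {R : realType} {E : hilbertType R}.
Implicit Types (b xi : E) (Q : {linear E -> E}) (S : R -> {linear E -> E}).
Implicit Types nu : {measure set (borel E) -> \bar R}.

(* Indicator function of the closed unit ball. *)
Definition chiB1 (x : E) : R := (`|x| <= 1)%R%:R.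

Definition levy_measure nu : Prop :=
  nu [set (0 : E)] = 0%E /\
  (\int[nu]_x (Num.min 1 (`|x : E| ^+ 2))%:E < +oo)%E.

Definition charfun (mu : {measure set (borel E) -> \bar R}) xi : R[i] :=
  cintegral mu setT (fun x => cexp ('i * (inner xi x)%:C)%C).

Definition mehler_symbol b Q nu xi : R[i] :=
  (- 'i * (inner b xi)%:C + (2^-1 * inner (Q xi) xi)%:C
   + cintegral nu setT (fun y => 1 - cexp ('i * (inner xi y)%:C)
                                 + 'i * (inner xi y * chiB1 y)%:C))%C.

Definition mehler_semigroup b Q nu S (P : R -> (E -> R) -> E -> R) : Prop :=
  exists mu : R -> probability (borel E) R, forall t, 0 <= t ->
    (forall xi, charfun (mu t) xi =
       cexp (- cintegral lebesgue_measure `[0, t]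
                 (fun s => mehler_symbol b Q nu (adj setT (S s) xi)))) /\
    (forall f : E -> R,
       measurable_fun setT (f : borel E -> R) -> bounded_fun f ->
       forall x, P t f x = (\int[mu t]_y f (S t x + (y : E)))%R).

Definition is_Q_infty Q S (Qoo : E -> E) : Prop :=
  forall x, is_vintegral lebesgue_measure `[0, +oo[
              (fun s : R => S s (Q (adj setT (S s) x))) (Qoo x).

Definition is_nu_infty nu S (nuoo : {measure set (borel E) -> \bar R}) : Prop :=
  nuoo [set (0 : E)] = 0%E /\
  forall B : set (borel E), measurable B -> ~ B (0 : E) ->
    nuoo B = (\int[lebesgue_measure]_(s in `[0%R, +oo[) nu (S s @^-1` B))%E.

Definition is_b_infty b nu S (boo : E) : Prop :=
  vintegral lebesgue_measure `[0, t] (fun s : R => S s b)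
  + vintegral lebesgue_measure `[0, t] (fun s : R =>
      vintegral nu setT (fun x : borel E =>
        (chiB1 (S s x) - chiB1 x) *: S s x))
  @[t --> +oo] --> boo.

(* gamma = N(0, Qoo) *)
Definition is_centered_gaussian (Qoo : E -> E)
    (gamma : probability (borel E) R) : Prop :=
  forall xi, charfun gamma xi = cexp (- (2^-1 * inner (Qoo xi) xi)%:C)%C.

(* p is infinitely divisible without Gaussian part *)
Definition is_jump_part (boo : E) (nuoo : {measure set (borel E) -> \bar R})
    (p : probability (borel E) R) : Prop :=
  forall xi, charfun p xi =
    cexp ('i * (inner boo xi)%:C
          + cintegral nuoo setT (fun y => cexp ('i * (inner xi y)%:C) - 1
                                  - 'i * (inner xi y * chiB1 y)%:C))%C.

(* Cameron-Martin norm of a centered measure gamma: the supremum of <xi, x>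
   over the functionals xi of norm at most 1 in L^2(gamma). The Cameron-Martin
   space H is the set where it is finite. *)
Definition cm_norm (gamma : probability (borel E) R) (x : E) : \bar R :=
  ereal_sup [set (inner xi x)%:E | xi in
    [set xi | (\int[gamma]_z (inner xi z ^+ 2)%:E <= 1)%E]].

Definition cm_opnorm (gamma : probability (borel E) R) (T : E -> E) : \bar R :=
  ereal_sup [set cm_norm gamma (T x) | x in [set x | (cm_norm gamma x <= 1)%E]].

(* In the extended reals 0^-1 = +oo. *)
Definition mehler_rate (gamma : probability (borel E) R) S : \bar R :=
  limf_einf (fun t : R =>
    (t^-1)%:E * ((cm_opnorm gamma (S t))^-1 ^+ 2 - 1))%E 0^'+.

Definition convolution (mu p : probability (borel E) R) :
    set (borel E) -> \bar R :=
  pushforward (mu \x p)%E (fun z => (z.1 : E) + (z.2 : E) : borel E).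

End Mehler.

Section FunctionClasses.
Context {R : realType}.

Definition grad (V : normedModType R) (ip : V -> V -> R) (f : V -> R) (x : V) :
    V := xget 0 [set g | forall v, 'd f x v = ip g v].

Definition op_bounded (V W : normedModType R) (G : V -> V -> W) : Prop :=
  exists M : R, forall x v, `|G x v| <= M * `|v|.

(* uniform continuity on bounded sets, for the operator norm on the values *)
Definition op_ucont_bounded (V W : normedModType R) (G : V -> V -> W) : Prop :=
  forall M e : R, 0 < e -> exists2 d : R, 0 < d &
    forall x y, `|x| <= M -> `|y| <= M -> `|x - y| < d ->
    forall v, `|G x v - G y v| <= e * `|v|.

(* The class C^2_A for an inner product ip inducing the topology of V and an
   operator B with domain D playing the role of A^*. The second derivative is
   the derivative of the gradient, and its continuity is contained in
   op_ucont_bounded. *)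
Record C2A (V : normedModType R) (ip : V -> V -> R) (D : set V) (B : V -> V)
    (f : V -> R) : Prop := {
  C2A_continuous : continuous f ;
  C2A_bounded : bounded_fun f ;
  C2A_diff1 : forall x, differentiable f x ;
  C2A_diff2 : forall x, differentiable (grad ip f) x ;
  C2A_bounded1 : op_bounded (fun x v => 'd f x v) ;
  C2A_bounded2 : op_bounded (fun x v => 'd (grad ip f) x v) ;
  C2A_ucont1 : op_ucont_bounded (fun x v => 'd f x v) ;
  C2A_ucont2 : op_ucont_bounded (fun x v => 'd (grad ip f) x v) ;
  C2A_dom : forall x, D (grad ip f x) ;
  C2A_drift_continuous : continuous (fun x => ip x (B (grad ip f x))) ;
  C2A_drift_bounded : bounded_fun (fun x => ip x (B (grad ip f x)))
}.

Definition dotrv n (x y : 'rV[R]_n) : R := \sum_(i < n) x 0 i * y 0 i.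

Definition FC2A (E : hilbertType R) (h : nat -> E) (alpha : nat -> R)
    (F : E -> R) : Prop :=
  exists n (f : 'rV[R]_n -> R),
    C2A (@dotrv n) setT (fun v => v *m diag_mx (\row_(i < n) alpha i)) f /\
    forall x, F x = f (\row_(i < n) inner x (h i)).

End FunctionClasses.

Section Functionals.
Context {R : realType}.

Definition entropy d (T : measurableType d) (mu : {measure set T -> \bar R})
    (psi : T -> R) : \bar R :=
  let m := (\int[mu]_x psi x)%R in
  (\int[mu]_x (psi x * ln (psi x))%:E - (m * ln m)%:E)%E.

Definition bregman_pow (r x y : R) : R :=
  `|x| `^ r - `|y| `^ r - r * `|y| `^ (r - 1) * Num.sg y * (x - y).

End Functionals.

(* Main.v *)
(* The jump term is nonnegative by Young's inequality, so it suffices to bound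
   the entropy of [|f (. + y)| ^ r] under gamma, for each y, by a Gaussian
   logarithmic Sobolev inequality, and to integrate over y.

   Logarithmic Sobolev inequality: by tensorization of the entropy, the loss of
   entropy along the Ornstein-Uhlenbeck averages of gamma over one time step is
   at most twice the loss over half of the step. Iterating, the entropy of g is
   at most 2^k times the loss over a step of length 2^-k, and as k grows this
   tends to at most (1/2) times the integral of <Qoo Dg, Dg> / g. The averages
   are compared through the rotation invariance of gamma, a consequence of the
   uniqueness of characteristic functions.

   Covariance: the vectors h_n are common eigenvectors of the semigroup, which
   is therefore self-adjoint, with W(t) = <Qoo S(t)v, S(t)v> satisfying
   W'(0) = - <Q v, v> and W(t) <= |S(t)|_H^2 W(0). Hence q0 Qoo <= Q on the span
   of the h_n, which contains the gradients of cylindrical functions.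

   The two facts combine for g = |f|^r + eps, and eps tends to 0. *)

Require Import Defs.
From HB Require Import structures.
From mathcomp Require Import all_boot all_order all_algebra.
From mathcomp Require Import all_classical all_reals all_analysis.
From mathcomp Require Import measurable_realfun.
From mathcomp Require Import ring lra.
Import Order.TTheory GRing.Theory Num.Theory.
Import numFieldNormedType.Exports.
Local Open Scope classical_set_scope.
Local Open Scope ring_scope.

Set Implicit Arguments.
Unset Strict Implicit.
Unset Printing Implicit Defensive.

(** The halving argument stands in for differentiating along the Ornstein-Uhlenbeck semigroup; it
    runs on Fubini, Gibbs' inequality and a dominated limit. The step 2^-k means a Mehler average
    with b^2 = 2^-k and a^2 = 1 - 2^-k. At k = 0 the average is the mean, so the loss is the whole
    entropy. As k grows, the increment of g is about b times a directional derivative, b^2 cancels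
    2^k, and the factor 1/2 is that of (p - c)^2 / (2 c), the second-order Taylor term of u ln u at
    c.

    The shift eps keeps g away from 0, so that logarithms and quotients stay bounded. The constant
    r^2 / (2 q0) splits into r^2 / 2, from the squared derivative of |f|^r divided by 2 |f|^r, and 1
    / q0, from Qoo <= Q / q0.

    The eigenvectors are given for the adjoint of the generator, and a general vector lies outside
    the domain of the generator; the coordinates of S(t) x are therefore found from an integral
    equation. The bound W(t) <= |S(t)|_H^2 W(0) is a duality: S(t) is tested on a multiple of Qoo
    S(t) v, a vector of H. *)

(** * Hilbert spaces *)

Section InnerProduct.
Context {R : realType} {E : hilbertType R}.
Implicit Types x y z : E.

Lemma innerDr x y z : inner x (y + z) = inner x y + inner x z.
Proof. by rewrite innerC innerDl !(innerC _ x). Qed.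

Lemma innerZr a x y : inner x (a *: y) = a * inner x y.
Proof. by rewrite innerC innerZl innerC. Qed.

Lemma inner0l y : inner 0 y = 0.
Proof. by rewrite -(scale0r 0) innerZl mul0r. Qed.

Lemma inner0r y : inner y 0 = 0.
Proof. by rewrite innerC inner0l. Qed.

Lemma innerNl x y : inner (- x) y = - inner x y.
Proof. by rewrite -scaleN1r innerZl mulN1r. Qed.

Lemma innerNr x y : inner x (- y) = - inner x y.
Proof. by rewrite innerC innerNl innerC. Qed.

Lemma innerBl x y z : inner (x - y) z = inner x z - inner y z.
Proof. by rewrite innerDl innerNl. Qed.

Lemma innerBr x y z : inner x (y - z) = inner x y - inner x z.
Proof. by rewrite innerDr innerNr. Qed.

Lemma inner_suml (I : Type) (s : seq I) (P : pred I) (F : I -> E) y :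
  inner (\sum_(i <- s | P i) F i) y = \sum_(i <- s | P i) inner (F i) y.
Proof.
by apply: (big_morph (inner^~ y)); [move=> u v; exact: innerDl|exact: inner0l].
Qed.

Lemma inner_sumr (I : Type) (s : seq I) (P : pred I) (F : I -> E) y :
  inner y (\sum_(i <- s | P i) F i) = \sum_(i <- s | P i) inner y (F i).
Proof. by rewrite innerC inner_suml; apply: eq_bigr => i _; rewrite innerC. Qed.

Lemma inner_ge0 x : 0 <= inner x x.
Proof. by rewrite inner_norm exprn_ge0. Qed.

Lemma inner_ext x y : (forall z, inner x z = inner y z) -> x = y.
Proof.
move=> xy; apply/eqP; rewrite -subr_eq0 -normr_eq0 -sqrf_eq0 -inner_norm.
by rewrite innerBl xy subrr.
Qed.

Lemma cauchy_schwarz x y : `|inner x y| <= `|x| * `|y|.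
Proof.
have [->|y0] := eqVneq y 0; first by rewrite inner0r !normr0 mulr0.
rewrite -(@ler_pXn2r _ 2)// ?nnegrE ?mulr_ge0// real_normK ?num_real//.
rewrite exprMn -!inner_norm.
have yy : 0 < inner y y by rewrite inner_norm exprn_gt0// normr_gt0.
have := inner_ge0 (inner y y *: x - inner x y *: y).
rewrite !(innerBl, innerBr, innerZl, innerZr) (innerC y x) => h.
suff : 0 <= inner y y * (inner x x * inner y y - inner x y ^+ 2).
  by rewrite pmulr_rge0// subr_ge0.
by apply: le_trans h _; rewrite le_eqVlt; apply/orP; left; apply/eqP; ring.
Qed.

Lemma continuous_innerl y : continuous (inner^~ y : E -> R).
Proof.
move=> x; apply/cvgrPdist_le => e e0.
near=> z; rewrite -innerBl (le_trans (cauchy_schwarz _ _))//.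
rewrite (le_trans (ler_wpM2l _ (_ : `|y| <= `|y| + 1)))//; first by rewrite lerDl.
rewrite -ler_pdivlMr ?ltr_wpDl//; near: z.
apply: cvgr_dist_le; first exact: cvg_id.
by rewrite divr_gt0// ltr_wpDl.
Unshelve. all: by end_near. Qed.

Lemma continuous_innerr y : continuous (inner y : E -> R).
Proof.
have -> : (inner y : E -> R) = inner^~ y by apply/funext => z; rewrite innerC.
exact: continuous_innerl.
Qed.

Section Basis.
Variable h : nat -> E.
Hypothesis hb : hilbert_basis h.

Lemma hilbert_basisE i j : inner (h i) (h j) = (i == j)%:R.
Proof. by case: hb. Qed.

Lemma inner_partial_sum (c : nat -> R) n j :
  inner (\sum_(0 <= i < n) c i *: h i) (h j) = if (j < n)%N then c j else 0.
Proof.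
rewrite inner_suml; under eq_bigr do rewrite innerZl hilbert_basisE.
case: ltnP => jn.
  rewrite (bigD1_seq j) ?mem_index_iota ?iota_uniq//= eqxx mulr1.
  by rewrite big1 ?addr0// => i /negPf ->; rewrite mulr0.
rewrite big_nat_cond big1// => i; rewrite andbT => /andP[_ ilt].
by rewrite (ltn_eqF (leq_trans ilt jn)) mulr0.
Qed.

Lemma norm_partial_sum (c : nat -> R) m n :
  `|\sum_(m <= i < n) c i *: h i| ^+ 2 = \sum_(m <= i < n) c i ^+ 2.
Proof.
rewrite -inner_norm inner_suml; apply: eq_big_seq => i.
rewrite mem_index_iota => iin.
rewrite innerZl inner_sumr (bigD1_seq i) ?mem_index_iota ?iota_uniq//=.
rewrite innerZr hilbert_basisE eqxx mulr1 big1 ?addr0// => j /negPf ji.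
by rewrite innerZr hilbert_basisE eq_sym ji mulr0.
Qed.

Lemma cvg_basis x (G : E -> R) : continuous G ->
  G (\sum_(0 <= i < n) inner x (h i) *: h i) @[n --> \oo] --> G x.
Proof.
by move=> cG; case: hb => _ /(_ x) hx; exact: (cvg_comp _ _ hx (cG x)).
Qed.

Lemma basis_parseval x y :
  \sum_(0 <= i < n) inner x (h i) * inner y (h i) @[n --> \oo] --> inner x y.
Proof.
have := @cvg_basis x _ (@continuous_innerl y); apply: cvg_trans.
apply: near_eq_cvg; apply: nearW => n.
by rewrite inner_suml; apply: eq_bigr => i _; rewrite innerZl (innerC (h i)).
Qed.

Lemma basis_ext x y : (forall i, inner x (h i) = inner y (h i)) -> x = y.
Proof.
move=> xy; apply: inner_ext => z.
apply: (cvg_unique _ (basis_parseval (x:=x) (y:=z))) => //.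
rewrite (_ : (fun _ => _) = fun n => \sum_(0 <= i < n) inner y (h i) * inner z (h i)).
  exact: basis_parseval.
by apply/funext => n; apply: eq_bigr => i _; rewrite xy.
Qed.

(** By orthogonality the squared norm of a block of the series is a block of the numerical series of
    [c i ^+ 2], which is monotone and bounded; the Cauchy criterion passes from one to the other. *)
Lemma basis_bounded_series_cvg (c : nat -> R) M :
  (forall n, \sum_(0 <= i < n) c i ^+ 2 <= M) ->
  cvgn (series (fun i => c i *: h i)).
Proof.
move=> cM; apply/cauchy_cvgP/cauchy_seriesP => e e0.
have : cvgn (series (fun i => c i ^+ 2)).
  apply: nondecreasing_is_cvgn.
    by apply: nondecreasing_series => i _ _; exact: sqr_ge0.
  by exists M => _ [n _ <-]; exact: cM.
move=> /cauchy_cvgP/cauchy_seriesP/(_ (e ^+ 2)); rewrite exprn_gt0// => /(_ isT).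
apply: filterS => -[m n] /= h2.
rewrite -(@ltr_pXn2r _ 2) ?nnegrE ?(ltW e0)// norm_partial_sum.
exact: le_lt_trans (ler_norm _) h2.
Qed.

(* The vector is built from its coordinates [l (h i)], square-summable by
   boundedness of [l]. *)
Lemma riesz (l : {linear E -> R}) (K : R) :
  (forall x, `|l x| <= K * `|x|) -> exists y, forall x, l x = inner y x.
Proof.
move=> lK.
have K0 : 0 <= K.
  have h0 : `|h 0%N| = 1.
    by apply/eqP; rewrite -sqrp_eq1// -inner_norm hilbert_basisE.
  by have := le_trans (normr_ge0 _) (lK (h 0%N)); rewrite h0 mulr1.
have lc : continuous l.
  move=> x; apply/cvgrPdist_le => e e0.
  near=> z; rewrite -linearB (le_trans (lK _))//.
  rewrite (le_trans (ler_wpM2r _ (_ : K <= K + 1)))//; first by rewrite lerDl.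
  rewrite -ler_pdivlMl ?ltr_wpDl//; near: z.
  apply: cvgr_dist_le; first exact: cvg_id.
  by rewrite mulr_gt0// invr_gt0 ltr_wpDl.
pose c i := l (h i).
pose s n := \sum_(0 <= i < n) c i *: h i.
(* Testing [l] on the partial sum built from its own coordinates bounds the squared norm of [s n] by
   [K] times its norm, hence the norm by [K] for every [n]. *)
have ls n : l (s n) = `|s n| ^+ 2.
  rewrite norm_partial_sum linear_sum; apply: eq_bigr => i _.
  by rewrite linearZ.
have sK n : `|s n| <= K.
  have := lK (s n); rewrite ls ger0_norm ?exprn_ge0// expr2.
  have [->|s0] := eqVneq (s n) 0; first by rewrite normr0.
  by rewrite ler_pM2r ?normr_gt0.
have /cvg_ex[y sy] : cvgn (series (fun i => c i *: h i)).
  apply: (@basis_bounded_series_cvg _ (K ^+ 2)) => n.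
  by rewrite -norm_partial_sum; apply: lerXn2r; rewrite ?nnegrE//; exact: sK.
have yh j : inner y (h j) = c j.
  have : inner (s n) (h j) @[n --> \oo] --> inner y (h j).
    exact: (cvg_comp _ _ sy (@continuous_innerl (h j) y)).
  move=> /(cvg_unique _); apply => //.
  apply: cvg_near_cst; near=> n; rewrite inner_partial_sum.
  by rewrite ifT//; near: n; exact: nbhs_infty_gt.
exists y => x.
have lx : l (\sum_(0 <= i < n) inner x (h i) *: h i) @[n --> \oo] --> l x.
  exact: cvg_basis.
apply: (cvg_unique _ lx) => //.
have := @cvg_basis x _ (@continuous_innerr y); apply: cvg_trans.
apply: near_eq_cvg; apply: nearW => n /=.
by rewrite inner_sumr linear_sum; apply: eq_bigr => i _; rewrite innerZr linearZ yh.
Unshelve. all: by end_near. Qed.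

End Basis.

End InnerProduct.

(** * Semigroups with an eigenbasis *)

Section Primitive.
Context {R : realType}.
Implicit Types f g : R -> R.

(** The base point -1 makes every time [t >= 0], including 0, an interior point, so that derivatives
    there are two-sided; subtracting the value at 0 gives the integral from 0. *)
Definition primitive f (t : R) : R :=
  (\int[lebesgue_measure]_(s in `[(-1)%R, t]) f s)%R.

Lemma continuous_integrable_itv f a b : continuous f ->
  lebesgue_measure.-integrable `[a, b] (EFin \o f).
Proof.
move=> cf; apply: continuous_compact_integrable; first exact: segment_compact.
exact: continuous_subspaceT.
Qed.

Lemma is_derive_primitive f (t : R) : continuous f -> -1 < t ->
  is_derive t 1 (primitive f) (f t).
Proof.
move=> cf t0.
have t1 : t < t + 1 by rewrite ltrDl.
have ft : lebesgue_measure.-integrable `[-1, t + 1] (EFin \o f).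
  exact: continuous_integrable_itv.
have [dF <-] := continuous_FTC1 t1 ft t0 (cf t).
by rewrite derive1E; exact: derivableP.
Qed.

Lemma primitiveD f g t : continuous f -> continuous g ->
  primitive (fun s => f s + g s) t = primitive f t + primitive g t.
Proof. by move=> cf cg; apply: RintegralD => //; exact: continuous_integrable_itv. Qed.

Lemma primitiveZ f a t : continuous f ->
  primitive (fun s => a * f s) t = a * primitive f t.
Proof. by move=> cf; apply: RintegralZl => //; exact: continuous_integrable_itv. Qed.

Lemma MVT_is_derive (F f : R -> R) (a b : R) : a < b ->
  (forall s : R, a <= s <= b -> is_derive s 1 F (f s)) ->
  exists2 c, a < c < b & F b - F a = f c * (b - a).
Proof.
move=> ab dF; have [||c] := @MVT R F f a b ab.
- by move=> s; rewrite in_itv/= => /andP[? ?]; apply: dF; rewrite !ltW.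
- apply: derivable_within_continuous => s; rewrite in_itv/= => sab.
  by have [] := dF s sab.
- by rewrite in_itv/= => ? ?; exists c.
Qed.

Lemma eq_increment (F G f : R -> R) (t : R) : 0 <= t ->
  (forall s : R, 0 <= s <= t -> is_derive s 1 F (f s)) ->
  (forall s : R, 0 <= s <= t -> is_derive s 1 G (f s)) ->
  F t - F 0 = G t - G 0.
Proof.
rewrite le_eqVlt => /predU1P[<- _ _|t0 dF dG]; first by rewrite !subrr.
have [s st|c _] := @MVT_is_derive (F \- G) (fun s => f s - f s) 0 t t0.
  by have ? := dF _ st; have ? := dG _ st; exact: is_deriveB.
by rewrite subrr mul0r => /eqP; rewrite subr_eq0 => /eqP /= ?; lra.
Qed.

(* The variation-of-constants formula for [u = u0 + alpha * int u]. *)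
Lemma integral_eq_exp (u : R -> R) (alpha t : R) : continuous u -> 0 <= t ->
  (forall s, 0 <= s -> u s = u 0 + alpha * (primitive u s - primitive u 0)) ->
  u t = expR (alpha * t) * u 0.
Proof.
move=> cu t0 eu.
(* On [s >= 0] this is [u s * expR (- alpha * s)], written through the primitive because [u] is only
   known to be continuous. *)
pose W s := (u 0 + alpha * (primitive u s - primitive u 0)) * expR (- alpha * s).
have dW (s : R) : 0 <= s <= t -> is_derive s 1 W 0.
  move=> /andP[s0 _].
  have dP := @is_derive_primitive u s cu (lt_le_trans (ltrN10 _) s0).
  rewrite /W; apply: is_derive_eq.
  by rewrite -eu// /GRing.scale/=; ring.
have := @eq_increment W (fun=> 0) (fun=> 0) t t0 dW (fun s _ => is_derive_cst _ _ _).
rewrite subrr => /eqP; rewrite subr_eq0 => /eqP.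
rewrite /W -eu// mulr0 expR0 mulr1 subrr mulr0 addr0 => <-.
by rewrite mulrC -mulrA -expRD mulNr addNr expR0 mulr1.
Qed.

End Primitive.

Section Semigroup.
Context {R : realType} {E : hilbertType R}.
Variable S : R -> {linear E -> E}.
Hypothesis S_C0 : C0_semigroup S.

Lemma cvg_at_rightP (f : R -> E) l : f t @[t --> 0^'+] --> l ->
  forall e, 0 < e -> exists2 d, 0 < d & forall t, 0 < t < d -> `|l - f t| <= e.
Proof.
move=> fl e e0.
have [d /= d0 dP] := cvgr_dist_le _ _ fl _ e0.
exists d => // t /andP[t0 td]; apply: dP => //=.
by rewrite sub0r normrN gtr0_norm.
Qed.

(** Otherwise the operators have unbounded norms along times tending to 0, while each orbit is
    bounded along them by strong continuity at 0: this contradicts Banach-Steinhaus. *)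
Lemma semigroup_local_bound : exists d M,
  [/\ 0 < d, 1 <= M & forall t x, 0 <= t <= d -> `|S t x| <= M * `|x|].
Proof.
apply: contrapT => nb.
have /choice[t tP] : forall k : nat, exists t : R, 0 <= t <= k.+1%:R^-1 /\
    exists x, k.+1%:R * `|x| < `|S t x|.
  move=> k; apply: contrapT => nt; apply: nb; exists k.+1%:R^-1, k.+1%:R.
  split; [by rewrite invr_gt0|by rewrite ler1n|move=> t x tk].
  rewrite leNgt; apply/negP => lt; apply: nt; exists t; split => //.
  by exists x.
pose F := [set (S (t k) : E -> E) | k in [set: nat]].
have [||M MP] := @Banach_Steinhauss R E E F _ _ 1.
- move=> _ [k _ <-]; split; last exact: linearP.
  apply/bounded_funP; apply: continuous_linear_bounded.
  by apply: semigroup_continuous => //; have [/andP[]] := tP k.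
- move=> x.
  have [d d0 dP] := cvg_at_rightP (semigroup_strong S_C0 (x:=x)) ltr01.
  (* From index [K] on the time is below [d], where the orbit stays within 1 of [x]; the finitely
     many earlier times are absorbed by summing their norms. *)
  pose K := (Num.truncn d^-1).+1.
  exists (`|x| + 1 + \sum_(k < K) `|S (t k) x|) => _ [k _ <-].
  have [kK|Kk] := ltnP k K.
    rewrite (bigD1 (Ordinal kK))//= addrCA lerDl !addr_ge0//.
    by apply: sumr_ge0.
  apply: (@le_trans _ _ (`|x| + 1)); last by rewrite lerDl sumr_ge0.
  have [/andP[]] := tP k; rewrite le_eqVlt => /predU1P[<- _ _|tk0 tk _].
    by rewrite (semigroup0 S_C0) lerDl.
  rewrite -[S _ x](subrK x) addrC (le_trans (ler_normD _ _))// lerD2l distrC.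
  apply: dP; rewrite tk0/= (le_lt_trans tk)// -[ltRHS]invrK ltf_pV2 ?posrE ?invr_gt0//.
  by rewrite (lt_le_trans (truncnS_gt _))// ler_nat (leq_trans Kk).
pose k := Num.truncn `|M|.
have [/andP[t0 _] [x xP]] := tP k.
have x0 : 0 < `|x|.
  rewrite normr_gt0; apply/eqP => x0; move: xP.
  by rewrite x0 linear0 normr0 mulr0 ltxx.
have := MP _ (ex_intro2 _ _ k I erefl) (`|x|^-1 *: x).
rewrite normrZ normfV normr_id mulVf ?gt_eqF// lexx => /(_ isT).
rewrite linearZ normrZ normfV normr_id ler_pdivrMl// mulrC => /(lt_le_trans xP).
rewrite ltr_pM2r// => kM.
have := lt_trans (truncnS_gt `|M|) (lt_le_trans kM (ler_norm M)).
by rewrite ltxx.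
Qed.

(** Each step of length [d] costs a factor [M]; since [1 <= M], a shorter time obeys the same
    power. *)
Lemma semigroup_bound T : exists2 M, 0 < M &
  forall t x, 0 <= t <= T -> `|S t x| <= M * `|x|.
Proof.
have [d [M [d0 M1 MP]]] := semigroup_local_bound.
have M0 : 0 < M by exact: lt_le_trans M1.
have main n : forall t x, 0 <= t <= n%:R * d -> `|S t x| <= M ^+ n * `|x|.
  elim: n => [|n IH] t x.
    rewrite mul0r => t0; have -> : t = 0 by apply/eqP; rewrite eq_le andbC.
    by rewrite (semigroup0 S_C0) expr0 mul1r.
  move=> /andP[t0 tn]; have [td|dt] := leP t d.
    rewrite (le_trans (MP t x _)) ?t0// ler_wpM2r// exprS ler_peMr ?(ltW M0)//.
    exact: exprn_ege1.
  rewrite -(subrKC d t) (semigroupD S_C0) ?subr_ge0 ?(ltW d0) ?(ltW dt)//.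
  rewrite (le_trans (MP d _ _)) ?lexx ?(ltW d0)// exprS -mulrA ler_pM2l//.
  apply: IH; rewrite subr_ge0 (ltW dt)/= lerBlDr.
  by move: tn; rewrite -natr1 mulrDl mul1r.
exists (M ^+ (Num.truncn (`|T| / d)).+1); first exact: exprn_gt0.
move=> t x /andP[t0 tT]; apply: main; rewrite t0/= (le_trans tT)//.
rewrite -ler_pdivrMr// (le_trans _ (ltW (truncnS_gt _)))// ler_pM2r ?invr_gt0//.
exact: ler_norm.
Qed.

(** Frozen at [x] for negative times, which makes it continuous on the whole line, as [primitive]
    requires. *)
Definition orbit (x : E) (t : R) : E := S (Num.max t 0) x.

Lemma orbitE x t : 0 <= t -> orbit x t = S t x.
Proof. by move=> t0; rewrite /orbit max_l. Qed.

(** Strong continuity is assumed at 0 from the right only. For [a <= c] the difference is [S a]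
    applied to [x - S (c - a) x], and the bound on compact times makes it small on both sides. *)
Lemma orbit_continuous x : continuous (orbit x).
Proof.
move=> t; apply/cvgrPdist_le => e e0.
have [M M0 MP] := semigroup_bound (Num.max t 0 + 1).
have [d d0 dP] := cvg_at_rightP (semigroup_strong S_C0 (x:=x)) (divr_gt0 e0 M0).
have key a c : 0 <= a -> a <= c -> c <= Num.max t 0 + 1 -> c - a < d ->
    `|S a x - S c x| <= e.
  move=> a0 ac cT cad; rewrite -[c](subrKC a) (semigroupD S_C0) ?subr_ge0//.
  rewrite -linearB (le_trans (MP _ _ _)) ?a0 ?(le_trans ac)//.
  rewrite mulrC -ler_pdivlMr//.
  have [->|ca] := eqVneq c a; first by rewrite subrr (semigroup0 S_C0) subrr normr0 divr_ge0// ltW.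
  by apply: dP; rewrite subr_gt0 lt_neqAle eq_sym ca ac.
near=> z.
have zd : `|t - z| < d by near: z; exact: cvgr_dist_lt.
have z1 : `|t - z| < 1 by near: z; exact: cvgr_dist_lt.
move: zd z1; rewrite /orbit !ltr_norml => /andP[zd1 zd2] /andP[z11 z12].
have [tz|zt] := leP (Num.max t 0) (Num.max z 0).
- apply: key => //; move: zd1 zd2 z11 z12 tz; clear; case: (leP t 0); case: (leP z 0); lra.
- rewrite distrC; apply: key => //; move: zd1 zd2 z11 z12 zt; clear; case: (leP t 0); case: (leP z 0); lra.
Unshelve. all: by end_near. Qed.

Lemma inner_orbit_continuous x z : continuous (fun s => inner (orbit x s) z).
Proof.
move=> t; exact: (cvg_comp _ _ (@orbit_continuous x t) (@continuous_innerl _ _ z _)).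
Qed.

Variable h : nat -> E.
Hypothesis hb : hilbert_basis h.

(* [y] is the vector [int_0^t S_s x ds]. *)
Lemma orbit_integral x t : 0 <= t -> exists y, forall z,
  inner y z = primitive (fun s => inner (orbit x s) z) t -
              primitive (fun s => inner (orbit x s) z) 0.
Proof.
move=> t0.
pose U z := primitive (fun s => inner (orbit x s) z).
pose l z := U z t - U z 0.
have cU z : continuous (fun s => inner (orbit x s) z).
  exact: inner_orbit_continuous.
have ll : linear l.
  move=> a y z; rewrite /l /U.
  have eD s : primitive (fun s => inner (orbit x s) (a *: y + z)) s =
      a * primitive (fun s => inner (orbit x s) y) s +
      primitive (fun s => inner (orbit x s) z) s.
    rewrite -primitiveZ// -primitiveD//; last first.
      by move=> r; apply: cvgM; [exact: cvg_cst|exact: cU].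
    by congr primitive; apply/funext => r; rewrite innerDr innerZr.
  by rewrite !eD /GRing.scale/=; ring.
pose lP : {linear E -> R} :=
  HB.pack l (GRing.isLinear.Build _ _ _ _ _ ll).
have [M M0 MP] := semigroup_bound t.
have [z|y yP] := @riesz _ _ h hb lP (t * M * `|x|).
  rewrite /= /l; move: t0; rewrite le_eqVlt => /predU1P[<-|t0].
    by rewrite subrr normr0 !mul0r.
  have [s /andP[s0 _]|c /andP[c0 ct] ->] :=
      @MVT_is_derive _ (U z) (fun s => inner (orbit x s) z) 0 t t0.
    by apply: is_derive_primitive => //; exact: lt_le_trans s0.
  rewrite subr0 normrM (gtr0_norm t0) mulrC -!mulrA ler_pM2l//.
  rewrite (le_trans (cauchy_schwarz _ _))// mulrA ler_wpM2r//.
  by rewrite orbitE ?(ltW c0)// MP// (ltW c0) (ltW ct).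
by exists y => z; rewrite -yP.
Qed.

Lemma adjoint_exists t : 0 <= t ->
  forall z, exists w, forall x, inner (S t x) z = inner x w.
Proof.
move=> t0 z.
have ll : linear (fun x => inner (S t x) z : R).
  by move=> a u v; rewrite linearP innerDl innerZl.
pose lP : {linear E -> R} :=
  HB.pack (fun x => inner (S t x) z : R) (GRing.isLinear.Build _ _ _ _ _ ll).
have [M M0 MP] := semigroup_bound t.
have [x|w wP] := @riesz _ _ h hb lP (M * `|z|).
  rewrite /= (le_trans (cauchy_schwarz _ _))// mulrAC ler_wpM2r//.
  by rewrite MP// t0 lexx.
by exists w => x; exact: etrans (wP x) (innerC _ _).
Qed.

(** The classical identity A int_0^t S(s) x ds = S(t) x - x. Since [y] is known through its inner
    products only, the error [v] is estimated against every [z], uniformly in the norm of [z]; the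
    choice [z = v] then gives norm convergence. *)
Lemma gen_orbit_integral x t y : 0 <= t ->
  (forall z, inner y z = primitive (fun s => inner (orbit x s) z) t -
                         primitive (fun s => inner (orbit x s) z) 0) ->
  (r^-1 *: (S r y - y)) @[r --> 0^'+] --> S t x - x.
Proof.
move=> t0 yP.
pose U z := primitive (fun s => inner (orbit x s) z).
have cU z : continuous (fun s => inner (orbit x s) z).
  exact: inner_orbit_continuous.
have dU z (s : R) : 0 <= s -> is_derive s 1 (U z) (inner (orbit x s) z).
  by move=> s0; apply: is_derive_primitive => //; exact: lt_le_trans s0.
have {yP} yP z : inner y z = U z t - U z 0 := yP z.
move: U dU yP => U dU yP.
(* Moving [S r] across as the adjoint vector [w] turns the integrand into the orbit shifted by [r];
   the two increments agree because their derivatives do. *)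
have SyE r z : 0 <= r -> inner (S r y) z = U z (t + r) - U z r.
  move=> r0; have [w wP] := adjoint_exists r0 z.
  rewrite wP yP.
  have -> : U z r = U z (0 + r) by rewrite add0r.
  apply: (@eq_increment _ (U w) (fun s => U z (s + r))
    (fun s => inner (orbit x s) w) t t0) => s /andP[s0 _].
    exact: dU.
  have -> : inner (orbit x s) w = inner (orbit x (s + r)) z * 1.
    rewrite mulr1 !orbitE ?addr_ge0// addrC (semigroupD S_C0)// wP//.
  have d1 : is_derive (s + r) 1 (U z) (inner (orbit x (s + r)) z).
    by apply: dU; rewrite addr_ge0.
  have d2 : is_derive s 1 (fun s : R => s + r) (1 : R).
    by apply: is_derive_eq; rewrite addr0.
  exact: (@is_derive1_comp _ (U z) (fun s => s + r) s _ _ d1 d2).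
apply/cvgrPdist_le => e e0.
have oc := @orbit_continuous x.
have e2 : 0 < e / 2 by rewrite divr_gt0.
have [d1 /= d10 d1P] := cvgr_dist_le _ _ (oc t) _ e2.
have [d2 /= d20 d2P] := cvgr_dist_le _ _ (oc 0) _ e2.
near=> r.
have r0 : 0 < r by near: r; exact: nbhs_right_gt.
have rd1 : r < d1 by near: r; exact: nbhs_right_lt.
have rd2 : r < d2 by near: r; exact: nbhs_right_lt.
set v := _ - _.
have vE z : `|inner v z| <= e * `|z|.
  rewrite /v !(innerBl, innerZl) SyE ?(ltW r0)// yP.
  have tr : t < t + r by rewrite ltrDl.
  have [s /andP[ts _]|c1 /andP[c11 c12] E1] :=
    @MVT_is_derive _ (U z) (fun s => inner (orbit x s) z) t (t + r) tr.
    by apply: dU; exact: le_trans ts.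
  have [s /andP[s0 _]|c2 /andP[c21 c22] E2] :=
    @MVT_is_derive _ (U z) (fun s => inner (orbit x s) z) 0 r r0.
    exact: dU.
  have -> : U z (t + r) - U z r - (U z t - U z 0) =
      (U z (t + r) - U z t) - (U z r - U z 0) by ring.
  have -> : r^-1 * (U z (t + r) - U z t - (U z r - U z 0)) =
      inner (orbit x c1) z - inner (orbit x c2) z.
    by rewrite E1 E2; field; rewrite gt_eqF.
  have -> : inner (S t x) z - inner x z -
      (inner (orbit x c1) z - inner (orbit x c2) z) =
      inner (orbit x t - orbit x c1) z - inner (orbit x 0 - orbit x c2) z.
    by rewrite !innerBl (orbitE _ t0) (orbitE _ (lexx 0)) (semigroup0 S_C0); ring.
  rewrite (le_trans (ler_normB _ _))// [e in leRHS]splitr mulrDl lerD//.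
    rewrite (le_trans (cauchy_schwarz _ _))// ler_wpM2r// d1P//=.
    by rewrite ltr0_norm; lra.
  rewrite (le_trans (cauchy_schwarz _ _))// ler_wpM2r// d2P//=.
  by rewrite sub0r normrN gtr0_norm; lra.
have [->|v0] := eqVneq v 0; first by rewrite normr0 ltW.
have := vE v; rewrite inner_norm ger0_norm ?exprn_ge0// expr2 ler_pM2r//.
by rewrite normr_gt0.
Unshelve. all: by end_near. Qed.

Variable alpha : nat -> R.
Hypothesis h_eigen : adjoint_eigenbasis S h alpha.

(** [adj] is a choice among representing vectors; membership in [adj_dom] says that there is one, so
    the chosen vector [alpha n *: h n] does represent. *)
Lemma gen_inner_eigen x n : gen_dom S x ->
  inner (gen S x) (h n) = alpha n * inner x (h n).
Proof.
move=> Dx; case: h_eigen => _ /(_ n)[[z zP] eadj].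
have := @xgetPex E 0 [set w | forall u, gen_dom S u -> inner (gen S u) (h n) = inner u w]
  (ex_intro _ z zP).
by rewrite -/(adj _ _ _) eadj => -> //; rewrite innerZr.
Qed.

(** For arbitrary [x] the integrated orbit lies in the domain of the generator, and pairing it with
    [h n] gives the scalar equation u(s) = u(0) + alpha int_0^s u, solved by the exponential. *)
Lemma semigroup_coord t x n : 0 <= t ->
  inner (S t x) (h n) = expR (alpha n * t) * inner x (h n).
Proof.
move=> t0.
have := @integral_eq_exp R (fun s => inner (orbit x s) (h n)) (alpha n) t.
rewrite !orbitE// (semigroup0 S_C0); apply => //.
  exact: inner_orbit_continuous.
move=> s s0; have [y yP] := orbit_integral x s0.
have gy := gen_orbit_integral s0 yP.
have := @gen_inner_eigen y n (cvgP _ gy).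
rewrite /gen (cvg_lim (@norm_hausdorff _ _) gy) -yP innerBl orbitE// => <-.
by rewrite addrC subrK.
Qed.

Lemma semigroup_eigen t n : 0 <= t -> S t (h n) = expR (alpha n * t) *: h n.
Proof.
move=> t0; apply: (basis_ext hb) => i.
rewrite semigroup_coord// innerZl (hilbert_basisE hb).
by case: eqVneq => [->//|_]; rewrite !mulr0.
Qed.

Lemma semigroup_selfadjoint t x y : 0 <= t -> inner (S t x) y = inner x (S t y).
Proof.
move=> t0; apply: (cvg_unique _ (basis_parseval hb (x:=S t x) (y:=y))) => //.
rewrite (_ : (fun _ => _) =
    fun n => \sum_(0 <= i < n) inner x (h i) * inner (S t y) (h i)).
  exact: basis_parseval.
apply/funext => n; apply: eq_bigr => i _.
by rewrite !semigroup_coord//; ring.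
Qed.

Lemma adj_semigroup t x : 0 <= t -> adj setT (S t) x = S t x.
Proof.
move=> t0; rewrite /adj.
have ex : exists w, [set w | forall u, [set: E] u -> inner (S t u) x = inner u w] w.
  by exists (S t x) => u _; exact: semigroup_selfadjoint.
have h1 := xgetPex 0 ex.
by apply: inner_ext => u; rewrite innerC -h1// semigroup_selfadjoint// innerC.
Qed.

Hypothesis A_neg : forall x, gen_dom S x -> x != 0 -> inner (gen S x) x < 0.

(** By [semigroup_eigen] the vector [h n], given as an eigenvector of the adjoint, is also in the
    domain of the generator with the same eigenvalue, so strict dissipativity can be tested on
    it. *)
Lemma eigenvalue_neg n : alpha n < 0.
Proof.
have hn0 : h n != 0.
  apply/eqP => h0; have := hilbert_basisE hb n n.
  by rewrite h0 inner0l eqxx => /esym/eqP; rewrite oner_eq0.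
have gh : (r^-1 *: (S r (h n) - h n)) @[r --> 0^'+] --> alpha n *: h n.
  have : (r^-1 *: (expR (alpha n * r) - 1)) *: h n @[r --> 0^'+] --> alpha n *: h n.
    apply: cvgZ; last exact: cvg_cst.
    have /cvg_dnbhs_at_right : r^-1 *: (expR (alpha n * (r + 0)) - expR (alpha n * 0)) @[r --> 0^'] --> alpha n.
      have : is_derive (0 : R) 1 (fun r => expR (alpha n * r)) (alpha n).
        apply: is_derive_eq; rewrite mulr0 expR0 /GRing.scale/=; ring.
      move=> [dl dE]; rewrite -[X in _ --> X]dE; apply: cvg_trans dl; apply: near_eq_cvg; apply: nearW => r /=.
      by rewrite /GRing.scale/= mulr1.
    by apply: cvg_trans; apply: near_eq_cvg; apply: nearW => r; rewrite mulr0 expR0 addr0.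
  apply: cvg_trans; apply: near_eq_cvg; near=> r.
  rewrite semigroup_eigen; last by apply: ltW; near: r; exact: nbhs_right_gt.
  by rewrite -scalerA scalerBl scale1r.
have := A_neg (cvgP _ gh) hn0.
by rewrite /gen (cvg_lim (@norm_hausdorff _ _) gh) innerZl (hilbert_basisE hb) eqxx mulr1.
Unshelve. all: by end_near. Qed.

End Semigroup.

(** * Uniqueness of characteristic functions *)

Section BoundedMeasurable.
Context {R : realType} d (T : measurableType d).
Implicit Types F G : T -> R.

(** An algebra of functions, integrable for every probability and stable under partial integration,
    so that linearity and Fubini apply to it freely. *)
Definition bounded_measurable F :=
  measurable_fun setT F /\ exists M, forall x, `|F x| <= M.

Lemma bm_cst c : bounded_measurable (cst c).
Proof. by split; [exact: measurable_cst|exists `|c|]. Qed.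

Lemma bmD F G : bounded_measurable F -> bounded_measurable G ->
  bounded_measurable (fun x => F x + G x).
Proof.
move=> [mF [M MF]] [mG [N NG]]; split; first exact: measurable_funD.
by exists (M + N) => x; rewrite (le_trans (ler_normD _ _))// lerD.
Qed.

Lemma bmM F G : bounded_measurable F -> bounded_measurable G ->
  bounded_measurable (fun x => F x * G x).
Proof.
move=> [mF [M MF]] [mG [N NG]]; split; first exact: measurable_funM.
by exists (M * N) => x; rewrite normrM ler_pM.
Qed.

Lemma bmZ c F : bounded_measurable F -> bounded_measurable (fun x => c * F x).
Proof. by apply: bmM; exact: bm_cst. Qed.

Lemma bmB F G : bounded_measurable F -> bounded_measurable G ->
  bounded_measurable (fun x => F x - G x).
Proof.
move=> bF bG; have := bmD bF (bmZ (-1) bG).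
by congr bounded_measurable; apply/funext => x; rewrite mulN1r.
Qed.

Variable P : probability T R.

Lemma bm_integrable F : bounded_measurable F -> P.-integrable setT (EFin \o F).
Proof.
move=> [mF [M MF]].
apply: (@le_integrable _ _ _ _ _ measurableT _ (EFin \o cst M)) => //.
- exact/measurable_EFinP.
- move=> x _ /=; rewrite lee_fin (le_trans (MF x))//; exact: ler_norm.
- exact: finite_measure_integrable_cst.
Qed.

Lemma bm_integralD F G : bounded_measurable F -> bounded_measurable G ->
  (\int[P]_x (F x + G x) = \int[P]_x F x + \int[P]_x G x)%R.
Proof. by move=> bF bG; apply: RintegralD => //; exact: bm_integrable. Qed.

Lemma bm_integralB F G : bounded_measurable F -> bounded_measurable G ->
  (\int[P]_x (F x - G x) = \int[P]_x F x - \int[P]_x G x)%R.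
Proof. by move=> bF bG; apply: RintegralB => //; exact: bm_integrable. Qed.

Lemma bm_integralZ c F : bounded_measurable F ->
  (\int[P]_x (c * F x) = c * \int[P]_x F x)%R.
Proof. by move=> bF; apply: RintegralZl => //; exact: bm_integrable. Qed.

Lemma prob_integral_cst c : (\int[P]_x c = c)%R.
Proof. by rewrite Rintegral_cst// [X in fine X](@probability_setT _ _ _ P) mulr1. Qed.

Lemma bm_le_integral F G : bounded_measurable F -> bounded_measurable G ->
  (forall x, F x <= G x) -> (\int[P]_x F x <= \int[P]_x G x)%R.
Proof. by move=> bF bG FG; apply: le_Rintegral => //; exact: bm_integrable. Qed.

Lemma bm_integral_EFin F : bounded_measurable F ->
  (\int[P]_x (F x)%:E)%E = (\int[P]_x F x)%R%:E.
Proof.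
move=> bF; rewrite /Rintegral fineK//; apply: integrable_fin_num => //.
exact: bm_integrable.
Qed.

Lemma bm_integral_bounded F M : bounded_measurable F ->
  (forall x, `|F x| <= M) -> `|(\int[P]_x F x)%R| <= M.
Proof.
move=> bF MF; have bM := bm_cst M; have bN := bm_cst (- M).
rewrite ler_norml -{1}(prob_integral_cst (- M)) -{2}(prob_integral_cst M).
by apply/andP; split; apply: bm_le_integral => // x; have := MF x;
  rewrite ler_norml => /andP[].
Qed.

Lemma dominated_cvg_prob (F_ : nat -> T -> R) F M :
  (forall n, measurable_fun setT (F_ n)) -> (forall n x, `|F_ n x| <= M) ->
  (forall x, F_ n x @[n --> \oo] --> F x) ->
  bounded_measurable F /\
  (\int[P]_x F_ n x)%R @[n --> \oo] --> (\int[P]_x F x)%R.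
Proof.
move=> mF MF cF.
have bF : bounded_measurable F.
  split; first by apply: (measurable_fun_cvg (h := F_)) => // x _; exact: cF.
  exists M => x; rewrite leNgt; apply/negP => MFx.
  have [N _ /(_ N (leqnn N))/=] := cvgr_norm_gt _ (cF x) _ MFx.
  by rewrite ltNge MF.
split => //; apply: fine_cvg; rewrite -bm_integral_EFin//.
have [|||||_ _ //] := @dominated_convergence _ _ _ P setT measurableT
  (fun n => EFin \o F_ n) (EFin \o F) (EFin \o cst M).
- by move=> n; exact/measurable_EFinP.
- by apply/measurable_EFinP; case: bF.
- by apply: aeW => x _; apply: cvg_EFin; [exact: nearW|exact: cF].
- exact: finite_measure_integrable_cst.
- by apply: aeW => x n _; rewrite /= lee_fin.
Qed.

End BoundedMeasurable.

Lemma bm_comp {R : realType} d1 d2 (T1 : measurableType d1)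
    (T2 : measurableType d2) (F : T2 -> R) (phi : T1 -> T2) :
  measurable_fun setT phi -> bounded_measurable F -> bounded_measurable (F \o phi).
Proof.
move=> mphi [mF [M MF]]; split; first exact: measurableT_comp.
by exists M => x; exact: MF.
Qed.

Section Fubini.
Context {R : realType} d1 d2 (T1 : measurableType d1) (T2 : measurableType d2).
Variables (P1 : probability T1 R) (P2 : probability T2 R).
Variable F : T1 * T2 -> R.
Hypothesis bF : bounded_measurable F.

Lemma bm_section1 x : bounded_measurable (fun y => F (x, y)).
Proof. exact: (bm_comp (pair1_measurable x) bF). Qed.

Lemma bm_section2 y : bounded_measurable (fun x => F (x, y)).
Proof. exact: (bm_comp (pair2_measurable y) bF). Qed.

Lemma bm_prod_integrable : (P1 \x P2)%E.-integrable setT (EFin \o F).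
Proof.
have [mF [M MF]] := bF.
apply/integrable12ltyP; first exact/measurable_EFinP.
apply: (@le_lt_trans _ _ (\int[P1]_x (cst `|M|%:E) x)%E); last first.
  by rewrite integral_cst// [X in (_ * X)%E](@probability_setT _ _ _ P1) mule1 ltry.
apply: ge0_le_integral => //.
- by move=> x _; exact: integral_ge0.
- apply: (measurable_fun_fubini_tonelli_F (fun z => (`|F z|%:E)%E)).
    by apply/measurable_EFinP; exact: measurableT_comp.
  by move=> z; rewrite lee_fin.
- move=> x _ /=.
  apply: (@le_trans _ _ (\int[P2]_y (cst `|M|%:E) y)%E).
    apply: ge0_le_integral => //.
      apply/measurable_EFinP; apply: measurableT_comp => //.
      by have [] := bm_section1 x.
    by move=> y _ /=; rewrite lee_fin (le_trans (MF _))// ler_norm.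
  by rewrite integral_cst// [X in (_ * X)%E](@probability_setT _ _ _ P2) mule1.
Qed.

Lemma bm_fubini_F : bounded_measurable (fun x => (\int[P2]_y F (x, y))%R).
Proof.
have [mF [M MF]] := bF; split; last first.
  by exists M => x; apply: bm_integral_bounded => //; exact: bm_section1.
apply/measurable_EFinP.
have := measurable_fubini_F bm_prod_integrable; congr measurable_fun.
apply/funext => x; rewrite /fubini_F /= -bm_integral_EFin//; exact: bm_section1.
Qed.

Lemma bm_fubini_G : bounded_measurable (fun y => (\int[P1]_x F (x, y))%R).
Proof.
have [mF [M MF]] := bF; split; last first.
  by exists M => y; apply: bm_integral_bounded => //; exact: bm_section2.
apply/measurable_EFinP.
have := measurable_fubini_G bm_prod_integrable; congr measurable_fun.
apply/funext => y; rewrite /fubini_G /= -bm_integral_EFin//; exact: bm_section2.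
Qed.

Lemma bm_fubini1 : (\int[(P1 \x P2)%E]_z F z = \int[P1]_x \int[P2]_y F (x, y))%R.
Proof.
rewrite /Rintegral -(integral12_prod_meas1 bm_prod_integrable); congr fine.
apply: eq_integral => x _; rewrite /fubini_F /=.
by rewrite -bm_integral_EFin//; exact: bm_section1.
Qed.

Lemma bm_fubini :
  (\int[P1]_x \int[P2]_y F (x, y) = \int[P2]_y \int[P1]_x F (x, y))%R.
Proof.
rewrite -bm_fubini1 /Rintegral -(integral21_prod_meas1 bm_prod_integrable).
congr fine; apply: eq_integral => y _; rewrite /fubini_G /=.
by rewrite -bm_integral_EFin//; exact: bm_section2.
Qed.

End Fubini.

Section Bernstein.
Context {R : realType}.

(* Recursive form of [\sum_k 'C(m, k) y^k (1 - y)^(m - k) f k]. *)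
Fixpoint bernstein (m : nat) (y : R) (f : nat -> R) : R :=
  if m is m'.+1 then y * bernstein m' y (fun k => f k.+1) +
                     (1 - y) * bernstein m' y f
  else f 0%N.

Lemma bernsteinB m y f g :
  bernstein m y (fun k => f k - g k) = bernstein m y f - bernstein m y g.
Proof. by elim: m f g => //= m IH f g; rewrite !IH; ring. Qed.

Lemma bernstein_cst m y c : bernstein m y (fun=> c) = c.
Proof. by elim: m => //= m ->; ring. Qed.

Lemma bernstein_affine m y a c f :
  bernstein m y (fun k => c + a * f k) = c + a * bernstein m y f.
Proof. by elim: m f => //= m IH f; rewrite !IH; ring. Qed.

(** The second moment about [c] of a binomial law: squared bias plus variance. The centre is left
    general because the induction replaces [c] by [c - 1]. *)
Lemma bernstein_sqr m y c :
  bernstein m y (fun k => (k%:R - c) ^+ 2) = (m%:R * y - c) ^+ 2 + m%:R * (y * (1 - y)).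
Proof.
elim: m c => [|m IH] c /=; first by ring.
have -> : (fun k => (k.+1%:R - c) ^+ 2) = (fun k => (k%:R - (c - 1)) ^+ 2).
  by apply/funext => k; rewrite -natr1; congr (_ ^+ 2); ring.
by rewrite !IH -natr1; ring.
Qed.

Lemma bernstein_le m y f g : 0 <= y <= 1 -> (forall k, f k <= g k) ->
  bernstein m y f <= bernstein m y g.
Proof.
move=> /andP[y0 y1]; elim: m f g => [|m IH] f g fg /=; first exact: fg.
by rewrite lerD// ler_wpM2l ?subr_ge0// IH// => k; exact: fg.
Qed.

Lemma bernstein_norm m y f M : 0 <= y <= 1 -> (forall k, `|f k| <= M) ->
  `|bernstein m y f| <= M.
Proof.
move=> y01 fM; rewrite ler_norml -{1}(bernstein_cst m y (- M)).
rewrite -{2}(bernstein_cst m y M).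
by apply/andP; split; apply: bernstein_le => // k; have := fM k;
  rewrite ler_norml => /andP[].
Qed.

Arguments bernstein : simpl never.

Lemma bernstein_cvg (phi : R -> R) M y : 0 <= y <= 1 ->
  (forall z, `|phi z| <= M) -> {for y, continuous phi} ->
  bernstein m.+1 y (fun k => phi (k%:R / m.+1%:R)) @[m --> \oo] --> phi y.
Proof.
move=> y01 phiM cphi; apply/cvgrPdist_le => e e0.
have e2 : 0 < e / 2 by rewrite divr_gt0.
have M0 : 0 <= M by exact: le_trans (phiM 0).
have [d /= d0 dP] := cvgr_dist_le _ _ cphi _ e2.
(* Chebyshev's trick: farther than [d] from [y] the crude bound [2 * M] is at most [K] times the
   squared distance, whose Bernstein average is of order 1/m. *)
pose K := 2 * M / d ^+ 2.
have K0 : 0 <= K by rewrite divr_ge0 ?mulr_ge0 ?exprn_ge0 ?(ltW d0).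
have phiK z : `|phi z - phi y| <= e / 2 + K * (z - y) ^+ 2.
  have [zd|dz] := ltP `|y - z| d.
    rewrite distrC; apply: le_trans (dP _ zd) _.
    by rewrite lerDl mulr_ge0// sqr_ge0.
  apply: (@le_trans _ _ (2 * M)).
    by rewrite (le_trans (ler_normB _ _))// mulr_natl mulr2n lerD.
  rewrite ler_wpDl ?(ltW e2)// /K mulrAC ler_pdivlMr ?exprn_gt0//.
  rewrite ler_wpM2l ?mulr_ge0// -(@real_normK _ (z - y)) ?num_real//.
  by rewrite lerXn2r ?nnegrE ?(ltW d0)// distrC.
near=> m.
rewrite distrC -(bernstein_cst m.+1 y (phi y)) -bernsteinB.
have m0 : (0 : R) < m.+1%:R by rewrite ltr0n.
have bd f : (forall k, f k <= e / 2 + K * (k%:R / m.+1%:R - y) ^+ 2) ->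
    bernstein m.+1 y f <= e.
  move=> fk; apply: le_trans (bernstein_le m.+1 y01 fk) _.
  have -> : (fun k => e / 2 + K * (k%:R / m.+1%:R - y) ^+ 2) =
      fun k => e / 2 + K / m.+1%:R ^+ 2 * (k%:R - m.+1%:R * y) ^+ 2.
    apply/funext => k; congr (_ + _); field; exact: lt0r_neq0.
  rewrite bernstein_affine bernstein_sqr subrr expr0n add0r.
  rewrite [leRHS]splitr lerD2l.
  have -> : K / m.+1%:R ^+ 2 * (m.+1%:R * (y * (1 - y))) = K * (y * (1 - y)) / m.+1%:R.
    field; exact: lt0r_neq0.
  rewrite ler_pdivrMr//.
  apply: (@le_trans _ _ (e / 2 * m%:R)); last by rewrite ler_pM2l// ler_nat.
  rewrite -ler_pdivrMl//; near: m; exact: nbhs_infty_ger.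
rewrite ler_norml; apply/andP; split; last first.
  by apply: bd => k; exact: le_trans (ler_norm _) (phiK _).
rewrite lerNl -mulN1r -[X in X <= _]add0r -bernstein_affine.
by apply: bd => k; rewrite add0r mulN1r (le_trans (ler_norm _))// normrN; exact: phiK.
Unshelve. all: by end_near. Qed.

End Bernstein.

Lemma continuous_borel_measurable {R : realType} (E : hilbertType R) (G : E -> R) :
  continuous G -> measurable_fun setT (G : borel E -> R).
Proof.
move=> /continuousP cG; apply: (measurability _ (RGenOpens.measurableE R)).
move=> _ [_ [a [b ->] <-]]; rewrite setTI; apply: sub_sigma_algebra.
exact/cG/interval_open.
Qed.

Lemma continuous_bm {R : realType} (E : hilbertType R) (G : E -> R) M :
  continuous G -> (forall x, `|G x| <= M) ->
  bounded_measurable (G : borel E -> R).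
Proof.
by move=> cG GM; split; [exact: continuous_borel_measurable|exists M].
Qed.

Lemma is_derive_seq {R : realType} (V : normedModType R) (f : V -> R) x v df
    (u : nat -> R) : is_derive x v f df -> (forall n, u n != 0) ->
  u n @[n --> \oo] --> 0 ->
  (u n)^-1 * (f (x + u n *: v) - f x) @[n --> \oo] --> df.
Proof.
move=> [dl <-] u0 cu.
have /cvgr_dnbhsP/(_ u (conj u0 cu)) := dl.
apply: cvg_trans; apply: near_eq_cvg; apply: nearW => n /=.
by rewrite [x + _]addrC.
Qed.

Section SameLaw.
Context {R : realType} {E : hilbertType R}.
Context d1 d2 (T1 : measurableType d1) (T2 : measurableType d2).
Variables (P1 : probability T1 R) (P2 : probability T2 R).
Variables (X1 : T1 -> borel E) (X2 : T2 -> borel E).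
Hypothesis mX1 : measurable_fun setT X1.
Hypothesis mX2 : measurable_fun setT X2.
Hypothesis cosX : forall xi : E,
  (\int[P1]_t cos (inner xi (X1 t)) = \int[P2]_t cos (inner xi (X2 t)))%R.
Hypothesis sinX : forall xi : E,
  (\int[P1]_t sin (inner xi (X1 t)) = \int[P2]_t sin (inner xi (X2 t)))%R.

(* The frequency [xi] is included so that the class is stable under
   multiplication by trigonometric functions. *)
Definition same_law (F : E -> R) :=
  bounded_measurable (F : borel E -> R) /\
  forall (xi : E) c,
    (\int[P1]_t (F (X1 t) * cos (inner xi (X1 t) + c)) =
     \int[P2]_t (F (X2 t) * cos (inner xi (X2 t) + c)))%R.

Lemma bm_cos (xi : E) c : bounded_measurable ((fun x => cos (inner xi x + c)) : borel E -> R).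
Proof.
apply: (@continuous_bm _ _ _ 1) => x; last exact: cos_max.
apply: (@continuous_comp _ _ _ (fun x => inner xi x + c) cos); last exact: continuous_cos.
by apply: cvgD; [exact: continuous_innerr|exact: cvg_cst].
Qed.

Lemma bm_sin (xi : E) : bounded_measurable ((fun x => sin (inner xi x)) : borel E -> R).
Proof.
apply: (@continuous_bm _ _ _ 1) => x; last exact: sin_max.
apply: (@continuous_comp _ _ _ (fun x => inner xi x) sin); last exact: continuous_sin.
exact: continuous_innerr.
Qed.

Lemma same_law1 : same_law (fun=> 1).
Proof.
split; first exact: bm_cst.
have bc (xi : E) : bounded_measurable ((fun x => cos (inner xi x)) : borel E -> R).
  by have := bm_cos xi 0; congr bounded_measurable; apply/funext => x; rewrite addr0.
have key d (T : measurableType d) (P : probability T R) (X : T -> borel E) xi c :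
    measurable_fun setT X ->
    (\int[P]_t (1 * cos (inner xi (X t) + c)))%R =
    cos c * (\int[P]_t cos (inner xi (X t)))%R - sin c * (\int[P]_t sin (inner xi (X t)))%R.
  move=> mX; have b1 := bm_comp mX (bc xi); have b2 := bm_comp mX (bm_sin xi).
  rewrite -bm_integralZ// -bm_integralZ// -bm_integralB//; [|exact: bmZ..].
  by apply: eq_Rintegral => t _; rewrite mul1r cosD mulrC [X in _ - X]mulrC.
by move=> xi c; rewrite !key// cosX sinX.
Qed.

Lemma same_law_integral F : same_law F ->
  (\int[P1]_t F (X1 t) = \int[P2]_t F (X2 t))%R.
Proof.
move=> [_ /(_ 0 0) FE].
have h d (T : measurableType d) (P : probability T R) (X : T -> borel E) :
    (\int[P]_t (F (X t) * cos (inner 0 (X t) + 0)))%R = (\int[P]_t F (X t))%R.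
  by apply: eq_Rintegral => t _; rewrite inner0l addr0 cos0 mulr1.
by rewrite -!h.
Qed.

Lemma same_law_affine a b F G : same_law F -> same_law G ->
  same_law (fun x => a * F x + b * G x).
Proof.
move=> [bF hF] [bG hG]; split; first by apply: bmD; exact: bmZ.
move=> xi c.
have key d (T : measurableType d) (P : probability T R) (X : T -> borel E) :
    measurable_fun setT X ->
    (\int[P]_t ((a * F (X t) + b * G (X t)) * cos (inner xi (X t) + c)))%R =
    a * (\int[P]_t (F (X t) * cos (inner xi (X t) + c)))%R +
    b * (\int[P]_t (G (X t) * cos (inner xi (X t) + c)))%R.
  move=> mX; have b1 := bm_comp mX (bmM bF (bm_cos xi c)).
  have b2 := bm_comp mX (bmM bG (bm_cos xi c)).
  rewrite -bm_integralZ// -bm_integralZ// -bm_integralD//; [|exact: bmZ..].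
  by apply: eq_Rintegral => t _; rewrite mulrDl !mulrA.
by rewrite !key// hF hG.
Qed.

Lemma same_law_cosM F (xi : E) c : same_law F ->
  same_law (fun x => F x * cos (inner xi x + c)).
Proof.
move=> [bF hF]; split; first exact: bmM bF (bm_cos xi c).
move=> xi' c'.
have key d (T : measurableType d) (P : probability T R) (X : T -> borel E) :
    measurable_fun setT X ->
    (\int[P]_t (F (X t) * cos (inner xi (X t) + c) * cos (inner xi' (X t) + c')))%R =
    2^-1 * (\int[P]_t (F (X t) * cos (inner (xi + xi') (X t) + (c + c'))))%R +
    2^-1 * (\int[P]_t (F (X t) * cos (inner (xi - xi') (X t) + (c - c'))))%R.
  move=> mX; have b1 := bm_comp mX (bmM bF (bm_cos (xi + xi') (c + c'))).
  have b2 := bm_comp mX (bmM bF (bm_cos (xi - xi') (c - c'))).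
  rewrite -bm_integralZ// -bm_integralZ// -bm_integralD//; [|exact: bmZ..].
  apply: eq_Rintegral => t _.
  set u := inner xi _ + c; set v := inner xi' _ + c'.
  have -> : inner (xi + xi') (X t) + (c + c') = u + v by rewrite innerDl addrACA.
  have -> : inner (xi - xi') (X t) + (c - c') = u - v.
    by rewrite innerBl /u /v; ring.
  by rewrite cosD cosB; field.
by rewrite !key// !hF.
Qed.

Lemma same_law_lim (F_ : nat -> E -> R) F M :
  (forall n, same_law (F_ n)) -> (forall n x, `|F_ n x| <= M) ->
  (forall x, F_ n x @[n --> \oo] --> F x) -> same_law F.
Proof.
move=> sF FM cF.
have [bF _] := @dominated_cvg_prob R _ T1 P1 (fun n => F_ n \o X1) (F \o X1) M
  (fun n => measurableT_comp (sF n).1.1 mX1) (fun n t => FM n (X1 t)) (fun t => cF (X1 t)).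
split.
  split; last first.
    exists M => x; rewrite leNgt; apply/negP => MFx.
    have [N _ /(_ N (leqnn N))/=] := cvgr_norm_gt _ (cF x) _ MFx.
    by rewrite ltNge FM.
  apply: (@measurable_fun_cvg _ (borel E) _ _ F_) => [n|x _]; last exact: cF.
  by have [[]] := sF n.
move=> xi c.
have key d (T : measurableType d) (P : probability T R) (X : T -> borel E) :
    measurable_fun setT X ->
    (\int[P]_t (F_ n (X t) * cos (inner xi (X t) + c)))%R @[n --> \oo] -->
    (\int[P]_t (F (X t) * cos (inner xi (X t) + c)))%R.
  move=> mX; have [] // := @dominated_cvg_prob R _ T P
    (fun n t => F_ n (X t) * cos (inner xi (X t) + c))
    (fun t => F (X t) * cos (inner xi (X t) + c)) M.
  - by move=> n; have [] := bm_comp mX (bmM (sF n).1 (bm_cos xi c)).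
  - by move=> n t; rewrite normrM (le_trans _ (FM n (X t)))// ler_piMr// cos_max.
  - by move=> t; apply: cvgM; [exact: cF|exact: cvg_cst].
apply: (cvg_unique _ (key _ _ _ _ mX1)) => //.
rewrite (_ : (fun _ => _) = fun n => (\int[P2]_t (F_ n (X2 t) * cos (inner xi (X2 t) + c)))%R).
  exact: key.
by apply/funext => n; exact: (sF n).2.
Qed.

(** A cosine rescaled to [0, 1], the range of a Bernstein variable. It is affine in the cosine, so
    multiplying by it or by its complement preserves [same_law]. *)
Let frac (xi : E) c x : R := (1 + cos (inner xi x + c)) / 2.

Lemma same_law_bernstein (xi : E) c m (F_ : nat -> E -> R) :
  (forall k, same_law (F_ k)) ->
  same_law (fun x => bernstein m (frac xi c x) (fun k => F_ k x)).
Proof.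
elim: m F_ => [|m IH] F_ sF; first exact: sF.
have s1 := IH _ (fun k => sF k.+1); have s2 := IH _ sF.
have := same_law_affine 1 1
  (same_law_affine 2^-1 2^-1 s1 (same_law_cosM xi c s1))
  (same_law_affine 2^-1 (- 2^-1) s2 (same_law_cosM xi c s2)).
by congr same_law; apply/funext => x; rewrite /bernstein -/bernstein /frac; field.
Qed.

Variable h : nat -> E.

Lemma frac01 xi c x : 0 <= frac xi c x <= 1.
Proof.
rewrite /frac; have := cos_max (inner xi x + c); rewrite ler_norml => /andP[].
by move=> *; apply/andP; split; lra.
Qed.

(* [a cos (t / a - pi / 2) = a sin (t / a)] is a bounded substitute for the
   coordinate [t]; the coordinates are substituted one at a time, by Bernstein
   approximation in the variable [frac]. *)
Lemma same_law_box n (a : R) (G : E -> R) M : continuous G -> (forall x, `|G x| <= M) ->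
  same_law (fun x => G (\sum_(0 <= i < n)
    (a * cos (inner (a^-1 *: h i) x + - (pi / 2))) *: h i)).
Proof.
elim: n G => [|n IH] G cG GM.
  under eq_fun do rewrite big_geq//.
  by have := same_law_affine (G 0) 0 same_law1 same_law1; congr same_law;
    apply/funext => x; ring.
pose v x := \sum_(0 <= i < n) (a * cos (inner (a^-1 *: h i) x + - (pi / 2))) *: h i.
pose y := frac (a^-1 *: h n) (- (pi / 2)).
pose phi x z : R := G (v x + (a * (2 * z - 1)) *: h n).
apply: (@same_law_lim (fun m x => bernstein m.+1 (y x) (fun k => phi x (k%:R / m.+1%:R))) _ M).
- move=> m; apply: (@same_law_bernstein _ _ _ (fun k x => phi x (k%:R / m.+1%:R))) => k.
  apply: (IH (fun w => G (w + (a * (2 * (k%:R / m.+1%:R) - 1)) *: h n))) => [w|w]; last exact: GM.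
  apply: (@continuous_comp _ _ _ (fun w => w + _) G); last exact: cG.
  by apply: cvgD; [exact: cvg_id|exact: cvg_cst].
- by move=> m x; apply: bernstein_norm => [|k]; [exact: frac01|exact: GM].
- move=> x; rewrite big_nat_recr//= -/(v x).
  have -> : a * cos (inner (a^-1 *: h n) x + - (pi / 2)) = a * (2 * y x - 1).
    by rewrite /y /frac; field.
  apply: (@bernstein_cvg _ (phi x) M); [exact: frac01|by move=> z; exact: GM|].
  rewrite /phi; apply: (@continuous_comp R E R (fun z => v x + (a * (2 * z - 1)) *: h n) G (y x)); last exact: cG.
  apply: cvgD; first exact: cvg_cst.
  apply: cvgZ; last exact: cvg_cst.
  apply: cvgM; first exact: cvg_cst.
  apply: cvgB; last exact: cvg_cst.
  by apply: cvgM; [exact: cvg_cst|exact: cvg_id].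
Qed.

Hypothesis hb : hilbert_basis h.

(** Two pointwise limits under the uniform bound [M]: the amplitude of the bounded coordinates grows
    until they become the true ones, then the number of coordinates grows. *)
Lemma charfun_unique (G : E -> R) M : continuous G -> (forall x, `|G x| <= M) ->
  (\int[P1]_t G (X1 t) = \int[P2]_t G (X2 t))%R.
Proof.
move=> cG GM; apply: same_law_integral.
apply: (@same_law_lim (fun n x => G (\sum_(0 <= i < n) inner x (h i) *: h i)) _ M).
- move=> n.
  apply: (@same_law_lim (fun k x => G (\sum_(0 <= i < n)
      (k.+1%:R * cos (inner (k.+1%:R^-1 *: h i) x + - (pi / 2))) *: h i)) _ M).
  + by move=> k; exact: same_law_box GM.
  + by move=> k x; exact: GM.
  + move=> x; apply: (cvg_comp _ G _ (cG _)).
    apply: cvg_big => [|i _]; first by move=> ?; exact: add_continuous.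
    apply: cvgZ; last exact: cvg_cst.
    (* The bounded coordinate of amplitude [k.+1] is the difference quotient at 0, with step
       [k.+1%:R^-1], of this sine; the derivative is the coordinate itself. *)
    have d0 : is_derive (0 : R) (1 : R) (fun s => sin (inner x (h i) * s)) (inner x (h i)).
      by apply: is_derive_eq; rewrite mulr0 cos0 /GRing.scale/=; ring.
    have hc : (harmonic n : R) @[n --> \oo] --> 0 by exact: cvg_harmonic.
    have hn0 k : (harmonic k : R) != 0 by rewrite /= invr_eq0 pnatr_eq0.
    have := is_derive_seq d0 hn0 hc.
    apply: cvg_trans; apply: near_eq_cvg; apply: nearW => k /=.
    rewrite (_ : k.+1%:R^-1 *: 1 = k.+1%:R^-1 :> R); last exact: mulr1.
    rewrite invrK add0r mulr0 sin0 subr0 cosD cosN sinN.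
    rewrite cos_pihalf sin_pihalf mulr0 add0r mulrN1 opprK innerZl.
    by rewrite innerC [_ * k.+1%:R^-1]mulrC.
- by move=> n x; exact: GM.
- by move=> x; exact: cvg_basis.
Qed.

End SameLaw.

Section BorelMaps.
Context {R : realType} {E : hilbertType R}.

Lemma continuous_borel_map (phi : E -> E) : continuous phi ->
  measurable_fun setT (phi : borel E -> borel E).
Proof.
move=> /continuousP cphi; apply: (@measurability _ _ (borel E) (borel E) setT phi (@open E)) => //.
by move=> _ [B oB <-]; rewrite setTI; apply: sub_sigma_algebra; exact: cphi.
Qed.

Lemma scale_continuous_fixed (a : R) : continuous (fun x : E => a *: x).
Proof. by move=> x; apply: cvgZ; [exact: cvg_cst|exact: cvg_id]. Qed.

Lemma open_borel (B : set E) : open B -> measurable (B : set (borel E)).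
Proof. exact: sub_sigma_algebra. Qed.

Hypothesis sepE : separable_space E.

(** The source carries the product of the Borel sigma-algebras, so an open preimage must be shown to
    be a countable union of rectangles. Separability provides them: products of balls with centres
    in a dense sequence and radii 1/(k+1), kept when their sum lies in [U]. *)
Lemma add_borel_measurable :
  measurable_fun setT (fun z : borel E * borel E => (z.1 : E) + (z.2 : E) : borel E).
Proof.
have [A cA dA] := sepE.
have [e eA] : exists e : nat -> E, forall a, A a -> exists n, e n = a.
  have [f fA] := pcard_surjP cA.
  by exists f => a /fA[n _ <-]; exists n.
apply: (@measurability _ _ (borel E * borel E)%type (borel E) setT _ (@open E)) => //.
move=> _ [U oU <-]; rewrite setTI.
pose rho k : R := k.+1%:R^-1.
have rho0 k : 0 < rho k by rewrite invr_gt0.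
pose F (i : nat * nat * nat) : set (borel E * borel E) :=
  if `[< forall x y : E, ball (e i.1.1) (rho i.2) x -> ball (e i.1.2) (rho i.2) y -> U (x + y) >]
  then (ball (e i.1.1) (rho i.2) : set (borel E)) `*` (ball (e i.1.2) (rho i.2) : set (borel E))
  else set0.
have -> : (fun z : borel E * borel E => (z.1 : E) + (z.2 : E) : borel E) @^-1` U =
    \bigcup_i F i.
  apply/seteqP; split => [[x y] /= Uxy|[x y] [[[i j] k] _]]; last first.
    by rewrite /F; case: asboolP => //= UP [/= bx By]; exact: UP.
  have /nbhs_ballP[eps /= eps0 epsU] : nbhs ((x : E) + (y : E)) U by exact: open_nbhs_nbhs.
  (* Two points of a ball of radius [rho k] are less than [2 * rho k] apart, and this occurs in both
     factors. *)
  have e4 : 0 < eps / 4 by rewrite divr_gt0.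
  pose k := Num.truncn (eps / 4)^-1.
  have kP : rho k < eps / 4.
    rewrite /rho -[ltRHS]invrK ltf_pV2 ?posrE ?invr_gt0//; exact: truncnS_gt.
  have near_e (w : E) : exists n, ball (e n) (rho k) w.
    have [|a [wa Aa]] := dA (ball w (rho k)) _ (ball_open _ _).
      by exists w; exact: ballxx.
    by have [n na] := eA _ Aa; exists n; rewrite na; exact: ball_sym.
  have [i iP] := near_e x; have [j jP] := near_e y.
  exists (i, j, k) => //; rewrite /F asboolT//= => x' y' ix jy.
  apply: epsU; move: iP jP ix jy; rewrite -!ball_normE /ball_/= => iP jP ix jy.
  have -> : (x : E) + (y : E) - (x' + y') =
      ((e i - x') - (e i - x)) + ((e j - y') - (e j - y)).
    have sub3 (a b c : E) : a - b - (a - c) = c - b by rewrite opprB addrC subrKA.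
    by rewrite !sub3 opprD addrACA.
  rewrite (le_lt_trans (ler_normD _ _))//.
  have := ler_normB (e i - x') (e i - x); have := ler_normB (e j - y') (e j - y).
  lra.
apply: countable_bigcupT_measurable => // i.
rewrite /F; case: asboolP => // _.
by apply: measurableX; apply: open_borel; exact: ball_open.
Qed.

Lemma affine_borel_measurable (a b : R) :
  measurable_fun setT
    (fun z : borel E * borel E => a *: (z.1 : E) + b *: (z.2 : E) : borel E).
Proof.
have ms (c : R) := continuous_borel_map (@scale_continuous_fixed c).
have ma := measurableT_comp (ms a) (@measurable_fst _ _ (borel E) (borel E)).
have mb := measurableT_comp (ms b) (@measurable_snd _ _ (borel E) (borel E)).
exact: (measurableT_comp add_borel_measurable (measurable_fun_pair ma mb)).
Qed.

End BorelMaps.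

Lemma seq_cvgM {R : realType} (u v : nat -> R) (a b : R) :
  u n @[n --> \oo] --> a -> v n @[n --> \oo] --> b ->
  u n * v n @[n --> \oo] --> a * b.
Proof. exact: cvgM. Qed.

(** * Gaussian measures: second moments and rotation invariance *)

Section Gaussian.
Context {R : realType} {E : hilbertType R}.
Variables (Qoo : E -> E) (gamma : probability (borel E) R).
Hypothesis gamma_gauss : is_centered_gaussian Qoo gamma.
Hypothesis QooZ : forall (a : R) x,
  inner (Qoo (a *: x)) (a *: x) = a ^+ 2 * inner (Qoo x) x.

Lemma gaussian_cos (xi : E) :
  (\int[gamma]_x cos (inner xi x))%R = expR (- (2^-1 * inner (Qoo xi) xi)).
Proof.
have := gamma_gauss xi; rewrite /charfun /cintegral /cexp /= => -[+ _].
rewrite oppr0 cos0 mulr1 => <-.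
by apply: eq_Rintegral => x _; rewrite !(mul0r, mul1r, mulr0, subr0, addr0, add0r) oppr0 expR0 mul1r.
Qed.

Lemma gaussian_sin (xi : E) : (\int[gamma]_x sin (inner xi x))%R = 0.
Proof.
have := gamma_gauss xi; rewrite /charfun /cintegral /cexp /= => -[_ h].
rewrite oppr0 sin0 [RHS]mulr0 in h; rewrite -[RHS]h.
by apply: eq_Rintegral => x _; rewrite !(mul0r, mul1r, mulr0, subr0, addr0, add0r) oppr0 expR0 mul1r.
Qed.

Lemma sqr_sin_le (u : R) : sin u ^+ 2 <= u ^+ 2.
Proof.
wlog u0 : u / 0 < u.
  move=> W; have [u0|u0|->] := ltgtP u 0; [|exact: W|by rewrite sin0].
  by have := W (- u); rewrite oppr_gt0 sinN !sqrrN; exact.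
have [c _] := @MVT_is_derive R sin cos 0 u u0 (fun s _ => is_derive_sin s).
rewrite sin0 !subr0 => ->; by rewrite exprMn ler_piMl ?sqr_ge0.
Qed.

Lemma inner_borel_measurable (xi : E) : measurable_fun setT (inner xi : borel E -> R).
Proof. exact: continuous_borel_measurable (@continuous_innerr _ _ xi). Qed.

(* The integrals of [(2 sin (t <xi, x> / 2) / t)^2 = 2 (1 - cos (t <xi, x>)) / t^2]
   are known from the characteristic function; they are bounded by the second
   moment and, by Fatou's lemma, their limit bounds it. *)
Lemma gaussian_moment2 (xi : E) :
  (\int[gamma]_x (inner xi x ^+ 2)%:E)%E = (inner (Qoo xi) xi)%:E.
Proof.
pose t n : R := harmonic n.
have t0 n : t n != 0 by rewrite /t /= invr_eq0 pnatr_eq0.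
have ct : t n @[n --> \oo] --> 0 by exact: cvg_harmonic.
pose f n (x : borel E) : R := ((t n / 2)^-1 * sin (t n / 2 * inner xi x)) ^+ 2.
pose k := inner (Qoo xi) xi.
have t20 n : t n / 2 != 0 by rewrite mulf_neq0// invr_eq0 pnatr_eq0.
have mf n : measurable_fun setT (f n).
  apply: measurable_funX; apply: measurable_funM => //.
  apply: measurableT_comp; first exact: (continuous_measurable_fun (@continuous_sin R)).
  by apply: measurable_funM => //; exact: inner_borel_measurable.
have If n : (\int[gamma]_x (f n x)%:E)%E =
    (2 * (t n ^+ 2)^-1 * (1 - expR (- (2^-1 * (t n ^+ 2 * k)))))%:E.
  have bc : bounded_measurable ((fun x => cos (inner (t n *: xi) x)) : borel E -> R).
    have := bm_cos (t n *: xi) 0; congr bounded_measurable.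
    by apply/funext => x; rewrite addr0.
  have -> : f n = fun x => 2 * (t n ^+ 2)^-1 * (1 - cos (inner (t n *: xi) x)).
    apply/funext => x; rewrite /f innerZl.
    have -> : t n * inner xi x = t n / 2 * inner xi x + t n / 2 * inner xi x by field.
    rewrite cosD -!expr2 cos2sin2 exprMn; field; exact: t0.
  rewrite bm_integral_EFin; last by apply: bmZ; apply: bmB => //; exact: bm_cst.
  rewrite bm_integralZ; last by apply: bmB => //; exact: bm_cst.
  rewrite bm_integralB//; last exact: bm_cst.
  by rewrite prob_integral_cst gaussian_cos QooZ.
have cIf : (\int[gamma]_x (f n x)%:E)%E @[n --> \oo] --> k%:E.
  under eq_fun do rewrite If.
  apply: cvg_EFin; first exact: nearW.
  have d0 : is_derive (0 : R) (1 : R) (fun s => expR (- (2^-1 * (s * k)))) (- (2^-1 * k)).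
    by apply: is_derive_eq; rewrite mul0r mulr0 oppr0 expR0 /GRing.scale/=; ring.
  have ct2 : t n ^+ 2 @[n --> \oo] --> 0.
    by have := cvg_comp _ _ ct (@exprn_continuous R 2 0); rewrite expr0n.
  have t2 n : t n ^+ 2 != 0 by rewrite expf_neq0.
  have c2 : (- 2 : R) @[_ --> \oo] --> (- 2 : R) by exact: cvg_cst.
  have := seq_cvgM c2 (is_derive_seq d0 t2 ct2).
  rewrite (_ : - 2 * - (2^-1 * k) = k); last by field.
  apply: cvg_trans; apply: near_eq_cvg; apply: nearW => n /=.
  rewrite (_ : t n ^+ 2 *: 1 = t n ^+ 2 :> R); last exact: mulr1.
  by rewrite add0r mul0r mulr0 oppr0 expR0; ring.
have cf x : f n x @[n --> \oo] --> inner xi x ^+ 2.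
  have d0 : is_derive (0 : R) (1 : R) (fun s => sin (s * inner xi x)) (inner xi x).
    by apply: is_derive_eq; rewrite mul0r cos0 /GRing.scale/=; ring.
  have ct2 : t n / 2 @[n --> \oo] --> 0.
    have c2 : (2^-1 : R) @[_ --> \oo] --> (2^-1 : R) by exact: cvg_cst.
    by have := seq_cvgM ct c2; rewrite mul0r.
  have h := is_derive_seq d0 t20 ct2.
  have := seq_cvgM h h; rewrite -expr2; apply: cvg_trans.
  apply: near_eq_cvg; apply: nearW => n /=.
  rewrite (_ : (t n / 2) *: 1 = t n / 2 :> R); last exact: mulr1.
  by rewrite add0r mul0r sin0 subr0 /f expr2.
have mI : measurable_fun setT (fun x : borel E => (inner xi x ^+ 2)%:E).
  by apply/measurable_EFinP; apply: measurable_funX; exact: inner_borel_measurable.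
have mfE n : measurable_fun setT (fun x : borel E => (f n x)%:E) by exact/measurable_EFinP.
apply/eqP; rewrite eq_le; apply/andP; split.
- have f0 n (x : borel E) : setT x -> (0 <= (f n x)%:E)%E by rewrite lee_fin sqr_ge0.
  have := fatou gamma measurableT mfE f0.
  rewrite (is_cvg_limn_einfE (cvgP _ cIf)) (cvg_lim _ cIf)//; congr (_ <= _)%E.
  apply: eq_integral => x _.
  have cfE : (f n x)%:E @[n --> \oo] --> (inner xi x ^+ 2)%:E.
    by apply: cvg_EFin; [exact: nearW|exact: cf].
  by rewrite (is_cvg_limn_einfE (cvgP _ cfE)) (cvg_lim _ cfE).
- rewrite -/k -(cvg_lim _ cIf)//; apply: lime_le; first exact: (cvgP _ cIf).
  apply: nearW => n; apply: ge0_le_integral => //.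
  + by move=> x _; rewrite lee_fin sqr_ge0.
  + move=> x _; rewrite lee_fin /f exprMn exprVn.
    have c2 : 0 < (t n / 2) ^+ 2 by rewrite exprn_even_gt0// t20 orbT.
    by rewrite ler_pdivrMl// -exprMn; exact: sqr_sin_le.
Qed.

Hypothesis sepE : separable_space E.
Variable h : nat -> E.
Hypothesis hb : hilbert_basis h.

Lemma bm_inner_cos (xi : E) : bounded_measurable ((fun x => cos (inner xi x)) : borel E -> R).
Proof.
by have := bm_cos xi 0; congr bounded_measurable; apply/funext => x; rewrite addr0.
Qed.

Lemma gaussian_iterated_trig (a b : R) (xi : E) :
  (\int[gamma]_x \int[gamma]_y cos (inner xi (a *: (x : E) + b *: (y : E))))%R =
    expR (- (2^-1 * ((a ^+ 2 + b ^+ 2) * inner (Qoo xi) xi))) /\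
  (\int[gamma]_x \int[gamma]_y sin (inner xi (a *: (x : E) + b *: (y : E))))%R = 0.
Proof.
have bc r := bm_inner_cos (r *: xi); have bs r := bm_sin (r *: xi).
have iE r s (x y : E) : inner xi (r *: x + s *: y) = inner (r *: xi) x + inner (s *: xi) y.
  by rewrite innerDr !innerZr !innerZl.
split.
- have e1 (x : borel E) : (\int[gamma]_y cos (inner xi (a *: (x : E) + b *: (y : E))))%R =
      expR (- (2^-1 * (b ^+ 2 * inner (Qoo xi) xi))) * cos (inner (a *: xi) x).
    rewrite -QooZ -gaussian_cos.
    under eq_Rintegral do rewrite iE cosD.
    rewrite bm_integralB; [|exact: bmZ..].
    by rewrite !bm_integralZ// gaussian_sin mulr0 subr0 mulrC.
  under eq_Rintegral do rewrite e1.
  rewrite bm_integralZ// gaussian_cos QooZ -expRD; congr expR; ring.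
- have e1 (x : borel E) : (\int[gamma]_y sin (inner xi (a *: (x : E) + b *: (y : E))))%R =
      expR (- (2^-1 * (b ^+ 2 * inner (Qoo xi) xi))) * sin (inner (a *: xi) x).
    rewrite -QooZ -gaussian_cos.
    under eq_Rintegral do rewrite iE sinD.
    rewrite bm_integralD; [|exact: bmZ..].
    by rewrite !bm_integralZ// gaussian_sin mulr0 addr0 mulrC.
  under eq_Rintegral do rewrite e1.
  by rewrite bm_integralZ// gaussian_sin mulr0.
Qed.

(** Independent copies weighted by [a] and [b] have covariance [(a ^+ 2 + b ^+ 2) Qoo], that of one
    copy scaled by [c], so the characteristic functions coincide. *)
Lemma gaussian_stable (a b c : R) (G : E -> R) M : a ^+ 2 + b ^+ 2 = c ^+ 2 ->
  continuous G -> (forall x, `|G x| <= M) ->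
  (\int[gamma]_x \int[gamma]_y G (a *: (x : E) + b *: (y : E)) =
   \int[gamma]_x G (c *: (x : E)))%R.
Proof.
move=> abc cG GM.
have mab := affine_borel_measurable sepE a b.
have bG := continuous_bm cG GM.
rewrite -(bm_fubini1 gamma gamma (bm_comp mab bG)).
have mc := continuous_borel_map (@scale_continuous_fixed _ E c).
apply: (charfun_unique (P1 := (gamma \x gamma)%E) mab mc _ _ hb cG GM) => xi.
- rewrite (bm_fubini1 gamma gamma (bm_comp mab (bm_inner_cos xi))).
  rewrite (gaussian_iterated_trig a b xi).1.
  under [RHS]eq_Rintegral do rewrite innerZr -innerZl.
  by rewrite gaussian_cos QooZ abc.
- rewrite (bm_fubini1 gamma gamma (bm_comp mab (bm_sin xi))).
  rewrite (gaussian_iterated_trig a b xi).2.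
  under [RHS]eq_Rintegral do rewrite innerZr -innerZl.
  by rewrite gaussian_sin.
Qed.

End Gaussian.

(** * The covariance operators *)

Section ExpIntegral.
Context {R : realType}.

Lemma Rintegral_expR (a : R) : a < 0 ->
  (\int[lebesgue_measure]_(s in `[0%R, +oo[) expR (a * s))%R = - a^-1.
Proof.
move=> a0.
have dF (x : R) : is_derive x 1 (fun s => a^-1 * expR (a * s)) (expR (a * x)).
  apply: is_derive_eq; rewrite /GRing.scale/=; field; exact: ltr0_neq0.
rewrite (@Rintegral_ge0_continuous_FTC2y _ _ (fun s => a^-1 * expR (a * s)) 0 0).
- by rewrite mulr0 expR0 mulr1 sub0r.
- by move=> *; exact: expR_ge0.
- apply: continuous_subspaceT => x.
  apply: (@continuous_comp _ _ _ (fun s => a * s) expR); last exact: continuous_expR.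
  by apply: cvgM; [exact: cvg_cst|exact: cvg_id].
- rewrite -(mulr0 a^-1); apply: cvgM; first exact: cvg_cst.
  under eq_fun do rewrite -[X in expR X]opprK -mulNr.
  apply: (@cvg_comp _ _ _ (fun x => - a * x) (fun y => expR (- y)) _ (pinfty_nbhs R)).
    by apply: gt0_cvgMry; [rewrite oppr_gt0|exact: cvg_id].
  exact: cvgr_expR.
- by move=> x _; have [] := dF x.
- have cF : {for (0 : R), continuous (fun s => a^-1 * expR (a * s))}.
    by apply: differentiable_continuous; apply/derivable1_diffP; have [] := dF 0.
  exact: (cvg_at_right_filter cF).
- by move=> x _; rewrite derive1E; have [_ ->] := dF x.
Qed.

End ExpIntegral.

Section Covariance.
Context {R : realType} {E : hilbertType R}.
Variable Q : {linear E -> E}.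
Hypothesis Q_tc : nonneg_sym_trace_class Q.
Variable S : R -> {linear E -> E}.
Hypothesis S_C0 : C0_semigroup S.
Hypothesis A_neg : forall x, gen_dom S x -> x != 0 -> inner (gen S x) x < 0.
Variables (h : nat -> E) (alpha : nat -> R).
Hypothesis h_eigen : adjoint_eigenbasis S h alpha.
Variable Qoo : E -> E.
Hypothesis Qoo_def : is_Q_infty Q S Qoo.

Let hb : hilbert_basis h. Proof. by case: h_eigen. Qed.

Let Q_sym x y : inner (Q x) y = inner x (Q y). Proof. by case: Q_tc. Qed.

Let Q_ge0 x : 0 <= inner (Q x) x. Proof. by case: Q_tc. Qed.

Let qf x y s := inner (Q (S s x)) (S s y).

Lemma Qoo_formE s x y : `[0%R, +oo[%classic s ->
  inner (S s (Q (adj setT (S s) x))) y = qf x y s.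
Proof.
rewrite /= in_itv/= andbT => s0.
by rewrite (adj_semigroup S_C0 hb h_eigen)// (semigroup_selfadjoint S_C0 hb h_eigen).
Qed.

Lemma qf_integrable x y :
  lebesgue_measure.-integrable `[0%R, +oo[ (EFin \o qf x y).
Proof.
have [+ _] := Qoo_def x y; apply: eq_integrable => // s.
by rewrite inE => s0; rewrite /= Qoo_formE.
Qed.

Lemma inner_QooE x y :
  inner (Qoo x) y = (\int[lebesgue_measure]_(s in `[0%R, +oo[) qf x y s)%R.
Proof.
have [_ ->] := Qoo_def x y; apply: eq_Rintegral => s; rewrite inE => s0.
exact: Qoo_formE.
Qed.

Lemma QooC x y : inner (Qoo x) y = inner (Qoo y) x.
Proof.
rewrite !inner_QooE; apply: eq_Rintegral => s _.
by rewrite /qf Q_sym innerC.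
Qed.

Lemma Qoo_linear a x x' y :
  inner (Qoo (a *: x + x')) y = a * inner (Qoo x) y + inner (Qoo x') y.
Proof.
rewrite !inner_QooE -RintegralZl//; last exact: qf_integrable.
rewrite -RintegralD//; [|exact: (integrableZl _ a (qf_integrable _ _))|exact: qf_integrable].
by apply: eq_Rintegral => s _; rewrite /qf !linearP/= innerDl innerZl.
Qed.

Lemma Qoo_ge0 x : 0 <= inner (Qoo x) x.
Proof. by rewrite inner_QooE; apply: Rintegral_ge0 => s _; exact: Q_ge0. Qed.

Lemma QooDl x x' y : inner (Qoo (x + x')) y = inner (Qoo x) y + inner (Qoo x') y.
Proof. by rewrite -[x]scale1r Qoo_linear mul1r scale1r. Qed.

Lemma Qoo0l y : inner (Qoo 0) y = 0.
Proof.
by have := QooDl 0 0 y; rewrite addr0 => /eqP; rewrite -subr_eq0 opprD addrA subrr sub0r oppr_eq0 => /eqP.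
Qed.

Lemma QooZl a x y : inner (Qoo (a *: x)) y = a * inner (Qoo x) y.
Proof. by rewrite -[a *: x]addr0 Qoo_linear Qoo0l addr0. Qed.

Lemma QooZ (a : R) x : inner (Qoo (a *: x)) (a *: x) = a ^+ 2 * inner (Qoo x) x.
Proof. by rewrite QooZl innerZr expr2 mulrA. Qed.

Lemma Qoo_suml n (F : 'I_n -> E) y :
  inner (Qoo (\sum_(i < n) F i)) y = \sum_(i < n) inner (Qoo (F i)) y.
Proof.
by apply: (big_morph (fun x => inner (Qoo x) y)) => [x x'|]; [exact: QooDl|exact: Qoo0l].
Qed.

Lemma Qoo_cauchy_schwarz x y : 0 < inner (Qoo y) y ->
  inner (Qoo x) y ^+ 2 <= inner (Qoo x) x * inner (Qoo y) y.
Proof.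
move=> y0; have := Qoo_ge0 (inner (Qoo y) y *: x + (- inner (Qoo x) y) *: y).
rewrite QooDl !QooZl !innerDr !innerZr (QooC y x) => H.
suff : 0 <= inner (Qoo y) y * (inner (Qoo x) x * inner (Qoo y) y - inner (Qoo x) y ^+ 2).
  by rewrite pmulr_rge0// subr_ge0.
by apply: le_trans H _; rewrite le_eqVlt; apply/orP; left; apply/eqP; ring.
Qed.

(** The Lyapunov equation A Qoo + Qoo A^* = - Q in coordinates: on a pair of eigenvectors the
    covariance integrand is a single decaying exponential. *)
Lemma Qoo_basis i j :
  inner (Qoo (h i)) (h j) * (alpha i + alpha j) = - inner (Q (h i)) (h j).
Proof.
have an k := eigenvalue_neg S_C0 hb h_eigen A_neg k.
have aij : alpha i + alpha j < 0 by have := an i; have := an j; lra.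
rewrite inner_QooE.
have -> : (\int[lebesgue_measure]_(s in `[0%R, +oo[) qf (h i) (h j) s)%R =
  (\int[lebesgue_measure]_(s in `[0%R, +oo[) (inner (Q (h i)) (h j) * expR ((alpha i + alpha j) * s)))%R.
  apply: eq_Rintegral => s; rewrite inE/= in_itv/= andbT => s0.
  rewrite /qf !(semigroup_eigen S_C0 hb h_eigen)// linearZ/= innerZl innerZr.
  by rewrite mulrA -expRD -mulrDl mulrC.
(* Integrability of the exponential is recovered from that of the covariance integrand by dividing
   by the coefficient, so a zero coefficient is treated apart. *)
have [->|q0] := eqVneq (inner (Q (h i)) (h j)) 0.
  under eq_Rintegral do rewrite mul0r.
  by rewrite /Rintegral integral0 mul0r oppr0.
rewrite RintegralZl//; last first.
  have : lebesgue_measure.-integrable `[0%R, +oo[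
      (fun s => (inner (Q (h i)) (h j))^-1%:E * (EFin \o qf (h i) (h j)) s)%E.
    exact: (integrableZl _ _ (qf_integrable _ _)).
  apply: eq_integrable => // s; rewrite inE/= in_itv/= andbT => s0.
  rewrite -EFinM /qf !(semigroup_eigen S_C0 hb h_eigen)// linearZ/= innerZl innerZr.
  by rewrite [expR (alpha i * s) * _]mulrA -expRD -mulrDl [expR _ * _]mulrC mulKf.
by rewrite Rintegral_expR//; field; exact: ltr0_neq0.
Qed.

Variable n : nat.
Variable c : 'I_n -> R.
Let v := \sum_(i < n) c i *: h i.

Let W t := inner (Qoo (S t v)) (S t v).

Lemma Qoo_semigroupE t : 0 <= t -> W t =
  \sum_(i < n) \sum_(j < n)
    c i * c j * inner (Qoo (h i)) (h j) * expR ((alpha i + alpha j) * t).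
Proof.
move=> t0; rewrite /W /v linear_sum Qoo_suml; apply: eq_bigr => i _.
rewrite inner_sumr; apply: eq_bigr => j _.
rewrite !linearZ/= !(semigroup_eigen S_C0 hb h_eigen)// !scalerA QooZl innerZr.
by rewrite mulrDl expRD; ring.
Qed.

(** [v] is a finite combination of eigenvectors, so [W] is a finite sum of exponentials,
    differentiated term by term; [Qoo_basis] turns the coefficients into those of [Q]. *)
Lemma Qoo_semigroup_derive :
  (harmonic k)^-1 * (W 0 - W (harmonic k)) @[k --> \oo] --> inner (Q v) v.
Proof.
have t0 k : (harmonic k : R) != 0 by rewrite /= invr_eq0 pnatr_eq0.
have ct : (harmonic k : R) @[k --> \oo] --> 0 by exact: cvg_harmonic.
have -> : inner (Q v) v = \sum_(i < n) \sum_(j < n)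
    c i * c j * inner (Qoo (h i)) (h j) * (- (alpha i + alpha j)).
  rewrite /v linear_sum inner_suml; apply: eq_bigr => i _.
  rewrite inner_sumr; apply: eq_bigr => j _.
  rewrite linearZ/= innerZl innerZr -[inner (Q _) _]opprK -Qoo_basis; ring.
have : \sum_(i < n) \sum_(j < n) c i * c j * inner (Qoo (h i)) (h j) *
    ((harmonic k)^-1 * (1 - expR ((alpha i + alpha j) * harmonic k))) @[k --> \oo] -->
    \sum_(i < n) \sum_(j < n) c i * c j * inner (Qoo (h i)) (h j) * (- (alpha i + alpha j)).
  apply: cvg_big => [|i _]; first by move=> ?; exact: add_continuous.
  apply: cvg_big => [|j _]; first by move=> ?; exact: add_continuous.
  apply: seq_cvgM; first exact: cvg_cst.
  have d0 : is_derive (0 : R) (1 : R) (fun s => - expR ((alpha i + alpha j) * s)) (- (alpha i + alpha j)).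
    by apply: is_derive_eq; rewrite mulr0 expR0 /GRing.scale/=; ring.
  have := is_derive_seq d0 t0 ct.
  apply: cvg_trans; apply: near_eq_cvg; apply: nearW => k.
  rewrite (_ : harmonic k *: 1 = harmonic k :> R); last exact: mulr1.
  by rewrite add0r mulr0 expR0 opprK addrC.
apply: cvg_trans; apply: near_eq_cvg; apply: nearW => k.
have hk : 0 <= harmonic k :> R by exact: harmonic_ge0.
rewrite !Qoo_semigroupE// -sumrB mulr_sumr; apply: eq_bigr => i _.
rewrite -sumrB mulr_sumr; apply: eq_bigr => j _.
by rewrite mulr0 expR0; ring.
Qed.

Variable gamma : probability (borel E) R.
Hypothesis gamma_gauss : is_centered_gaussian Qoo gamma.

Lemma cm_normP (x : E) (r : R) : (cm_norm gamma x <= r%:E)%E <->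
  forall xi, inner (Qoo xi) xi <= 1 -> inner xi x <= r.
Proof.
split=> [xr xi xi1|xr].
  rewrite -lee_fin; apply: le_trans xr; apply: ereal_sup_ubound.
  by exists xi => //=; rewrite (gaussian_moment2 gamma_gauss QooZ) lee_fin.
apply: ge_ereal_sup => _ [xi /= + <-].
by rewrite (gaussian_moment2 gamma_gauss QooZ) !lee_fin; exact: xr.
Qed.

(** The vector [x], a multiple of [Qoo (S t v)], has Cameron-Martin norm at most 1 by Cauchy-Schwarz
    for the form of [Qoo]. Pairing [S t x] with the normalized functional [v], and moving [S t]
    across by self-adjointness, yields exactly this square root. *)
Lemma Qoo_opnorm t : 0 <= t -> 0 < W 0 ->
  ((Num.sqrt (W t / W 0))%:E <= cm_opnorm gamma (S t))%E.
Proof.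
move=> t0 W0; rewrite le_eqVlt in t0.
have {}t0 : 0 <= t by rewrite le_eqVlt.
(* If [W t] vanishes the normalization breaks down, but only nonnegativity of the norm is left to
   prove, and the zero vector shows it. *)
have [Wt|Wt] := leP (W t) 0.
  have -> : W t = 0 by apply/eqP; rewrite eq_le Wt Qoo_ge0.
  rewrite mul0r sqrtr0.
  apply: (@le_trans _ _ (cm_norm gamma (S t 0))).
    rewrite linear0; apply: ereal_sup_ubound; exists 0; last by rewrite inner0l.
    by rewrite /= (gaussian_moment2 gamma_gauss QooZ) inner0r lee_fin.
  apply: ereal_sup_ubound; exists 0 => //=.
  by apply/cm_normP => xi _; rewrite inner0r.
pose eta := S t v.
pose x := (Num.sqrt (W t))^-1 *: Qoo eta.
have x1 : (cm_norm gamma x <= 1%:E)%E.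
  apply/cm_normP => xi xi1; rewrite /x innerZr ler_pdivrMl ?sqrtr_gt0// mulr1.
  rewrite innerC QooC (le_trans (ler_norm _))// -sqrtr_sqr ler_sqrt//; last exact: ltW.
  apply: le_trans (Qoo_cauchy_schwarz _ Wt) _.
  by rewrite ler_piMl// ltW.
apply: (@le_trans _ _ (cm_norm gamma (S t x))); last first.
  by apply: ereal_sup_ubound; exists x.
apply: ereal_sup_ubound; exists ((Num.sqrt (W 0))^-1 *: v).
  rewrite /= (gaussian_moment2 gamma_gauss QooZ) lee_fin QooZ exprVn sqr_sqrtr; last exact: ltW.
  have <- : W 0 = inner (Qoo v) v by rewrite /W (semigroup0 S_C0).
  by rewrite mulVf// gt_eqF.
congr (_%:E); rewrite innerZl -(semigroup_selfadjoint S_C0 hb h_eigen)// /x innerZr.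
rewrite [inner (S t v) _]innerC -/(W t).
rewrite sqrtrM; last exact: ltW.
rewrite sqrtrV; last exact: ltW.
have We : W t = Num.sqrt (W t) * Num.sqrt (W t) by rewrite -expr2 sqr_sqrtr ?(ltW Wt).
by rewrite [X in _ * (_ * X)]We mulKf ?gt_eqF ?sqrtr_gt0// mulrC.
Qed.

Variable q0 : R.
Hypothesis q0_def : mehler_rate gamma S = q0%:E.
Hypothesis q0_gt0 : 0 < q0.

Lemma Q_ge_rate_Qoo : q0 * inner (Qoo v) v <= inner (Q v) v.
Proof.
have W0E : W 0 = inner (Qoo v) v by rewrite /W (semigroup0 S_C0).
rewrite -W0E.
have [W0|W0] := leP (W 0) 0.
  have -> : W 0 = 0 by apply/eqP; rewrite eq_le W0 Qoo_ge0.
  by rewrite mulr0.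
rewrite leNgt; apply/negP => QW.
(* Assuming the contrary, the midpoint [q] lies strictly between the quotient of the two forms and
   [q0]; being below the lower limit, it bounds the rate from below on a right neighbourhood [V] of
   0. *)
pose q := (inner (Q v) v / W 0 + q0) / 2.
have Qq : inner (Q v) v / W 0 < q0 by rewrite ltr_pdivrMr.
have qq0 : q < q0 by rewrite /q; lra.
have qQ : inner (Q v) v < q * W 0 by rewrite -ltr_pdivrMr// /q; lra.
have q_gt0 : 0 < q.
  have : 0 <= inner (Q v) v / W 0 by rewrite divr_ge0// ltW.
  by rewrite /q; lra.
clearbody q.
have [V [V0 qV]] : exists V, (0^'+ : set_system R) V /\ forall t, V t ->
    (q%:E < (t^-1)%:E * ((cm_opnorm gamma (S t))^-1 ^+ 2 - 1))%E.
  have : (q%:E < mehler_rate gamma S)%E by rewrite q0_def lte_fin.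
  rewrite /mehler_rate limf_einfE => /ereal_sup_gt[_ [V V0 <-] qV].
  exists V; split => // t Vt; apply: (lt_le_trans qV); apply: ereal_inf_lbound.
  by exists t.
have key t : 0 < t -> V t -> W t * (1 + q * t) <= W 0.
  move=> t0 /qV; have := Qoo_opnorm (ltW t0) W0.
  have Wt0 : 0 <= W t by exact: Qoo_ge0.
  (* Extended values matter: a zero norm has inverse [+oo] but forces [W t = 0], and an infinite
     norm has inverse 0, making the rate [- t^-1] and contradicting [q > 0]. *)
  case: (cm_opnorm _ _) => [rho| |]; last by [].
  - rewrite lee_fin => Wrho.
    have rho0 : 0 <= rho by exact: le_trans (sqrtr_ge0 _) Wrho.
    have {}Wrho : W t <= rho ^+ 2 * W 0.
      rewrite -ler_pdivrMr// -[leLHS]sqr_sqrtr ?divr_ge0 ?(ltW W0)//.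
      by rewrite lerXn2r ?nnegrE ?sqrtr_ge0.
    rewrite inver; case: eqVneq => [r0 _|r0].
      have -> : W t = 0.
        by apply/eqP; rewrite eq_le Wt0 (le_trans Wrho)// r0 expr0n mul0r.
      by rewrite mul0r ltW.
    rewrite -EFin_expe -EFinB -EFinM lte_fin ltr_pdivlMl//.
    rewrite ltrBrDl exprVn => qr.
    have rho2 : 0 < rho ^+ 2 by rewrite exprn_gt0// lt_neqAle eq_sym r0.
    have qt0 : 0 <= 1 + q * t by rewrite addr_ge0// mulr_ge0 ?(ltW q_gt0) ?(ltW t0).
    rewrite (le_trans (ler_wpM2r qt0 Wrho))// mulrAC ler_piMl ?(ltW W0)//.
    by rewrite -ler_pdivlMl// mulr1 [q * t]mulrC ltW.
  - rewrite invey expe2 mul0e sub0e -EFinN -EFinM lte_fin mulrN1 => _ qt.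
    have : 0 < - t^-1 by exact: lt_trans qt.
    by rewrite oppr_gt0 invr_lt0 ltNge (ltW t0).
have hc : (harmonic k : R) @[k --> \oo] --> 0 by exact: cvg_harmonic.
(* Rearranged, [key] says that the decrease of [W] per unit time, times [1 + q * t], is at least
   [q * W 0]; the extra factor disappears in the limit. *)
have q1 : 1 + q * harmonic k @[k --> \oo] --> (1 : R).
  have cq : q @[_ --> \oo] --> q by exact: cvg_cst.
  have := seq_cvgM cq hc; rewrite mulr0 => qh.
  by rewrite -[X in _ --> X]addr0; apply: cvgD => //; exact: cvg_cst.
have := seq_cvgM Qoo_semigroup_derive q1; rewrite mulr1 => lim.
have cW : q * W 0 @[_ --> \oo] --> q * W 0 by exact: cvg_cst.
have : q * W 0 <= inner (Q v) v.
  have [d /= d0 dV] := V0; have hd : \forall k \near \oo, `|0 - harmonic k : R| < d by exact: cvgr_dist_lt hc _ d0.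
  apply: (ler_cvg_to cW lim); near=> k.
  have k0 : 0 < harmonic k :> R by rewrite /= invr_gt0.
  have Vk : V (harmonic k).
    by apply: dV => //; near: k; exact: hd.
  have := key _ k0 Vk; move: k0; set t := harmonic k => t0 h1.
  rewrite -(ler_pM2l t0) !mulrA mulfV ?gt_eqF// mul1r.
  have -> : (W 0 - W t) * (1 + q * t) = t * q * W 0 + (W 0 - W t * (1 + q * t)) by ring.
  by rewrite lerDl subr_ge0.
by rewrite leNgt qQ.
Unshelve. all: by end_near. Qed.

End Covariance.

(** * The Gaussian logarithmic Sobolev inequality *)

Section EntropyFunction.
Context {R : realType}.
Implicit Types p c u : R.

Definition xlnx u := u * ln u.

(** The defect [G] has derivative [y ^+ 3 / (1 + y)], of the sign of [y], hence its minimum 0 at 0.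
    The cubic term makes the bound valid on both sides of 0 while keeping the exact quadratic
    coefficient. *)
Lemma ln1D_le (x : R) : -1 < x -> ln (1 + x) <= x - x ^+ 2 / 2 + x ^+ 3 / 3.
Proof.
move=> x1.
pose G y : R := y - y ^+ 2 / 2 + y ^+ 3 / 3 - ln (1 + y).
have dG (y : R) : -1 < y -> is_derive y 1 G (y ^+ 3 / (1 + y)).
  move=> y1; have y0 : 0 < 1 + y by lra.
  have dl := is_derive1_ln y0.
  have d1 : is_derive y (1 : R) (fun y : R => y + 1) 1 by apply: is_derive_eq; rewrite addr0.
  rewrite addrC in dl; have dc := @is_derive1_comp R (@ln R) (fun y : R => y + 1) y _ _ dl d1.
  have fE : (@ln R \o (fun y : R => y + 1)) = (fun y => ln (1 + y)).
    by apply/funext => s /=; rewrite addrC.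
  rewrite fE in dc.
  rewrite /G; apply: is_derive_eq; rewrite /GRing.scale/=; field.
  exact: lt0r_neq0.
have G0 : G 0 = 0 by rewrite /G addr0 ln1; field.
suff : 0 <= G x by rewrite subr_ge0.
have [x0|x0|->] := ltgtP x 0; last by rewrite G0.
- have [s /andP[xs _]|c /andP[xc c0]] :=
      @MVT_is_derive R G (fun y => y ^+ 3 / (1 + y)) _ _ x0.
    by apply: dG; exact: lt_le_trans xs.
  have : c ^+ 3 / (1 + c) * (0 - x) <= 0.
    rewrite mulr_le0_ge0 ?subr_ge0 ?(ltW x0)// mulr_le0_ge0 ?invr_ge0//; last lra.
    by rewrite exprS mulr_le0_ge0 ?(ltW c0)// sqr_ge0.
  by move=> + e; rewrite -e G0; lra.
- have [s /andP[xs _]|c /andP[xc c0]] :=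
      @MVT_is_derive R G (fun y => y ^+ 3 / (1 + y)) _ _ x0.
    by apply: dG; rewrite (lt_le_trans _ xs).
  have : 0 <= c ^+ 3 / (1 + c) * (x - 0).
    by rewrite !mulr_ge0 ?subr_ge0 ?(ltW x0)// ?exprn_ge0 ?invr_ge0 ?(ltW xc)//; lra.
  by move=> + e; rewrite -e G0; lra.
Qed.

(** The second-order Taylor term of [xlnx] at [c] times a factor tending to 1 as [p] tends to [c];
    the sharp constant of the logarithmic Sobolev inequality comes from it. *)
Definition relative_bound p c :=
  (p - c) ^+ 2 / (2 * c) * (1 - (p - c) / c / 3 + 2 * ((p - c) / c) ^+ 2 / 3).

Lemma xlnx_relative_le p c : 0 < p -> 0 < c ->
  xlnx p - p * ln c - p + c <= relative_bound p c.
Proof.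
move=> p0 c0; pose z := (p - c) / c.
have z1 : -1 < z by rewrite /z ltr_pdivlMr//; lra.
have pE : p = c * (1 + z) by rewrite /z; field; exact: lt0r_neq0.
have lnp : ln p = ln c + ln (1 + z) by rewrite {1}pE lnM// posrE//; lra.
have -> : xlnx p - p * ln c - p + c = c * ((1 + z) * ln (1 + z) - z).
  by rewrite /xlnx lnp [in LHS]pE; ring.
have -> : relative_bound p c = c * ((1 + z) * (z - z ^+ 2 / 2 + z ^+ 3 / 3) - z).
  by rewrite /relative_bound -/z pE /z; field; exact: lt0r_neq0.
by rewrite ler_pM2l// lerD2r ler_pM2l ?ln1D_le//; lra.
Qed.

Lemma ln_le_subr1 u : 0 < u -> ln u <= u - 1.
Proof. by move=> u0; have := @le_ln1Dx R (u - 1); rewrite [1 + _]addrC subrK; apply; lra. Qed.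

(** Convexity: the left-hand side is the tangent to [xlnx] at [c]. *)
Lemma xlnx_ge p c : 0 < p -> 0 < c -> p * ln c + p - c <= xlnx p.
Proof.
move=> p0 c0; have := @ln_le_subr1 (c / p).
rewrite divr_gt0// ln_div ?posrE// => /(_ isT).
rewrite -(ler_pM2l p0) mulrBr [leRHS]mulrBr mulr1 mulrC [p * (c / p)]mulrC divfK ?gt_eqF//.
by rewrite /xlnx; lra.
Qed.

Lemma ln_range_bound (a M u : R) : 0 < a -> a <= u <= M -> `|ln u| <= `|ln a| + `|ln M|.
Proof.
move=> a0 /andP[au uM]; have u0 := lt_le_trans a0 au; have M0 := lt_le_trans u0 uM.
have l1 : ln a <= ln u by rewrite ler_ln.
have l2 : ln u <= ln M by rewrite ler_ln.
have := ler_norm (ln M); have := ler_norm (- ln a); rewrite normrN.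
by rewrite ler_norml; have := normr_ge0 (ln M); have := normr_ge0 (ln a); lra.
Qed.

End EntropyFunction.

Section Tensor.
Context {R : realType} d (T : measurableType d) (P : probability T R).
Variables (a M : R).
Hypothesis a0 : 0 < a.

Lemma range_bm d' (T' : measurableType d') (F : T' -> R) :
  measurable_fun setT F -> (forall x, a <= F x <= M) -> bounded_measurable F.
Proof.
move=> mF FM; split => //; exists M => x; have /andP[aF FM'] := FM x.
by rewrite ger0_norm// (le_trans (ltW a0)).
Qed.

Lemma range_bm_ln d' (T' : measurableType d') (F : T' -> R) :
  measurable_fun setT F -> (forall x, a <= F x <= M) ->
  bounded_measurable (fun x => ln (F x)).
Proof.
move=> mF FM; split; first by apply: measurableT_comp.
by exists (`|ln a| + `|ln M|) => x; exact: ln_range_bound.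
Qed.

Lemma range_integral d' (T' : measurableType d') (P' : probability T' R) (F : T' -> R) :
  measurable_fun setT F -> (forall x, a <= F x <= M) -> a <= (\int[P']_x F x)%R <= M.
Proof.
move=> mF FM; have bF := range_bm mF FM.
rewrite -{1}(prob_integral_cst P' a) -[X in _ && (_ <= X)](prob_integral_cst P' M).
by apply/andP; split; apply: bm_le_integral => //; try exact: bm_cst;
  move=> x; have /andP[] := FM x.
Qed.

(* Gibbs' inequality for the density [A x * B y / m] relative to [F]. *)
Lemma xlnx_tensor (F : T * T -> R) :
  measurable_fun setT F -> (forall z, a <= F z <= M) ->
  (\int[P]_x xlnx (\int[P]_y F (x, y)) + \int[P]_y xlnx (\int[P]_x F (x, y)) <=
   \int[P]_x \int[P]_y xlnx (F (x, y)) + xlnx (\int[P]_x \int[P]_y F (x, y)))%R.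
Proof.
have aux (f la lb lm lf ab : R) : f * (- lm + (la + lb)) + f - ab <= f * lf ->
  f * la + f * lb - lm * f - f * lf <= ab - f by lra.
move=> mF FM; have bF := range_bm mF FM.
pose A x := (\int[P]_y F (x, y))%R; pose B y := (\int[P]_x F (x, y))%R.
pose m := (\int[P]_x A x)%R; pose PP : probability (T * T)%type R := (P \x P)%E.
have bA : bounded_measurable A by exact: bm_fubini_F.
have bB : bounded_measurable B by exact: bm_fubini_G.
have rA x : a <= A x <= M.
  by apply: range_integral => // ; case: (bm_section1 bF x).
have rB y : a <= B y <= M.
  by apply: range_integral => // ; case: (bm_section2 bF y).
have /andP[am mM] : a <= m <= M by apply: range_integral => //; case: bA.
have m0 : 0 < m by exact: lt_le_trans am.
have BE : (\int[P]_y B y)%R = m by rewrite /B -(bm_fubini P P bF).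
have blA := range_bm_ln bA.1 rA; have blB := range_bm_ln bB.1 rB.
have b1 : bounded_measurable (fun z : T * T => F z * ln (A z.1)).
  by apply: bmM => //; exact: (bm_comp (@measurable_fst _ _ T T) blA).
have b2 : bounded_measurable (fun z : T * T => F z * ln (B z.2)).
  by apply: bmM => //; exact: (bm_comp (@measurable_snd _ _ T T) blB).
have b3 : bounded_measurable (fun z : T * T => ln m * F z) by exact: bmZ.
have b4 : bounded_measurable (fun z : T * T => xlnx (F z)).
  by apply: bmM => //; exact: range_bm_ln.
have b5 : bounded_measurable (fun z : T * T => m^-1 * (A z.1 * B z.2)).
  apply: bmZ; apply: bmM; first exact: (bm_comp (@measurable_fst _ _ T T) bA).
  exact: (bm_comp (@measurable_snd _ _ T T) bB).
have e1 : (\int[PP]_z (F z * ln (A z.1)) = \int[P]_x xlnx (A x))%R.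
  rewrite (bm_fubini1 P P b1); apply: eq_Rintegral => x _ /=.
  under eq_Rintegral do rewrite mulrC.
  by rewrite bm_integralZ; [rewrite mulrC|exact: bm_section1].
have e2 : (\int[PP]_z (F z * ln (B z.2)) = \int[P]_y xlnx (B y))%R.
  rewrite (bm_fubini1 P P b2) (bm_fubini P P b2); apply: eq_Rintegral => y _ /=.
  under eq_Rintegral do rewrite mulrC.
  by rewrite bm_integralZ; [rewrite mulrC|exact: bm_section2].
have e6 : (\int[PP]_z F z = m)%R by rewrite (bm_fubini1 P P bF).
have e3 : (\int[PP]_z (ln m * F z) = xlnx m)%R by rewrite bm_integralZ// e6 mulrC.
have e4 : (\int[PP]_z xlnx (F z) = \int[P]_x \int[P]_y xlnx (F (x, y)))%R.
  exact: (bm_fubini1 P P b4).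
have e5 : (\int[PP]_z (m^-1 * (A z.1 * B z.2)) = m)%R.
  rewrite (bm_fubini1 P P b5) /=.
  have -> : (\int[P]_x \int[P]_y (m^-1 * (A x * B y)))%R = (\int[P]_x A x)%R.
    apply: eq_Rintegral => x _; under eq_Rintegral do rewrite mulrA.
    by rewrite bm_integralZ// BE mulrAC mulVf ?mul1r// gt_eqF.
  by [].
(* The tangent inequality is integrated with reference value [m^-1 * (A z.1 * B z.2)]; this product
   and [F] have the same mass [m], so the linear terms cancel. *)
have := @bm_le_integral _ _ _ PP
  (fun z => F z * ln (A z.1) + F z * ln (B z.2) - ln m * F z - xlnx (F z))
  (fun z => m^-1 * (A z.1 * B z.2) - F z).
rewrite bm_integralB ?bm_integralB ?bm_integralD//; try do ?[exact: bmB|exact: bmD|apply: bmB].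
  rewrite e1 e2 e3 e4 e5 e6 subrr => h.
  rewrite -subr_le0 opprD addrA addrAC; apply: h => [||z].
  - by apply: bmB => //; apply: bmB => //; exact: bmD.
  - exact: bmB.
  have F0 : 0 < F z by have /andP[+ _] := FM z; exact: lt_le_trans.
  have A0 : 0 < A z.1 by have /andP[+ _] := rA z.1; exact: lt_le_trans.
  have B0 : 0 < B z.2 by have /andP[+ _] := rB z.2; exact: lt_le_trans.
  have := @xlnx_ge R (F z) (m^-1 * (A z.1 * B z.2)) F0.
  rewrite !mulr_gt0 ?invr_gt0// !lnM ?posrE ?mulr_gt0 ?invr_gt0// lnV ?posrE// => /(_ isT).
  exact: aux.
exact: b3.
Qed.

End Tensor.

Lemma seq_cvgD {R : realType} (u v : nat -> R) (a b : R) :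
  u n @[n --> \oo] --> a -> v n @[n --> \oo] --> b ->
  u n + v n @[n --> \oo] --> a + b.
Proof. exact: cvgD. Qed.

Section LogSobolev.
Context {R : realType} {E : hilbertType R}.
Hypothesis sepE : separable_space E.
Variable gamma : probability (borel E) R.
Hypothesis stable : forall (a b c : R) (G : E -> R) M,
  a ^+ 2 + b ^+ 2 = c ^+ 2 -> continuous G -> (forall x, `|G x| <= M) ->
  (\int[gamma]_x \int[gamma]_y G (a *: (x : E) + b *: (y : E)) =
   \int[gamma]_x G (c *: (x : E)))%R.
Variables (eps M L : R).
Hypothesis eps0 : 0 < eps.

(** The positive lower bound controls the logarithm. All three constants survive translation and
    averaging, so the same bounds serve at every scale. *)
Definition bounded_lipschitz (g : E -> R) :=
  (forall x, eps <= g x <= M) /\ (forall x y, `|g x - g y| <= L * `|x - y|).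

Lemma bounded_lipschitz_continuous g : bounded_lipschitz g -> continuous g.
Proof.
move=> [_ gL] x; apply/cvgrPdist_le => e e0.
near=> y; rewrite (le_trans (gL _ _))//.
rewrite (le_trans (ler_wpM2r _ (_ : L <= `|L| + 1)))//.
  by rewrite (le_trans (ler_norm _))// lerDl.
rewrite -ler_pdivlMl ?ltr_wpDl//; near: y.
apply: cvgr_dist_le; first exact: cvg_id.
by rewrite mulr_gt0// invr_gt0 ltr_wpDl.
Unshelve. all: by end_near. Qed.

Lemma bounded_lipschitz_norm g x : bounded_lipschitz g -> `|g x| <= M.
Proof.
by move=> [/(_ x)/andP[eg gM] _]; rewrite ger0_norm// (le_trans (ltW eps0)).
Qed.

Lemma bounded_lipschitz_bm g : bounded_lipschitz g -> bounded_measurable (g : borel E -> R).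
Proof.
move=> gP; apply: (continuous_bm (bounded_lipschitz_continuous gP)) => x.
exact: bounded_lipschitz_norm.
Qed.

Lemma bounded_lipschitz_shift v g : bounded_lipschitz g ->
  bounded_lipschitz (fun u => g (v + u)).
Proof.
move=> [gM gL]; split=> [x|x y]; first exact: gM.
by rewrite (le_trans (gL _ _))// opprD addrACA subrr add0r.
Qed.

Let xlnx_bound := M * (`|ln eps| + `|ln M|).

Lemma xlnx_comp_bounded g x : bounded_lipschitz g -> `|xlnx (g x)| <= xlnx_bound.
Proof.
move=> gP; rewrite /xlnx normrM ler_pM ?bounded_lipschitz_norm//.
by apply: ln_range_bound => //; case: gP.
Qed.

Lemma xlnx_comp_continuous g : bounded_lipschitz g -> continuous (fun x => xlnx (g x)).
Proof.
move=> gP x; have cg : {for x, continuous g} := @bounded_lipschitz_continuous g gP x.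
apply: cvgM; first exact: cg.
apply: (@continuous_comp E R R g (@ln R) x) => //; apply: continuous_ln.
by case: gP => /(_ x)/andP[+ _] _; exact: lt_le_trans.
Qed.

Definition conv_avg (b : R) (g : E -> R) (u : E) : R :=
  (\int[gamma]_x g (u + b *: (x : E)))%R.

Lemma bm_affine_section (G : E -> R) K (b : R) (u : E) : continuous G ->
  (forall x, `|G x| <= K) ->
  bounded_measurable ((fun x : E => G (u + b *: x)) : borel E -> R).
Proof.
move=> cG GK; apply: (@continuous_bm _ _ _ K) => [x|x]; last exact: GK.
apply: (@continuous_comp E E R (fun x => u + b *: x) G x); last exact: cG.
by apply: cvgD; [exact: cvg_cst|exact: scale_continuous_fixed].
Qed.

Lemma bounded_lipschitz_section g b u : bounded_lipschitz g ->
  bounded_measurable ((fun x : E => g (u + b *: x)) : borel E -> R).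
Proof.
move=> gP; apply: (@bm_affine_section _ M) => [|x].
  exact: bounded_lipschitz_continuous.
exact: bounded_lipschitz_norm.
Qed.

Lemma bounded_lipschitz_avg b g : bounded_lipschitz g ->
  bounded_lipschitz (conv_avg b g).
Proof.
move=> gP; have bs u := bounded_lipschitz_section b u gP.
split=> [u|u v].
  apply: (range_integral eps0) => [|x]; first by case: (bs u).
  by case: gP => + _; exact.
rewrite /conv_avg -bm_integralB//.
apply: bm_integral_bounded => [|x]; first exact: bmB.
case: gP => _ gL; rewrite (le_trans (gL _ _))//.
by rewrite opprD addrACA subrr addr0.
Qed.

Lemma bm_affine (G : E -> R) K (a b : R) : continuous G ->
  (forall x, `|G x| <= K) ->
  bounded_measurable (fun z : borel E * borel E => G (a *: (z.1 : E) + b *: (z.2 : E))).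
Proof.
move=> cG GK.
exact: (bm_comp (affine_borel_measurable sepE a b) (continuous_bm cG GK)).
Qed.

(* For [a ^+ 2 + b ^+ 2 = 1], [conv_avg b g (a *: w)] is Mehler's formula for
   the Ornstein-Uhlenbeck semigroup of [gamma]. *)
Definition avg_xlnx (a b : R) (g : E -> R) : R :=
  (\int[gamma]_w xlnx (conv_avg b g (a *: (w : E))))%R.

(* [xlnx_tensor] is applied to [(x, y) |-> g (a *: w + b2 *: x + b2 *: y)]. *)
Lemma entropy_halving (a b b2 c : R) g : bounded_lipschitz g ->
  a ^+ 2 + b ^+ 2 = 1 -> b2 ^+ 2 + b2 ^+ 2 = b ^+ 2 -> a ^+ 2 + b2 ^+ 2 = c ^+ 2 ->
  2 * avg_xlnx c b2 g <= (\int[gamma]_x xlnx (g x))%R + avg_xlnx a b g.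
Proof.
move=> gP ab bb ac.
have cg := bounded_lipschitz_continuous gP.
have gM x := bounded_lipschitz_norm x gP.
have avP := bounded_lipschitz_avg b2 gP.
pose G1 u := xlnx (conv_avg b2 g u).
have cG1 : continuous G1 by exact: xlnx_comp_continuous avP.
have G1M x : `|G1 x| <= xlnx_bound by exact: xlnx_comp_bounded avP.
pose G2 u := xlnx (g u).
have cG2 : continuous G2 by exact: xlnx_comp_continuous gP.
have G2M x : `|G2 x| <= xlnx_bound by exact: xlnx_comp_bounded gP.
have avbP := bounded_lipschitz_avg b gP.
pose G3 u := xlnx (conv_avg b g u).
have cG3 : continuous G3 by exact: xlnx_comp_continuous avbP.
have G3M x : `|G3 x| <= xlnx_bound by exact: xlnx_comp_bounded avbP.
have e1 : avg_xlnx c b2 g = (\int[gamma]_w \int[gamma]_x G1 (a *: (w : E) + b2 *: (x : E)))%R.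
  by rewrite (stable ac cG1 G1M).
have e2 : (\int[gamma]_x xlnx (g x) =
    \int[gamma]_w \int[gamma]_x G2 (a *: (w : E) + b *: (x : E)))%R.
  rewrite (@stable a b 1 _ _ _ cG2 G2M) ?expr1n//.
  by apply: eq_Rintegral => x _; rewrite scale1r.
have B1 := bm_fubini_F gamma gamma (bm_affine a b2 cG1 G1M).
have B2 := bm_fubini_F gamma gamma (bm_affine a b cG2 G2M).
have B3 : bounded_measurable ((fun w : E => G3 (a *: w)) : borel E -> R).
  apply: (@continuous_bm _ _ _ xlnx_bound) => [w|w]; last exact: G3M.
  by apply: (@continuous_comp E E R (fun w => a *: w) G3 w); [exact: scale_continuous_fixed|exact: cG3].
rewrite e1 e2 /avg_xlnx -bm_integralZ// -bm_integralD//.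
apply: bm_le_integral => [||w]; [exact: bmZ|exact: bmD|].
have gwP := bounded_lipschitz_shift (a *: (w : E)) gP.
(* For fixed [w] the noise of size [b] is split into two independent equal parts. The relation for
   [b2] reassembles both parts, and that for [c] merges one of them with [w] after integration; by
   symmetry both marginals of [F] give [G1]. *)
pose F (z : borel E * borel E) : R := g (a *: (w : E) + (b2 *: (z.1 : E) + b2 *: (z.2 : E))).
have cgw := bounded_lipschitz_continuous gwP.
have gwM x := bounded_lipschitz_norm x gwP.
have bF : bounded_measurable F := bm_affine b2 b2 cgw gwM.
have FM z : eps <= F z <= M by case: gP => + _; exact.
have := xlnx_tensor gamma eps0 bF.1 FM.
have -> : (\int[gamma]_x \int[gamma]_y F (x, y) = conv_avg b g (a *: (w : E)))%R.
  by rewrite /F/= (stable bb cgw gwM).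
have -> : (\int[gamma]_x \int[gamma]_y xlnx (F (x, y)) =
    \int[gamma]_x G2 (a *: (w : E) + b *: (x : E)))%R.
  rewrite /F/=.
  have cG2w := xlnx_comp_continuous gwP.
  have G2wM x := xlnx_comp_bounded x gwP.
  by rewrite (stable bb cG2w G2wM).
have -> : (\int[gamma]_x xlnx (\int[gamma]_y F (x, y)) =
    \int[gamma]_x G1 (a *: (w : E) + b2 *: (x : E)))%R.
  apply: eq_Rintegral => x _; rewrite /G1 /conv_avg /F/=; congr xlnx.
  by apply: eq_Rintegral => y _; rewrite addrA.
have -> : (\int[gamma]_y xlnx (\int[gamma]_x F (x, y)) =
    \int[gamma]_x G1 (a *: (w : E) + b2 *: (x : E)))%R.
  apply: eq_Rintegral => x _; rewrite /G1 /conv_avg /F/=; congr xlnx.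
  by apply: eq_Rintegral => y _; rewrite -addrA [b2 *: _ + _]addrC.
by rewrite mulr_natl mulr2n.
Qed.

(** Square roots because variances are what halve: [b_ k.+1 ^+ 2] is half of [b_ k ^+ 2], as
    [entropy_halving] asks. *)
Let b_ k : R := Num.sqrt (2^-1 ^+ k).
Let a_ k : R := Num.sqrt (1 - 2^-1 ^+ k).

Let half_pow_le1 k : 2^-1 ^+ k <= 1 :> R.
Proof. by rewrite exprn_ile1// ?invr_ge0// invf_le1// ler1n. Qed.

Let b_sqr k : b_ k ^+ 2 = 2^-1 ^+ k.
Proof. by rewrite sqr_sqrtr// exprn_ge0// invr_ge0. Qed.

Let a_sqr k : a_ k ^+ 2 = 1 - 2^-1 ^+ k.
Proof. by rewrite sqr_sqrtr// subr_ge0. Qed.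

Let b_gt0 k : 0 < b_ k.
Proof. by rewrite sqrtr_gt0 exprn_gt0// invr_gt0. Qed.

Lemma le_iter_double (u : nat -> R) k : (forall k, u k <= 2 * u k.+1) ->
  u 0 <= 2 ^+ k * u k.
Proof.
move=> u2; elim: k => [|k IH]; first by rewrite expr0 mul1r.
by rewrite (le_trans IH)// exprSr -mulrA ler_wpM2l ?exprn_ge0.
Qed.

(** At index 0 one has [a_ 0 = 0] and [b_ 0 = 1]: the average is the constant mean and the loss is
    the full entropy. Each halving costs a factor 2. *)
Lemma entropy_dyadic g k : bounded_lipschitz g ->
  (\int[gamma]_x xlnx (g x))%R - xlnx (\int[gamma]_x g x)%R <=
  2 ^+ k * ((\int[gamma]_x xlnx (g x))%R - avg_xlnx (a_ k) (b_ k) g).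
Proof.
have aux (i u v : R) : 2 * u <= i + v -> i - v <= 2 * (i - u) by lra.
move=> gP; set I := (\int[gamma]_x xlnx (g x))%R.
have := @le_iter_double (fun j => I - avg_xlnx (a_ j) (b_ j) g) k.
have -> : avg_xlnx (a_ 0) (b_ 0) g = xlnx (\int[gamma]_x g x)%R.
  rewrite /avg_xlnx /a_ /b_ expr0 subrr sqrtr0 sqrtr1.
  have -> : (fun w : borel E => xlnx (conv_avg 1 g (0 *: (w : E)))) =
      fun=> xlnx (\int[gamma]_x g x)%R.
    apply/funext => w; rewrite /conv_avg; congr xlnx; apply: eq_Rintegral => x _.
    by rewrite scale0r add0r scale1r.
  by rewrite prob_integral_cst.
apply=> j.
have := @entropy_halving (a_ j) (b_ j) (b_ j.+1) (a_ j.+1) g gP.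
rewrite -/I !b_sqr !a_sqr exprS subrK => /(_ erefl).
have -> : 2^-1 * 2^-1 ^+ j + 2^-1 * 2^-1 ^+ j = 2^-1 ^+ j :> R by field.
have -> : 1 - 2^-1 ^+ j + 2^-1 * 2^-1 ^+ j = 1 - 2^-1 * 2^-1 ^+ j :> R by field.
by move=> /(_ erefl erefl); exact: aux.
Qed.

Lemma relative_bound_bm (a b : R) g : bounded_lipschitz g ->
  bounded_measurable (fun z : borel E * borel E =>
    relative_bound (g (a *: (z.1 : E) + b *: (z.2 : E))) (g z.1)).
Proof.
move=> gP; have cg := bounded_lipschitz_continuous gP.
have gM x := bounded_lipschitz_norm x gP.
have bp := bm_affine a b cg gM.
have bc := bm_comp (@measurable_fst _ _ (borel E) (borel E)) (bounded_lipschitz_bm gP).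
have g0 x : 0 < g x by case: gP => /(_ x)/andP[+ _] _; exact: lt_le_trans.
have bV : bounded_measurable ((fun x => (g x)^-1) : borel E -> R).
  apply: (@continuous_bm _ _ _ eps^-1) => [x|x].
    by apply: cvgV; [exact: lt0r_neq0|exact: cg].
  rewrite ger0_norm ?invr_ge0 ?(ltW (g0 x))// lef_pV2 ?posrE//.
  by case: gP => /(_ x)/andP[].
have bi := bm_comp (@measurable_fst _ _ (borel E) (borel E)) bV.
have bd := bmB bp bc; have bz := bmM bd bi.
have := bmM (bmM (bmM bd bd) (bmZ 2^-1 bi))
  (bmD (bmB (@bm_cst R _ (borel E * borel E)%type 1) (bmZ 3^-1 bz)) (bmZ (2 / 3) (bmM bz bz))).
congr bounded_measurable; apply/funext => z /=.
by rewrite /relative_bound invfM; field; exact: lt0r_neq0.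
Qed.

(** Rotation invariance rewrites the first integral with the same arguments as the average. The
    tangent to [xlnx] is taken at [g w] rather than at the local mean, so that the bound involves
    only increments of [g] from [w]. *)
Lemma entropy_step_le (a b : R) g : bounded_lipschitz g -> a ^+ 2 + b ^+ 2 = 1 ->
  (\int[gamma]_x xlnx (g x))%R - avg_xlnx a b g <=
  (\int[gamma]_w \int[gamma]_x
    relative_bound (g (a *: (w : E) + b *: (x : E))) (g w))%R.
Proof.
have aux (p q r s : R) : p + r - s <= q -> - q <= - p + (- r + s) by lra.
move=> gP ab; have cg := bounded_lipschitz_continuous gP.
have gM x := bounded_lipschitz_norm x gP.
have cG2 := xlnx_comp_continuous gP; have G2M x := xlnx_comp_bounded x gP.
have avP := bounded_lipschitz_avg b gP.
have bR := relative_bound_bm a b gP.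
have g0 x : 0 < g x by case: gP => /(_ x)/andP[+ _] _; exact: lt_le_trans.
have -> : (\int[gamma]_x xlnx (g x) =
    \int[gamma]_w \int[gamma]_x xlnx (g (a *: (w : E) + b *: (x : E))))%R.
  rewrite (@stable a b 1 (fun x => xlnx (g x)) _ _ cG2 G2M) ?expr1n//.
  by apply: eq_Rintegral => x _; rewrite scale1r.
have B2 := bm_fubini_F gamma gamma (bm_affine a b cG2 G2M).
have B3 : bounded_measurable ((fun w : E => xlnx (conv_avg b g (a *: w))) : borel E -> R).
  apply: (@continuous_bm _ _ _ xlnx_bound) => [w|w]; last exact: xlnx_comp_bounded avP.
  apply: (@continuous_comp E E R (fun w => a *: w) (fun u => xlnx (conv_avg b g u)) w).
    exact: scale_continuous_fixed.
  exact: (@xlnx_comp_continuous _ avP).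
rewrite /avg_xlnx -bm_integralB//.
apply: bm_le_integral => [||w]; [exact: bmB|exact: (bm_fubini_F gamma gamma bR)|].
have bx := bounded_lipschitz_section b (a *: (w : E)) gP.
have blx := bm_affine_section b (a *: (w : E)) cG2 G2M.
have bRw := bm_section1 bR w.
rewrite /= in bRw.
have m0 : 0 < conv_avg b g (a *: (w : E)).
  by case: avP => /(_ (a *: (w : E)))/andP[+ _] _; exact: lt_le_trans.
apply: (@le_trans _ _ (\int[gamma]_x (xlnx (g (a *: (w : E) + b *: (x : E)))
    - ln (g w) * g (a *: (w : E) + b *: (x : E)) - g (a *: (w : E) + b *: (x : E)) + g w))%R).
  rewrite bm_integralD; [|by apply: bmB => //; apply: bmB => //; exact: bmZ|exact: bm_cst].
  rewrite bm_integralB//; last by apply: bmB => //; exact: bmZ.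
  rewrite bm_integralB//; last exact: bmZ.
  rewrite bm_integralZ// prob_integral_cst.
  rewrite -!addrA lerD2l.
  have := xlnx_ge m0 (g0 w); rewrite /conv_avg mulrC.
  exact: aux.
apply: bm_le_integral => //.
  by apply: bmD; [apply: bmB => //; apply: bmB => //; exact: bmZ|exact: bm_cst].
by move=> x; rewrite [ln _ * _]mulrC; exact: xlnx_relative_le.
Qed.

Variables (n : nat) (h : nat -> E) (K2 : R) (g : E -> R) (D : E -> E -> R).
Hypothesis gP : bounded_lipschitz g.
Hypothesis K20 : 0 <= K2.
Hypothesis gK2 : forall x y,
  (g x - g y) ^+ 2 <= K2 * \sum_(i < n) inner (x - y) (h i) ^+ 2.
Hypothesis dg : forall w x, is_derive w x g (D w x).
Hypothesis moment2 : forall xi, (\int[gamma]_x (inner xi x ^+ 2)%:E < +oo)%E.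

Let g_gt0 x : 0 < g x.
Proof. by case: gP => /(_ x)/andP[+ _] _; exact: lt_le_trans. Qed.

Let slope k w x := (g (a_ k *: w + b_ k *: x) - g w) / b_ k.

Let b_cvg : b_ k @[k --> \oo] --> 0.
Proof.
have h2 : 2^-1 ^+ k @[k --> \oo] --> (0 : R).
  by apply: cvg_expr; rewrite ger0_norm ?invr_ge0// invf_lt1// ltr1n.
by have := cvg_comp _ _ h2 (@sqrt_continuous R 0); rewrite sqrtr0.
Qed.

Let a_ge0 k : 0 <= a_ k. Proof. exact: sqrtr_ge0. Qed.

Let a_le1 k : a_ k <= 1.
Proof.
by rewrite -(@ler_pXn2r _ 2)// ?nnegrE// a_sqr expr1n gerBl exprn_ge0 ?invr_ge0.
Qed.

Let ab_le k : 1 - a_ k <= b_ k ^+ 2.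
Proof.
have -> : b_ k ^+ 2 = 1 - a_ k ^+ 2 by rewrite b_sqr a_sqr; ring.
by rewrite lerD2l lerN2 expr2 ler_piMl ?a_ge0 ?a_le1.
Qed.

(** Replacing [a_ k *: w] by [w] moves the argument by at most [b_ k ^+ 2] times the norm of [w],
    negligible against [b_ k] by the Lipschitz bound; a genuine directional difference quotient
    remains. *)
Lemma slope_cvg w x : slope k w x @[k --> \oo] --> D w x.
Proof.
have bn0 k : b_ k != 0 by exact: lt0r_neq0.
have h1 := is_derive_seq (dg w x) bn0 b_cvg.
have h2 : (g (a_ k *: w + b_ k *: x) - g (w + b_ k *: x)) / b_ k @[k --> \oo] --> 0.
  apply/norm_cvg0P.
  have cb : b_ k * (`|L| * `|w|) @[k --> \oo] --> 0.
    have cst_cvg : `|L| * `|w| @[_ --> \oo] --> `|L| * `|w| by exact: cvg_cst.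
    by have := seq_cvgM b_cvg cst_cvg; rewrite mul0r.
  apply: (squeeze_cvgr _ (cvg_cst 0) cb); apply: nearW => k.
  rewrite normr_ge0 normrM normfV (gtr0_norm (b_gt0 k)) ler_pdivrMr//=.
  case: gP => _ gL; rewrite (le_trans (gL _ _))// opprD addrACA subrr addr0.
  rewrite -{2}[w]scale1r -scalerBl normrZ distrC ger0_norm ?subr_ge0//.
  rewrite (_ : b_ k * _ * _ = `|L| * (b_ k ^+ 2 * `|w|)); last by ring.
  rewrite (le_trans (ler_wpM2r _ (ler_norm L))) ?mulr_ge0 ?subr_ge0//.
  by rewrite ler_wpM2l// ler_wpM2r.
have := seq_cvgD h2 h1; rewrite add0r; apply: cvg_trans.
apply: near_eq_cvg; apply: nearW => k /=.
rewrite /slope; field; exact: bn0.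
Qed.

Lemma slope_sqr_le k w x : slope k w x ^+ 2 <=
  K2 * \sum_(i < n) (2 * inner w (h i) ^+ 2 + 2 * inner x (h i) ^+ 2).
Proof.
have bk := b_gt0 k.
rewrite /slope expr_div_n ler_pdivrMr ?exprn_gt0//.
apply: (le_trans (gK2 _ _)); rewrite -mulrA ler_wpM2l// mulr_suml.
apply: ler_sum => i _.
rewrite innerBl innerDl !innerZl.
set p := inner w _; set q := inner x _.
have a1 := a_le1 k; have a0 := a_ge0 k; have ab := ab_le k.
have b1 : b_ k ^+ 2 = (1 - a_ k) * (1 + a_ k) by rewrite b_sqr; have := a_sqr k; lra.
have h1 : (1 - a_ k) ^+ 2 <= b_ k ^+ 2.
  by rewrite b1 expr2 ler_wpM2l ?subr_ge0//; lra.
have h2 : (1 - a_ k) ^+ 2 * p ^+ 2 <= b_ k ^+ 2 * p ^+ 2 by rewrite ler_wpM2r// sqr_ge0.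
(* The parallelogram identity: this square plus the one to be bounded is twice the sum of the
   squares of its two terms. *)
have h3 : 0 <= ((1 - a_ k) * p + b_ k * q) ^+ 2 by exact: sqr_ge0.
rewrite -subr_ge0 in h2; rewrite -subr_ge0.
apply: le_trans (addr_ge0 h3 (mulr_ge0 (ler0n R 2) h2)) _.
by rewrite le_eqVlt; apply/orP; left; apply/eqP; ring.
Qed.

(** An integrable majorant of all the [T k]: increments of [g] see finitely many coordinates, each
    with finite second moment. The prefactor uses the lower bound [eps] of [g] and the bound
    [M / eps] for relative increments. *)
Let dom (z : borel E * borel E) : R :=
  (1 + M / eps + 2 * (M / eps) ^+ 2) / (2 * eps) * K2 *
  \sum_(i < n) (2 * inner (z.1 : E) (h i) ^+ 2 + 2 * inner (z.2 : E) (h i) ^+ 2).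

Lemma dom_integrable : (gamma \x gamma)%E.-integrable setT (EFin \o dom).
Proof.
have mI (xi : E) : measurable_fun setT (fun x : borel E => (inner (x : E) xi ^+ 2)%:E).
  apply/measurable_EFinP; apply: measurable_funX.
  exact: continuous_borel_measurable (@continuous_innerl _ _ xi).
have I0 xi (x : borel E) : (0 <= (inner (x : E) xi ^+ 2)%:E)%E by rewrite lee_fin sqr_ge0.
have m2 (xi : E) : (\int[gamma]_x (inner (x : E) xi ^+ 2)%:E < +oo)%E.
  by under eq_integral do rewrite innerC; exact: moment2.
have i1 (xi : E) : (gamma \x gamma)%E.-integrable setT
    (fun z : borel E * borel E => (inner (z.1 : E) xi ^+ 2)%:E).
  apply/integrable12ltyP.
    exact: (measurableT_comp (mI xi) (@measurable_fst _ _ (borel E) (borel E))).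
  rewrite (eq_integral (fun x : borel E => (inner (x : E) xi ^+ 2)%:E)) ?m2// => x _ /=.
  rewrite integral_cst// [X in (_ * X)%E](@probability_setT _ _ _ gamma) mule1.
  by rewrite ger0_norm ?sqr_ge0.
have i2 (xi : E) : (gamma \x gamma)%E.-integrable setT
    (fun z : borel E * borel E => (inner (z.2 : E) xi ^+ 2)%:E).
  apply/integrable21ltyP.
    exact: (measurableT_comp (mI xi) (@measurable_snd _ _ (borel E) (borel E))).
  rewrite (eq_integral (fun x : borel E => (inner (x : E) xi ^+ 2)%:E)) ?m2// => x _ /=.
  rewrite integral_cst// [X in (_ * X)%E](@probability_setT _ _ _ gamma) mule1.
  by rewrite ger0_norm ?sqr_ge0.
have is_ : (gamma \x gamma)%E.-integrable setT (fun z : borel E * borel E =>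
    \sum_(i < n) (2%:E * (inner (z.1 : E) (h i) ^+ 2)%:E +
                  2%:E * (inner (z.2 : E) (h i) ^+ 2)%:E)%E)%E.
  apply: integrable_sum => // i _; apply: integrableD => //.
    exact: (integrableZl _ 2 (i1 (h i))).
  exact: (integrableZl _ 2 (i2 (h i))).
have := integrableZl measurableT ((1 + M / eps + 2 * (M / eps) ^+ 2) / (2 * eps) * K2) is_.
congr (_.-integrable setT); apply/funext => z /=.
rewrite /dom [in RHS]EFinM; congr (_ * _)%E.
by rewrite -sumEFin; apply: eq_bigr => i _; rewrite EFinD !EFinM.
Qed.

Let T k (z : borel E * borel E) : R :=
  2 ^+ k * relative_bound (g (a_ k *: (z.1 : E) + b_ k *: (z.2 : E))) (g z.1).

(** [2 ^+ k] is the inverse of [b_ k ^+ 2], which turns the squared increment in [relative_bound]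
    into a squared slope. *)
Let TE k z : let r := slope k z.1 z.2 * b_ k / g z.1 in
  T k z = slope k z.1 z.2 ^+ 2 / (2 * g z.1) * (1 - r / 3 + 2 * r ^+ 2 / 3).
Proof.
have bk := lt0r_neq0 (b_gt0 k); have g0 := lt0r_neq0 (g_gt0 z.1).
have p2 : 2 ^+ k = (b_ k ^+ 2)^-1 by rewrite b_sqr exprVn invrK.
by rewrite /T p2 /relative_bound /slope /=; field; rewrite bk g0.
Qed.

Let T_le k z : `|T k z| <= dom z.
Proof.
have aux (e m p q : R) : 0 < e -> e <= p -> p <= m -> e <= q -> q <= m -> `|q - p| <= m.
  by move=> *; rewrite ler_norml; apply/andP; split; lra.
have aux2 (s K : R) : `|s| <= K -> `|1 - s / 3 + 2 * s ^+ 2 / 3| <= 1 + K + 2 * K ^+ 2.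
  move=> sK; have s2 : s ^+ 2 <= K ^+ 2.
    by rewrite -[leLHS]real_normK ?num_real// lerXn2r ?nnegrE// (le_trans _ sK).
  have := sqr_ge0 s; have := sK; rewrite !ler_norml => /andP[? ?] ?.
  by apply/andP; split; lra.
have eM : eps <= M by case: gP => /(_ 0)/andP[g1 g2] _; exact: le_trans g1 g2.
have M0 : 0 < M by exact: lt_le_trans eM.
have Me : 0 <= M / eps by rewrite divr_ge0// ltW.
rewrite TE /=; pose r := slope k z.1 z.2 * b_ k / g z.1; rewrite -/r.
have rM : `|r| <= M / eps.
  have -> : r = (g (a_ k *: (z.1 : E) + b_ k *: (z.2 : E)) - g z.1) / g z.1.
    by rewrite /r /slope divfK// lt0r_neq0.
  rewrite normrM ler_pM// ?normfV ?(gtr0_norm (g_gt0 _)).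
    case: gP => gM _; have /andP[g1 g2] := gM z.1.
    have /andP[g3 g4] := gM (a_ k *: (z.1 : E) + b_ k *: (z.2 : E)).
    exact: (aux _ _ _ _ eps0).
  by rewrite lef_pV2 ?posrE//; case: gP => /(_ z.1)/andP[].
have f1 : `|1 - r / 3 + 2 * r ^+ 2 / 3| <= 1 + M / eps + 2 * (M / eps) ^+ 2.
  exact: aux2.
have gz : eps <= g z.1 by case: gP => /(_ z.1)/andP[].
have -> : dom z = (K2 * \sum_(i < n)
    (2 * inner (z.1 : E) (h i) ^+ 2 + 2 * inner (z.2 : E) (h i) ^+ 2)) / (2 * eps) *
    (1 + M / eps + 2 * (M / eps) ^+ 2).
  by rewrite /dom; field; exact: lt0r_neq0.
rewrite normrM ler_pM// ger0_norm ?divr_ge0 ?sqr_ge0 ?mulr_ge0 ?(ltW (g_gt0 _))//.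
rewrite ler_pM ?sqr_ge0 ?invr_ge0 ?mulr_ge0 ?(ltW (g_gt0 _)) ?slope_sqr_le//.
by rewrite lef_pV2 ?posrE ?mulr_gt0// ler_pM2l.
Qed.

Let T_cvg z : T k z @[k --> \oo] --> D z.1 z.2 ^+ 2 / (2 * g z.1).
Proof.
have cs := @slope_cvg z.1 z.2.
have c_cst (c : R) : c @[_ --> \oo] --> c by exact: cvg_cst.
pose r k := slope k z.1 z.2 * b_ k / g z.1.
have cr : r k @[k --> \oo] --> 0.
  have := seq_cvgM (seq_cvgM cs b_cvg) (c_cst (g z.1)^-1).
  by rewrite mulr0 mul0r.
have cf : 1 - r k * 3^-1 + 2 * 3^-1 * (r k * r k) @[k --> \oo] --> 1 - 0 * 3^-1 + 2 * 3^-1 * (0 * 0 : R).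
  apply: cvgD; last exact: seq_cvgM (c_cst _) (seq_cvgM cr cr).
  by apply: cvgB; [exact: c_cst|exact: seq_cvgM cr (c_cst _)].
have := seq_cvgM (seq_cvgM (seq_cvgM cs cs) (c_cst (2 * g z.1)^-1)) cf.
rewrite mul0r subr0 mulr0 mulr0 addr0 mulr1 -expr2; apply: cvg_trans.
apply: near_eq_cvg; apply: nearW => k /=; rewrite TE /=.
by rewrite !expr2; congr (_ * _); rewrite /r; ring.
Qed.

(** The dyadic bound holds for every [k], so its limit does too. With [D w x] the pairing of a
    gradient with [x], the inner integral over [x] is the covariance form of that gradient divided
    by [2 * g w]. *)
Lemma log_sobolev :
  (((\int[gamma]_x xlnx (g x))%R - xlnx (\int[gamma]_x g x)%R)%:E <=
   \int[gamma]_w \int[gamma]_x (D w x ^+ 2 / (2 * g w))%:E)%E.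
Proof.
have bT k : bounded_measurable (T k) by apply: bmZ; exact: relative_bound_bm.
have mT k : measurable_fun setT (T k) by case: (bT k).
have mD : measurable_fun setT (fun z : borel E * borel E => D z.1 z.2 ^+ 2 / (2 * g z.1)).
  by apply: (measurable_fun_cvg mT) => z _; exact: T_cvg.
rewrite -(fubini_tonelli1 (fun z : borel E * borel E => (D z.1 z.2 ^+ 2 / (2 * g z.1))%:E)); first last.
- by move=> z; rewrite lee_fin divr_ge0 ?sqr_ge0// mulr_ge0// ltW.
- exact/measurable_EFinP.
have [|||||_ _ lim] := @dominated_convergence _ _ _ (gamma \x gamma)%E setT measurableT
  (fun k => EFin \o T k) (EFin \o (fun z : borel E * borel E => D z.1 z.2 ^+ 2 / (2 * g z.1)))
  (EFin \o dom).
- by move=> k; exact/measurable_EFinP.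
- exact/measurable_EFinP.
- by apply: aeW => z _; apply: cvg_EFin; [exact: nearW|exact: T_cvg].
- exact: dom_integrable.
- by apply: aeW => z k _; rewrite /= lee_fin; exact: T_le.
rewrite -[leRHS](cvg_lim _ lim)//; apply: lime_ge; first exact: (cvgP _ lim).
apply: nearW => k /=.
rewrite (bm_integral_EFin (gamma \x gamma)%E (bT k)) lee_fin.
apply: (le_trans (entropy_dyadic k gP)).
rewrite (bm_integralZ _ _ (relative_bound_bm (a_ k) (b_ k) gP)) ler_wpM2l ?exprn_ge0//.
rewrite (bm_fubini1 gamma gamma (relative_bound_bm (a_ k) (b_ k) gP)).
apply: entropy_step_le => //; rewrite a_sqr b_sqr; ring.
Qed.

End LogSobolev.

(** * Cylindrical functions and powers *)

(** A directional derivative sees only the restriction to a line, so it transfers between functions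
    on different spaces that agree along lines. *)
Lemma is_derive_lines {R : realType} (V V' W : normedModType R) (f : V -> W)
    (f' : V' -> W) a v a' v' df :
  (forall t : R, f (t *: v + a) = f' (t *: v' + a')) ->
  is_derive a v f df -> is_derive a' v' f' df.
Proof.
move=> ff'; have E : f a = f' a' by have := ff' 0; rewrite !scale0r !add0r.
have fE : (fun t : R => t^-1 *: ((f \o shift a) (t *: v) - f a)) =
          (fun t : R => t^-1 *: ((f' \o shift a') (t *: v') - f' a')).
  by apply/funext => t /=; rewrite ff' E.
by move=> [dl dv]; apply: DeriveDef; [rewrite /derivable -fE|rewrite -dv /derive -fE].
Qed.

Section Cylinder.
Context {R : realType} {E : hilbertType R}.
Variable h : nat -> E.
Hypothesis hb : hilbert_basis h.
Variable n : nat.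

Definition coords (x : E) : 'rV[R]_n := \row_(i < n) inner x (h i).

Let coords_linear : linear coords.
Proof. by move=> a x y; apply/rowP => i; rewrite !mxE innerDl innerZl. Qed.

HB.instance Definition _ := GRing.isLinear.Build R E 'rV[R]_n *:%R coords coords_linear.

Lemma basis_norm i : `|h i| = 1.
Proof.
apply/eqP; rewrite -(@eqrXn2 _ 2)// -inner_norm hilbert_basisE// eqxx.
by rewrite expr1n.
Qed.

Lemma coords_le x : `|coords x| <= `|x|.
Proof.
have [/eqP x0|x0] := eqVneq `|coords x| 0; first by rewrite (eqP x0).
have [i xi] := mx_norm_neq0 x0.
rewrite [leLHS]xi mxE (le_trans (cauchy_schwarz _ _))// basis_norm mulr1//.
Qed.

Lemma coords_sqr_le x : `|coords x| ^+ 2 <= \sum_(i < n) inner x (h i) ^+ 2.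
Proof.
have [/eqP x0|x0] := eqVneq `|coords x| 0.
  by rewrite (eqP x0) expr0n/=; apply: sumr_ge0 => i _; exact: sqr_ge0.
have [i xi] := mx_norm_neq0 x0.
rewrite [X in X ^+ 2]xi mxE real_normK ?num_real// (bigD1 i.2)//= lerDl.
by apply: sumr_ge0 => j _; exact: sqr_ge0.
Qed.

Lemma coords_continuous : continuous coords.
Proof.
apply/linear_bounded_continuous; apply/ex_bound; exists 1.
have x1 : \forall x \near (0 : E), `|x| < 1.
  by apply: (@cvgr_norm_lt _ _ _ _ _ _ (0 : E)); [exact: cvg_id|rewrite normr0].
by apply: filterS x1 => x x1; rewrite /= (le_trans (coords_le _))// ltW.
Qed.

Variable phi : 'rV[R]_n -> R.
Hypothesis phi_diff : forall x, differentiable phi x.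
Hypothesis phi_bounded1 : op_bounded (fun x v => 'd phi x v).
Hypothesis phi_ucont1 : op_ucont_bounded (fun x v => 'd phi x v).

Let f x := phi (coords x).

Definition pderiv (i : 'I_n) (x : E) : R := 'd phi (coords x) (delta_mx 0 i).

Lemma pderiv_continuous i : continuous (pderiv i).
Proof.
move=> x; apply/cvgrPdist_le => e e0.
pose N := `|delta_mx 0 i : 'rV[R]_n| + 1.
have N0 : 0 < N by rewrite ltr_wpDl.
have [d d0 dP] := phi_ucont1 (`|coords x| + 1) (divr_gt0 e0 N0).
have cx : coords y @[y --> x] --> coords x by exact: coords_continuous.
near=> y; rewrite /pderiv (le_trans (dP _ _ _ _ _ _))//.
- by rewrite lerDl.
- near: y; apply: cvgr_norm_le; first exact: cx.
  by rewrite ltrDl.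
- near: y; exact: cvgr_dist_lt cx _ d0.
- rewrite mulrAC ler_pdivrMr// ler_pM2l// lerDl//.
Unshelve. all: by end_near. Qed.

Lemma pderivE x y : 'd phi (coords x) (coords y) =
  inner (\sum_(i < n) pderiv i x *: h i) y.
Proof.
rewrite [coords y]row_sum_delta linear_sum inner_suml; apply: eq_bigr => i _.
by rewrite linearZ/= mxE innerZl mulrC innerC.
Qed.

Lemma cylinder_differentiable x : differentiable f x.
Proof.
apply: (@differentiable_comp _ _ _ _ coords phi) => //.
by apply: linear_differentiable; exact: coords_continuous.
Qed.

(** Places the gradient in the span of the first [n] basis vectors, where the covariances are
    compared. [grad] is a choice, pinned down by its inner products. *)
Lemma grad_cylinder x : grad inner f x = \sum_(i < n) pderiv i x *: h i.
Proof.
have dE v : 'd f x v = inner (\sum_(i < n) pderiv i x *: h i) v.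
  rewrite -pderivE /f.
  rewrite (@diff_comp _ _ _ _ coords phi)//=; last first.
    by apply: linear_differentiable; exact: coords_continuous.
  by rewrite (diff_lin _ coords_continuous).
rewrite /grad; case: xgetP => [g _ gP|/(_ _ dE)//].
by apply: inner_ext => v; rewrite -dE gP.
Qed.

Lemma is_derive_cylinder x v : is_derive x v f (inner (grad inner f x) v).
Proof.
rewrite grad_cylinder -pderivE.
apply: (@is_derive_lines _ _ _ _ phi f (coords x) (coords v)).
  by move=> t; rewrite /f linearD linearZ.
by apply: DeriveDef; [exact: diff_derivable|rewrite deriveE].
Qed.

(** The increment is measured by the coordinates of [x - y], not by its full norm: this is what
    makes the later majorant integrable. *)
Lemma cylinder_lipschitz : exists2 K, 0 <= K &
  forall x y, `|f x - f y| <= K * `|coords (x - y)|.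
Proof.
have [K KP] := phi_bounded1; exists `|K| => // x y.
pose d := x - y.
have dF (s : R) : is_derive s 1 (fun s : R => f (y + s *: d))
    ('d phi (coords (y + s *: d)) (coords d)).
  apply: (@is_derive_lines _ _ _ _ f _ (y + s *: d) d).
    move=> t; rewrite (_ : t *: 1 = t :> R); last exact: mulr1.
    by rewrite scalerDl [X in _ = f X]addrCA.
  by rewrite pderivE -grad_cylinder; exact: is_derive_cylinder.
have [c _] := @MVT_is_derive R _ _ 0 1 ltr01 (fun s _ => dF s).
rewrite scale1r scale0r addr0 subr0 mulr1 /d [y + _]addrC subrK => ->.
rewrite (le_trans (KP _ _))// ler_wpM2r// ler_norm//.
Qed.

End Cylinder.

Section AbsPower.
Context {R : realType}.
Variable r : R.
Hypothesis r_ge2 : 2 <= r.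

Let r_gt0 : 0 < r. Proof. by apply: lt_le_trans r_ge2. Qed.
Let r1_gt0 : 0 < r - 1. Proof. by rewrite subr_gt0 (lt_le_trans _ r_ge2)// ltr1n. Qed.
Let r1_neq0 : r - 1 != 0. Proof. exact: lt0r_neq0. Qed.

Definition dabs_pow (v : R) := r * `|v| `^ (r - 1) * Num.sg v.

Lemma is_derive_abs_pow (v : R) :
  is_derive v 1 (fun u : R => `|u| `^ r) (dabs_pow v).
Proof.
rewrite /dabs_pow; have [v0|v0|->] := ltgtP v 0.
- rewrite ltr0_norm// ltr0_sg// mulrN1 -mulrN1.
  have dN : is_derive v 1 (fun u : R => - u) (-1) by apply: is_derive_eq.
  have v0' : 0 < - v by rewrite oppr_gt0.
  have := is_derive1_comp (is_derive1_powR r v0') dN.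
  apply: near_eq_is_derive; near=> u => /=; rewrite ltr0_norm//.
  by near: u; exact: lt_nbhsl.
- rewrite gtr0_norm// gtr0_sg// mulr1.
  apply: near_eq_is_derive (is_derive1_powR r v0); near=> u => /=.
  by rewrite gtr0_norm//; near: u; exact: lt_nbhsr.
- rewrite sgr0 mulr0.
  (* At 0 the quotient is at most [t] in absolute value, because the power [r >= 2] of a number in
     [0, 1] is below its square. *)
  suff lim : (fun t : R => t^-1 *: (`|t *: (1 : R) + 0| `^ r - `|0 : R| `^ r)) @ 0^' --> (0 : R).
    by apply: DeriveDef; [apply: cvgP lim|exact: cvg_lim lim].
  apply: norm_cvg0.
  apply: (@squeeze_cvgr _ _ _ _ (fun=> 0) (fun t => `|t|)); last 2 first.
  + exact: cvg_cst.
  + rewrite -[X in _ --> X](@normr0 R R); apply: cvg_norm; exact: cvg_within.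
  near=> t; rewrite normr_ge0/= normr0 powR0 ?gt_eqF// subr0 addr0.
  have t0 : t != 0 by near: t; exact: nbhs_dnbhs_neq.
  rewrite (_ : t *: (1 : R) = t); last exact: mulr1.
  rewrite normrM normfV (ger0_norm (powR_ge0 _ _)) mulrC ler_pdivrMr ?normr_gt0//.
  rewrite -expr2 -powR_mulrn// ger_powR// normr_gt0 t0/= ltW//.
  near: t; apply: dnbhs0_lt.
  exact: ltr01.
Unshelve. all: by end_near. Qed.

Lemma dabs_pow_sqr v : dabs_pow v ^+ 2 = r ^+ 2 * (`|v| `^ (r - 1)) ^+ 2.
Proof.
rewrite /dabs_pow !exprMn; have [->|v0] := eqVneq v 0.
  by rewrite sgr0 normr0 powR0// expr0n/= !mulr0.
by rewrite -[X in _ * X = _]real_normK ?num_real// normr_sg v0 expr1n mulr1.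
Qed.

(** Source of the constant [r ^+ 2 / 2]: the squared derivative contains the factor |v|^r, which
    cancels the denominator once [eps] is dropped. *)
Lemma dabs_pow_relative v eps : 0 < eps ->
  dabs_pow v ^+ 2 / (2 * (`|v| `^ r + eps)) <= r ^+ 2 / 2 * `|v| `^ (r - 2).
Proof.
move=> e0; rewrite dabs_pow_sqr.
have a0 := powR_ge0 `|v| r; have b0 := powR_ge0 `|v| (r - 2).
rewrite ler_pdivrMr; last by rewrite mulr_gt0// ltr_wpDl.
have -> : (`|v| `^ (r - 1)) ^+ 2 = `|v| `^ (r - 2) * `|v| `^ r.
  (* The law of exponents needs a nonzero base; at 0 both sides vanish, even if [r - 2 = 0] and the
     first factor is 1. *)
  have [->|v0] := eqVneq v 0.
    by rewrite normr0 (powR0 r1_neq0) (powR0 (lt0r_neq0 r_gt0)) expr0n/= mulr0.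
  have vn : `|v| != 0 by rewrite normr_eq0.
  rewrite expr2 -!powRD ?vn ?implybT//; congr (_ `^ _); ring.
have -> : r ^+ 2 / 2 * `|v| `^ (r - 2) * (2 * (`|v| `^ r + eps)) =
  r ^+ 2 * (`|v| `^ (r - 2) * `|v| `^ r) + r ^+ 2 * `|v| `^ (r - 2) * eps by field.
by rewrite lerDl mulr_ge0 ?mulr_ge0 ?sqr_ge0// ltW.
Qed.

Lemma abs_pow_lipschitz (B u v : R) : `|u| <= B -> `|v| <= B ->
  `| `|u| `^ r - `|v| `^ r | <= r * B `^ (r - 1) * `|u - v|.
Proof.
wlog uv : u v / v < u.
  move=> W uB vB; have [uv|vu|->] := ltgtP u v; last by rewrite !subrr normr0 mulr0.
    by rewrite distrC [X in _ * X]distrC; exact: W.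
  exact: W.
move=> uB vB; have [c /andP[vc cu] ->] := MVT_is_derive uv (fun s _ => is_derive_abs_pow s).
have cB : `|c| <= B.
  move: uB vB; rewrite !ler_norml => /andP[_ uB] /andP[vB _].
  by rewrite (le_trans vB (ltW vc)) (le_trans (ltW cu) uB).
rewrite normrM ler_wpM2r//.
rewrite /dabs_pow !normrM (gtr0_norm r_gt0) (ger0_norm (powR_ge0 _ _)).
have B0 : 0 <= B by exact: le_trans cB.
rewrite -[leRHS]mulr1 ler_pM// ?mulr_ge0 ?powR_ge0 ?(ltW r_gt0)//; last first.
  by rewrite normr_sg; case: (c != 0).
by rewrite ler_pM2l// ge0_ler_powR ?nnegrE// ltW.
Qed.

(* Young's inequality for [|x|] and [|y| `^ (r - 1)], with exponents [r] and
   [r / (r - 1)]. *)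
Lemma bregman_pow_ge0 (x y : R) : 0 <= bregman_pow r x y.
Proof.
rewrite /bregman_pow; set c := `|y|; have c0 : 0 <= c by exact: normr_ge0.
have Y : `|x| * c `^ (r - 1) <= `|x| `^ r / r + c `^ r * (r - 1) / r.
  have := @conjugate_powR R `|x| (c `^ (r - 1)) r (r / (r - 1)).
  rewrite normr_ge0 powR_ge0 divr_gt0// r_gt0 invf_div => /(_ isT isT isT isT).
  rewrite -powRrM [(r - 1) * _]mulrC divfK// -mulrA => -> //.
  by field; rewrite lt0r_neq0.
have cr : c * c `^ (r - 1) = c `^ r by rewrite mulr_powRB1.
have syx : Num.sg y * (x - y) <= `|x| - c.
  rewrite mulrBr -normrEsg lerD2r (le_trans (ler_norm _))// normrM.
  by rewrite ler_piMl// normr_sg; case: (y != 0).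
have s : r * c `^ (r - 1) * Num.sg y * (x - y) <= r * c `^ (r - 1) * (`|x| - c).
  by rewrite -mulrA ler_wpM2l// mulr_ge0 ?powR_ge0// ltW.
have {}Y : r * (`|x| * c `^ (r - 1)) <= `|x| `^ r + c `^ r * (r - 1).
  rewrite -(ler_pM2l r_gt0) in Y; apply: (le_trans Y); rewrite le_eqVlt; apply/orP; left.
  by apply/eqP; field; rewrite lt0r_neq0.
have e : r * c `^ (r - 1) * (`|x| - c) = r * (`|x| * c `^ (r - 1)) - r * c `^ r.
  by rewrite -cr; ring.
have f : c `^ r * (r - 1) = r * c `^ r - c `^ r by ring.
rewrite e in s; rewrite f in Y.
move: s Y; set p1 := _ * (x - y); set p2 := r * (_ * _); set p3 := _ `^ r; set p4 := c `^ r; set p5 := r * p4.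
by move=> *; lra.
Qed.

End AbsPower.

(** * Entropy of functions that may vanish *)

Section EntropyRegularization.
Context {R : realType}.

(** A majorant that stays bounded near 0, unlike [ln]; it dominates the regularized integrands
    uniformly in the shift. *)
Lemma xlnx_le_sqr (u : R) : 0 <= u -> `|xlnx u| <= u ^+ 2 + 1.
Proof.
rewrite le_eqVlt => /predU1P[<-|u0].
  by rewrite /xlnx mul0r normr0 addr_ge0 ?sqr_ge0.
have l := xlnx_ge u0 (@ltr01 R); rewrite ln1 mulr0 add0r in l.
have l2 : xlnx u <= u ^+ 2 by rewrite /xlnx expr2 ler_pM2l// ltW// ln_sublinear.
have u2 := sqr_ge0 u.
by rewrite ler_norml; apply/andP; split; lra.
Qed.

Lemma xlnx_cvg (u : R) (e : nat -> R) : 0 <= u -> (forall k, 0 < e k) ->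
  e k @[k --> \oo] --> 0 -> xlnx (u + e k) @[k --> \oo] --> xlnx u.
Proof.
move=> u0 e0 ce; move: u0; rewrite le_eqVlt => /predU1P[<-|u0]; last first.
  have cu : u + e k @[k --> \oo] --> u.
    by rewrite -[X in _ --> X]addr0; apply: seq_cvgD => //; exact: cvg_cst.
  apply: seq_cvgM => //.
  exact: (cvg_comp _ _ cu (continuous_ln u0)).
have xlnx0 : xlnx 0 = 0 :> R by rewrite /xlnx mul0r.
have cs : Num.sqrt (e k) @[k --> \oo] --> (0 : R).
  by rewrite -(@sqrtr0 R); apply: (cvg_comp _ _ ce); exact: sqrt_continuous.
have c2 : 2 * (e k - Num.sqrt (e k)) @[k --> \oo] --> (0 : R).
  have -> : 0 = 2 * (0 - 0) :> R by rewrite subrr mulr0.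
  by apply: seq_cvgM; [exact: cvg_cst|exact: cvgB].
have c3 : e k * e k @[k --> \oo] --> (0 : R).
  by rewrite -[X in _ --> X](mulr0 (0 : R)); exact: seq_cvgM.
rewrite xlnx0; apply: (squeeze_cvgr _ c2 c3); apply: nearW => k.
rewrite add0r; have ek := e0 k; have sk : 0 < Num.sqrt (e k) by rewrite sqrtr_gt0.
apply/andP; split; last by rewrite /xlnx ler_pM2l// ltW// ln_sublinear.
(* The tangent taken at the square root of [e k] yields the lower bound
   [2 * (e k - Num.sqrt (e k))], which tends to 0. *)
have := xlnx_ge ek sk; have -> : xlnx (e k) = 2 * (e k * ln (Num.sqrt (e k))).
  rewrite /xlnx -{2}(sqr_sqrtr (ltW ek)) lnXn// -mulr_natl; ring.
set p := _ * ln _; lra.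
Qed.

Context d (T : measurableType d) (P : probability T R).
Variables (psi : T -> R) (B : R).
Hypothesis mpsi : measurable_fun setT psi.
Hypothesis psiB : forall x, 0 <= psi x <= B.

Let bpsi : bounded_measurable psi.
Proof. by split => //; exists B => x; have /andP[? ?] := psiB x; rewrite ger0_norm. Qed.

Let psi_ge0 x : 0 <= psi x. Proof. by have /andP[] := psiB x. Qed.

Let xlnx_le_B (e : R) x : 0 <= e <= 1 -> `|xlnx (psi x + e)| <= (B + 1) ^+ 2 + 1.
Proof.
move=> /andP[e0 e1]; have /andP[p0 pB] := psiB x.
have pe : 0 <= psi x + e by rewrite addr_ge0.
rewrite (le_trans (xlnx_le_sqr pe))// lerD2r lerXn2r ?nnegrE ?lerD//.
by rewrite addr_ge0// (le_trans p0).
Qed.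

Let mxlnx (e : R) : measurable_fun setT (fun x => xlnx (psi x + e)).
Proof.
have me : measurable_fun setT (fun x => psi x + e) by exact: measurable_funD.
by apply: measurable_funM => //; apply: measurableT_comp => //; exact: measurable_ln.
Qed.

Lemma bm_xlnx : bounded_measurable (fun x => xlnx (psi x)).
Proof.
split; first by have := mxlnx 0; under eq_fun do rewrite addr0.
by exists ((B + 1) ^+ 2 + 1) => x; have := @xlnx_le_B 0 x; rewrite addr0; apply; rewrite lexx ler01.
Qed.

Lemma entropyE :
  entropy P psi = (\int[P]_x xlnx (psi x) - xlnx (\int[P]_x psi x))%R%:E.
Proof. by rewrite /entropy (bm_integral_EFin _ bm_xlnx) -EFinB. Qed.

Lemma entropy_regularization (I : \bar R) :
  (forall e : R, (0 < e)%R ->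
    ((\int[P]_x xlnx (psi x + e))%R - xlnx (\int[P]_x (psi x + e))%R)%:E <= I)%E ->
  (entropy P psi <= I)%E.
Proof.
move=> entI; rewrite entropyE.
pose e k : R := harmonic k.
have e0 k : 0 < e k by rewrite /e /= invr_gt0.
have e1 k : e k <= 1 by rewrite /e /= invf_le1 ?ler1n.
have ce : e k @[k --> \oo] --> 0 by exact: cvg_harmonic.
have [_ c1] := @dominated_cvg_prob _ _ _ P (fun k x => xlnx (psi x + e k))
  (fun x => xlnx (psi x)) ((B + 1) ^+ 2 + 1) (fun k => @mxlnx (e k))
  (fun k x => @xlnx_le_B (e k) x (introT andP (conj (ltW (e0 k)) (e1 k))))
  (fun x => xlnx_cvg (psi_ge0 x) e0 ce).
have m0 : 0 <= (\int[P]_x psi x)%R by apply: Rintegral_ge0.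
have c2 := xlnx_cvg m0 e0 ce.
have mE k : (\int[P]_x (psi x + e k))%R = (\int[P]_x psi x)%R + e k.
  by rewrite (bm_integralD P bpsi (bm_cst _ (e k))) prob_integral_cst.
have eI k := entI _ (e0 k).
case: I eI {entI} => [I| |] eI; last 2 first.
- by rewrite leey.
- by have := eI 0%N; rewrite leeNy_eq.
have cI : I @[_ --> \oo] --> I by exact: cvg_cst.
rewrite lee_fin; apply: (ler_cvg_to (cvgB c1 c2) cI); apply: nearW => k /=.
by have := eI k; rewrite lee_fin mE.
Qed.

(** Jensen's inequality by integrating the tangent at [c]: take [c] equal to the mean if it is
    positive, and let [c] tend to 0 otherwise. *)
Lemma entropy_ge0 : (0 <= entropy P psi)%E.
Proof.
rewrite entropyE lee_fin subr_ge0; set m := (\int[P]_x psi x)%R.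
have m0 : 0 <= m by apply: Rintegral_ge0.
have mc (c : R) : 0 < c -> m * ln c + m - c <= (\int[P]_x xlnx (psi x))%R.
  move=> c0.
  have b1 : bounded_measurable (fun x => psi x * (ln c + 1)) by apply: bmM => //; exact: bm_cst.
  have -> : m * ln c + m - c = (\int[P]_x (psi x * (ln c + 1) - c))%R.
    rewrite (bm_integralB P b1 (bm_cst _ c)) prob_integral_cst.
    under eq_Rintegral do rewrite mulrC.
    by rewrite (bm_integralZ _ _ bpsi) -/m; ring.
  apply: bm_le_integral; [exact: bmB b1 (bm_cst _ c)|exact: bm_xlnx|] => x.
  have := psi_ge0 x; rewrite le_eqVlt => /predU1P[<-|p0].
    by rewrite /xlnx !mul0r sub0r oppr_le0 ltW.
  by have := xlnx_ge p0 c0; rewrite mulrDr mulr1.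
move: m0; rewrite le_eqVlt => /predU1P[m0|m0]; last first.
  by have := mc _ m0; rewrite addrK.
rewrite -m0 /xlnx mul0r; apply/ler_addgt0Pr => c c0.
by have := mc _ c0; rewrite -m0 mul0r addr0 sub0r -lerBlDr sub0r.
Qed.

End EntropyRegularization.

(** * The Gaussian inequality for powers *)

Section PowerLogSobolev.
Context {R : realType} {E : hilbertType R}.
Hypothesis sepE : separable_space E.
Variable gamma : probability (borel E) R.
Hypothesis stable : forall (a b c : R) (G : E -> R) M,
  a ^+ 2 + b ^+ 2 = c ^+ 2 -> continuous G -> (forall x, `|G x| <= M) ->
  (\int[gamma]_x \int[gamma]_y G (a *: (x : E) + b *: (y : E)) =
   \int[gamma]_x G (c *: (x : E)))%R.
Variables (Qoo : E -> E).
Hypothesis moment2 : forall xi : E,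
  (\int[gamma]_x (inner xi x ^+ 2)%:E)%E = (inner (Qoo xi) xi)%:E.
Variable r : R.
Hypothesis r_ge2 : 2 <= r.
Variables (n : nat) (h : nat -> E) (u : E -> R) (G : E -> E) (W : E -> R).
Variables (B K K2 q0 : R).
Hypothesis q0_gt0 : 0 < q0.
Hypothesis K2_ge0 : 0 <= K2.
Hypothesis uB : forall x, `|u x| <= B.
Hypothesis uK : forall x y, `|u x - u y| <= K * `|x - y|.
Hypothesis uK2 : forall x y,
  (u x - u y) ^+ 2 <= K2 * \sum_(i < n) inner (x - y) (h i) ^+ 2.
Hypothesis du : forall w x, is_derive w x u (inner (G w) x).
Hypothesis cu : continuous u.
Hypothesis mG : measurable_fun setT ((fun w => inner (Qoo (G w)) (G w)) : borel E -> R).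
Hypothesis mW : measurable_fun setT (W : borel E -> R).
Hypothesis QG : forall w, q0 * inner (Qoo (G w)) (G w) <= W w.

Let r_gt0 : 0 < r. Proof. by apply: lt_le_trans r_ge2. Qed.

Let Qoo_ge0 xi : 0 <= inner (Qoo xi) xi.
Proof.
by rewrite -lee_fin -moment2; apply: integral_ge0 => x _; rewrite lee_fin sqr_ge0.
Qed.

Let W_ge0 w : 0 <= W w.
Proof. by rewrite (le_trans _ (QG w))// mulr_ge0// ltW. Qed.

Let B_ge0 : 0 <= B. Proof. exact: le_trans (uB 0). Qed.

Let g eps x : R := `|u x| `^ r + eps.
Let L := r * B `^ (r - 1).

Let L_ge0 : 0 <= L. Proof. by rewrite mulr_ge0 ?powR_ge0// ltW. Qed.

Let pow_lip x y : `| `|u x| `^ r - `|u y| `^ r| <= L * `|u x - u y|.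
Proof. exact: abs_pow_lipschitz. Qed.

Let pow_range x : 0 <= `|u x| `^ r <= B `^ r.
Proof. by rewrite powR_ge0 ge0_ler_powR ?nnegrE// ltW. Qed.

Let g_lip eps : bounded_lipschitz eps (B `^ r + eps) (L * K) (g eps).
Proof.
split=> [x|x y]; rewrite /g.
  by have /andP[? ?] := pow_range x; rewrite lerDr lerD2r; apply/andP.
by rewrite opprD addrACA subrr addr0 (le_trans (pow_lip _ _))// -mulrA ler_wpM2l.
Qed.

Let g_K2 eps x y :
  (g eps x - g eps y) ^+ 2 <= L ^+ 2 * K2 * \sum_(i < n) inner (x - y) (h i) ^+ 2.
Proof.
rewrite /g opprD addrACA subrr addr0 -mulrA -[leLHS]real_normK ?num_real//.
rewrite (le_trans (_ : _ <= (L * `|u x - u y|) ^+ 2))//.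
  by rewrite lerXn2r ?nnegrE//; exact: mulr_ge0.
by rewrite exprMn real_normK ?num_real// ler_wpM2l// sqr_ge0.
Qed.

Let g_derive eps w x :
  is_derive w x (g eps) (dabs_pow r (u w) * inner (G w) x).
Proof.
have d1 : is_derive (0 : R) 1 (fun t : R => u (w + t *: x)) (inner (G w) x).
  apply: is_derive_lines (du w x) => t.
  by rewrite (_ : t *: (1 : R) = t); [rewrite addr0 addrC|exact: mulr1].
have d2 : is_derive (u (w + 0 *: x)) 1 (fun v : R => `|v| `^ r + eps) (dabs_pow r (u w)).
  rewrite scale0r addr0 -[dabs_pow r (u w)]addr0.
  by have ? := is_derive_abs_pow r_ge2 (u w); exact: is_deriveD.
apply: is_derive_lines (is_derive1_comp d2 d1) => t.
rewrite [t *: x + w]addrC /g /=; congr (`|u (w + _ *: x)| `^ r + eps).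
by rewrite addr0; exact: mulr1.
Qed.

(** Here [u] stands for a translate of the cylindrical function, [G] for its gradient and [W] for
    the form of [Q] on it. Integrating the squared pairing with [G w] gives the form of [Qoo], and
    [QG] trades it for [W] at the cost of [q0^-1]. *)
Lemma entropy_pow_le :
  (entropy gamma (fun x => `|u x| `^ r)%R <=
   (r ^+ 2 / (2 * q0))%:E * \int[gamma]_w (`|u w| `^ (r - 2) * W w)%:E)%E.
Proof.
have mu : measurable_fun setT (u : borel E -> R) by exact: continuous_borel_measurable.
have mnu : measurable_fun setT (fun x : borel E => `|u x|) by exact: measurableT_comp.
have mpow (s : R) : measurable_fun setT (fun x : borel E => `|u x| `^ s).
  exact: (measurableT_comp (measurable_powR s) mnu).
apply: (entropy_regularization (mpow r) pow_range) => eps e0.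
apply: (le_trans (log_sobolev sepE stable e0 (g_lip eps) _ (g_K2 eps) (g_derive eps) _)).
- by rewrite mulr_ge0 ?sqr_ge0.
- by move=> xi; rewrite moment2 ltry.
rewrite -ge0_integralZl_EFin//; first last.
- by rewrite divr_ge0 ?sqr_ge0 ?mulr_ge0// ltW.
- by apply/measurable_EFinP; apply: measurable_funM => //; exact: mpow.
- by move=> w _; rewrite lee_fin mulr_ge0 ?powR_ge0.
have gP w : 0 < g eps w by rewrite /g ltr_wpDl ?powR_ge0.
have -> : (\int[gamma]_w \int[gamma]_x
      ((dabs_pow r (u w) * inner (G w) x) ^+ 2 / (2 * g eps w))%:E)%E =
    (\int[gamma]_w (dabs_pow r (u w) ^+ 2 / (2 * g eps w) *
      inner (Qoo (G w)) (G w))%:E)%E.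
  apply: eq_integral => w _; rewrite EFinM -moment2 -ge0_integralZl_EFin//; first last.
  - by rewrite divr_ge0 ?sqr_ge0// mulr_ge0// ltW.
  - apply/measurable_EFinP; apply: measurable_funX; exact: inner_borel_measurable.
  - by move=> x _; rewrite lee_fin sqr_ge0.
  by apply: eq_integral => x _; rewrite -EFinM exprMn mulrAC.
have mg : measurable_fun setT (g eps : borel E -> R) by exact: measurable_funD.
apply: ge0_le_integral => //.
- by move=> w _; rewrite lee_fin mulr_ge0// divr_ge0 ?sqr_ge0// mulr_ge0// ltW.
- apply/measurable_EFinP; apply: measurable_funM => //.
  under eq_fun do rewrite dabs_pow_sqr//.
  apply: measurable_funM; last first.
    under eq_fun => w do rewrite -powR_inv1 ?mulr_ge0 ?(ltW (gP w))//.
    by apply: (measurableT_comp (measurable_powR (-1))); exact: measurable_funM.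
  by apply: measurable_funM => //; apply: measurable_funX; exact: mpow.
- apply/measurable_EFinP; apply: measurable_funM => //.
  by apply: measurable_funM => //; exact: mpow.
- move=> w _; rewrite -EFinM lee_fin.
  rewrite (le_trans (ler_wpM2r (Qoo_ge0 _) (dabs_pow_relative r_ge2 (u w) e0)))//.
  have -> : r ^+ 2 / (2 * q0) * (`|u w| `^ (r - 2) * W w) =
    r ^+ 2 / 2 * `|u w| `^ (r - 2) * (q0^-1 * W w).
    by field; exact: lt0r_neq0.
  rewrite ler_wpM2l//; last by rewrite mulrC ler_pdivlMr// mulrC.
  by rewrite mulr_ge0 ?powR_ge0// divr_ge0 ?sqr_ge0.
Qed.

End PowerLogSobolev.

(** * Integrals against the convolution *)

Section Convolution.
Context {R : realType} {E : hilbertType R}.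
Hypothesis sepE : separable_space E.
Variables gamma ppi : probability (borel E) R.

Lemma ge0_integral_convolution (F : E -> R) : (forall x, 0 <= F x) ->
  measurable_fun setT (F : borel E -> R) ->
  (\int[convolution gamma ppi]_x (F x)%:E =
   \int[ppi]_y \int[gamma]_x (F ((x : E) + (y : E))%R)%:E)%E.
Proof.
move=> F0 mF; have madd := add_borel_measurable sepE.
rewrite /convolution ge0_integral_pushforward//; first last.
- by move=> x _; rewrite lee_fin.
- exact/measurable_EFinP.
rewrite preimage_setT fubini_tonelli2//.
- by apply/measurable_EFinP; exact: (measurableT_comp mF madd).
- by move=> z; rewrite /= lee_fin.
Qed.

(** [convolution] is a bare set function; measurability of addition makes it a measure. The
    integrand is an arbitrary nonnegative function, so this applies directly to the inner integral
    of the jump term. *)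
Lemma integral_convolution_ge0 (F : E -> \bar R) : (forall x, 0 <= F x)%E ->
  (0 <= \int[convolution gamma ppi]_x F x)%E.
Proof.
move=> F0.
apply: (integral_ge0 (measure_function_pushforward__canonical__measure_function_Measure
  (gamma \x ppi)%E (add_borel_measurable sepE))) => x _; exact: F0.
Qed.

Lemma entropy_translate_measurable (F : E -> R) (B : R) :
  measurable_fun setT (F : borel E -> R) -> (forall x, 0 <= F x <= B) ->
  measurable_fun setT
    (fun y : borel E => entropy gamma (fun x => F ((x : E) + (y : E)))).
Proof.
move=> mF FB; have madd := add_borel_measurable sepE.
have mFz : measurable_fun setT (fun z : borel E * borel E => F ((z.1 : E) + (z.2 : E))).
  exact: (measurableT_comp mF madd).
have bF : bounded_measurable (fun z : borel E * borel E => F ((z.1 : E) + (z.2 : E))).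
  by split => //; exists B => z; have /andP[? ?] := FB (z.1 + z.2); rewrite ger0_norm.
have bX := bm_xlnx mFz (fun z => FB (z.1 + z.2)).
have [m1 _] := bm_fubini_G gamma gamma bF.
have [m2 _] := bm_fubini_G gamma gamma bX.
under eq_fun => y.
  rewrite (@entropyE _ _ _ gamma _ B); last 2 first.
  - exact: (measurableT_comp mFz (pair2_measurable y)).
  - by move=> x; exact: FB.
  over.
apply/measurable_EFinP; apply: measurable_funB => //.
by apply: measurable_funM => //; apply: measurableT_comp => //; exact: measurable_ln.
Qed.

End Convolution.

(** [Qoo] is known only through its form, so measurability is read off the finite expansion in
    coordinates. *)
Lemma measurable_quadratic {R : realType} {E : hilbertType R} (T : E -> E) n
    (h : nat -> E) (c : 'I_n -> E -> R) :
  (forall (a : 'I_n -> R) y, inner (T (\sum_(i < n) a i *: h i)) y =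
    \sum_(i < n) a i * inner (T (h i)) y) ->
  (forall i, measurable_fun setT (c i : borel E -> R)) ->
  measurable_fun setT ((fun x => inner (T (\sum_(i < n) c i x *: h i))
    (\sum_(i < n) c i x *: h i)) : borel E -> R).
Proof.
move=> Tsum mc; under eq_fun do rewrite Tsum.
apply: measurable_sum => i; apply: measurable_funM => //.
under eq_fun do rewrite inner_sumr.
apply: measurable_sum => j; under eq_fun do rewrite innerZr.
exact: measurable_funM.
Qed.

Unset Implicit Arguments.
Set Strict Implicit.
Set Printing Implicit Defensive.

Theorem theorem6p5 (R : realType) (E : hilbertType R)
    (sepE : separable_space E)
    (b : E)
    (Q : {linear E -> E}) (Q_tc : nonneg_sym_trace_class Q)
    (nu : {measure set (borel E) -> \bar R}) (nu_levy : levy_measure nu)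
    (S : R -> {linear E -> E}) (S_C0 : C0_semigroup S)
    (P : R -> (E -> R) -> E -> R) (P_mehler : mehler_semigroup b Q nu S P)
    (A_neg : forall x, gen_dom S x -> x != 0 -> inner (gen S x) x < 0)
    (h : nat -> E) (alpha : nat -> R)
    (h_eigen : adjoint_eigenbasis S h alpha)
    (nu_mom : (\int[nu]_(x in [set x : borel E | (1 <= `|x : E|)%R])
                 (`|x : E|%R)%:E < +oo)%E)
    (Qoo : E -> E) (Qoo_def : is_Q_infty Q S Qoo)
    (nuoo : {measure set (borel E) -> \bar R})
    (nuoo_def : is_nu_infty nu S nuoo)
    (boo : E) (boo_def : is_b_infty b nu S boo)
    (gamma : probability (borel E) R)
    (gamma_def : is_centered_gaussian Qoo gamma)
    (ppi : probability (borel E) R) (ppi_def : is_jump_part boo nuoo ppi)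
    (q0 : R) (q0_def : mehler_rate gamma S = q0%:E) (q0_gt0 : 0 < q0)
    (r : R) (r_ge2 : 2 <= r)
    (f : E -> R) (f_FC2A : FC2A h alpha f) :
  (\int[ppi]_y entropy gamma (fun x => (`|f ((x : E) + (y : E))| `^ r)%R)
   <= (r ^+ 2 / (2 * q0))%:E *
        \int[convolution gamma ppi]_x
          (`|f x| `^ (r - 2) * inner (Q (grad inner f x)) (grad inner f x))%:E
    + (r / ((r - 1) * q0))%:E *
        \int[convolution gamma ppi]_x
          \int[nu]_y (bregman_pow r (f ((x : E) + (y : E))%R) (f x))%:E)%E.
Proof.
have hb : hilbert_basis h := h_eigen.1.
have QooZ' := QooZ S_C0 h_eigen Qoo_def.
have moment2 := gaussian_moment2 gamma_def QooZ'.
have stable := gaussian_stable gamma_def QooZ' sepE hb.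
have r_gt0 : 0 < r by apply: lt_le_trans r_ge2.
case: f_FC2A => n [phi [phiC fE]].
have {fE} fE : f = fun x => phi (coords h n x) by apply/funext => x; rewrite fE.
have phi_diff := C2A_diff1 phiC; have phi_b1 := C2A_bounded1 phiC.
have phi_u1 := C2A_ucont1 phiC.
pose p := pderiv h (n := n) phi.
have gradE x : grad inner f x = \sum_(i < n) p i x *: h i.
  by rewrite fE (grad_cylinder hb phi_diff).
have df x v : is_derive x v f (inner (grad inner f x) v).
  by rewrite fE; exact: is_derive_cylinder.
have cf : continuous f.
  move=> x; apply: differentiable_continuous; rewrite fE.
  exact: cylinder_differentiable.
have mf : measurable_fun setT (f : borel E -> R) by exact: continuous_borel_measurable.
have mp i : measurable_fun setT (p i : borel E -> R).
  by apply: continuous_borel_measurable; exact: pderiv_continuous.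
have [B fB] : exists B, forall x, `|f x| <= B.
  (* [bounded_fun] bounds the function by every constant strictly above a threshold, whence
     [B + 1]. *)
  have [B [_ HB]] := C2A_bounded phiC.
  by exists (B + 1) => x; rewrite fE; apply: HB => //; rewrite ltrDl.
have [K K0 fK] := cylinder_lipschitz hb phi_diff phi_b1.
pose W x := inner (Q (grad inner f x)) (grad inner f x).
have W0 x : 0 <= W x by case: Q_tc => _ _ + _; exact.
have mW : measurable_fun setT (W : borel E -> R).
  rewrite /W; under eq_fun do rewrite gradE.
  apply: measurable_quadratic => // a y.
  by rewrite linear_sum inner_suml; apply: eq_bigr => i _; rewrite linearZ innerZl.
have mQ : measurable_fun setT
    ((fun x => inner (Qoo (grad inner f x)) (grad inner f x)) : borel E -> R).
  under eq_fun do rewrite gradE.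
  apply: measurable_quadratic => // a y.
  rewrite (Qoo_suml S_C0 h_eigen Qoo_def); apply: eq_bigr => i _.
  by rewrite (QooZl S_C0 h_eigen Qoo_def).
have QW x : q0 * inner (Qoo (grad inner f x)) (grad inner f x) <= W x.
  rewrite /W gradE.
  exact: (Q_ge_rate_Qoo Q_tc S_C0 A_neg h_eigen Qoo_def _ gamma_def q0_def).
have mshift (y : E) : measurable_fun setT ((fun x : E => x + y) : borel E -> borel E).
  apply: continuous_borel_map => x.
  by apply: cvgD; [exact: cvg_id|exact: cvg_cst].
pose F x := `|f x| `^ r; pose D x := `|f x| `^ (r - 2) * W x.
have mpow (s : R) : measurable_fun setT ((fun x => `|f x| `^ s) : borel E -> R).
  by apply: (measurableT_comp (measurable_powR s)); exact: measurableT_comp.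
have F0 x : 0 <= F x <= B `^ r.
  by rewrite powR_ge0 ge0_ler_powR ?nnegrE ?(ltW r_gt0)// (le_trans _ (fB x)).
have D0 x : 0 <= D x by rewrite mulr_ge0 ?powR_ge0.
have mD : measurable_fun setT (D : borel E -> R).
  by apply: measurable_funM => //; exact: mpow.
have mDz : measurable_fun setT (fun z : borel E * borel E => (D ((z.1 : E) + (z.2 : E)))%:E).
  by apply/measurable_EFinP; exact: (measurableT_comp mD (add_borel_measurable sepE)).
have mDy : measurable_fun setT
    (fun y : borel E => (\int[gamma]_x (D ((x : E) + (y : E))%R)%:E)%E).
  apply: (measurable_fun_fubini_tonelli_G (m1 := gamma) _ mDz) => z.
  by rewrite lee_fin.
have q0r : 0 <= r ^+ 2 / (2 * q0) by rewrite divr_ge0 ?sqr_ge0 ?mulr_ge0// ltW.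
(* The gradient of a translate is the translated gradient, still in the span of the [h i], so the
   constants are the same for every [y]; [K ^+ 2] is the square of the Lipschitz constant in the
   coordinates. *)
have ent y : (entropy gamma (fun x => F ((x : E) + y)%R) <= (r ^+ 2 / (2 * q0))%:E *
    \int[gamma]_x (D ((x : E) + y)%R)%:E)%E.
  have H := @entropy_pow_le _ _ sepE gamma stable Qoo moment2 r r_ge2 n h
    (fun x => f (x + y)) (fun x => grad inner f (x + y)) (fun x => W (x + y)) B K (K ^+ 2) q0.
  apply: (H q0_gt0 (sqr_ge0 K)) => {H}.
  - by move=> x.
  - move=> x x'; rewrite fE (le_trans (fK _ _))// opprD addrACA subrr addr0 ler_wpM2l//.
    exact: coords_le.
  - move=> x x'; rewrite fE -[leLHS]real_normK ?num_real//.
    rewrite (le_trans (_ : _ <= (K * `|coords h n (x - x')|) ^+ 2))//.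
      rewrite lerXn2r ?nnegrE ?mulr_ge0//; have := fK (x + y) (x' + y).
      by rewrite opprD addrACA subrr addr0.
    by rewrite exprMn ler_wpM2l ?sqr_ge0// coords_sqr_le.
  - move=> w x; apply: is_derive_lines (df (w + y) x) => t.
    by rewrite addrA.
  - move=> x; apply: continuous_comp; last exact: cf.
    by apply: cvgD; [exact: cvg_id|exact: cvg_cst].
  - exact: (measurableT_comp mQ (mshift y)).
  - exact: (measurableT_comp mW (mshift y)).
  - by move=> x.
(* The jump term is split off by its sign; the gradient term alone dominates. *)
apply: (@le_trans _ _ ((r ^+ 2 / (2 * q0))%:E * \int[convolution gamma ppi]_x (D x)%:E)%E); last first.
  apply: leeDl; apply: mule_ge0.
    by rewrite lee_fin divr_ge0 ?mulr_ge0 ?(ltW q0_gt0) ?(ltW r_gt0)// subr_ge0 (le_trans _ r_ge2)// ler1n.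
  apply: integral_convolution_ge0 => // x; apply: integral_ge0 => y _.
  by rewrite lee_fin bregman_pow_ge0.
rewrite (ge0_integral_convolution sepE)// -ge0_integralZl_EFin//; last first.
  by move=> y _; apply: integral_ge0 => x _; rewrite lee_fin.
(* Monotonicity is applied to entropies that are nonnegative, by Jensen's inequality, and measurable
   in [y]. *)
apply: ge0_le_integral => //.
- move=> y _; have mFy := measurableT_comp (mpow r) (mshift y).
  exact: (@entropy_ge0 _ _ _ gamma _ (B `^ r) mFy (fun x => F0 (x + y))).
- exact: (entropy_translate_measurable sepE gamma (mpow r) F0).
- exact: measurable_funeM.
- by move=> y _; exact: ent.
Qed.
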